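(* Fix an integer $k\geq 1$. There exist $2$-coloured geometric simplicial complexes $\mathsf Q_n$, one for each $n\geq 2k+1$, with $\mathsf Q_n$ lying in $\mathbb R^{n-2k+1}$, whose black vertices are labelled bijectively by the elements of $\mathcal V_n^k$ and whose white vertices are labelled bijectively by the elements of $\mathcal V_n^k$, such that for every $n\geq 2k+1$: (i) $\mathsf Q_n$ is an antisymmetric triangulation of the sphere $S^{n-2k}$ such that no face contains a pair of antipodal vertices; (ii) $\mathsf Q_n$ contains no monochromatic maximal faces; (iii) the associated graph of $\mathsf Q_n$ is a spanning subgraph of $SG(n,k)$: every element of $\mathcal V_n^k$ labels a vertex of $\mathsf Q_n$, and whenever the black vertex labelled $A$ and the white vertex labelled $B$ are joined by an edge of $\mathsf Q_n$, the sets $A$ and $B$ are disjoint (i.e. adjacent in $SG(n,k)$); (iv) for $n>2k+1$, $\mathsf Q_n$ contains $\mathsf Q_{n-1}$ (with its colouring and labelling) as an antisymmetric subcomplex.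
   Context: $C_n$ is the cycle on $[n]=\{1,\dots,n\}$ with edges $\{i,i+1\}$ ($1\le i<n$) and $\{n,1\}$; $\mathcal V_n^k$ denotes the set of all $k$-element subsets of $[n]$ that are independent in $C_n$. The Schrijver graph $SG(n,k)$ has vertex set $\mathcal V_n^k$, two sets being adjacent iff they are disjoint. A geometric simplicial complex in $\mathbb R^d$ is a simplicial complex whose vertices are assigned points of $\mathbb R^d$ so that each face's points are affinely independent and relative interiors of convex hulls of distinct faces are disjoint; it triangulates a space $X$ if the union of its faces is homeomorphic to $X$. A $2$-coloured complex is one whose vertices are each coloured black or white; a face is monochromatic if all its vertices have the same colour. The antipode of a point $p$ is $-p$. A $2$-coloured complex is antisymmetric if for every vertex $v$, the point $-v$ is also a vertex and $v$, $-v$ have different colours. The associated graph of an antisymmetric $2$-coloured complex triangulating a sphere has as vertices the vertices of the complex and as edges those $1$-dimensional faces with one black and one white end. *)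

(* Defs.v *)
From HB Require Import structures.
From mathcomp Require Import all_boot all_order all_algebra.
From mathcomp Require Import all_classical all_reals all_analysis.

Set Implicit Arguments.
Unset Strict Implicit.
Unset Printing Implicit Defensive.

Import Order.TTheory GRing.Theory Num.Theory.
Import numFieldNormedType.Exports.

Local Open Scope classical_set_scope.
Local Open Scope ring_scope.

                                                                          
                                                                                
Definition cycle_adj (n : nat) : rel 'I_n :=
  fun i j => (j == ordS i) || (i == ordS j).

Definition independent (T : finType) (e : rel T) (A : {set T}) : bool :=
  [forall i in A, forall j in A, ~~ e i j].

Definition schrijver_vertices (n k : nat) : {set {set 'I_n}} :=
  [set A : {set 'I_n} | (#|A| == k) && independent (@cycle_adj n) A]%SET.

Definition schrijver_adj (n k : nat) : rel {set 'I_n} :=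
  fun A B => [&& A \in schrijver_vertices n k, B \in schrijver_vertices n k
               & [disjoint A & B]].

                                                                           
                            
Definition widen_set (m n : nat) (A : {set 'I_m}) : {set 'I_n} :=
  [set j : 'I_n | [exists i in A, val i == val j]]%SET.

Definition pad_row (R : realType) (d e : nat) (x : 'rV[R]_d) : 'rV[R]_e :=
  \row_(j < e) (if insub (val j) is Some i then x ord0 i else 0).

Section Hulls.
Variables (R : realType) (d : nat) (V : finType) (p : V -> 'rV[R]_d).
Implicit Types F : {set V}.

Definition affinely_independent F : Prop :=
  forall c : V -> R,
    \sum_(v in F) c v = 0 -> \sum_(v in F) c v *: p v = 0 ->
    forall v, v \in F -> c v = 0.

Definition affine_hull F : set 'rV[R]_d :=
  [set x | exists c : V -> R,
     \sum_(v in F) c v = 1 /\ x = \sum_(v in F) c v *: p v].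

Definition convex_hull F : set 'rV[R]_d :=
  [set x | exists c : V -> R,
     [/\ forall v, v \in F -> 0 <= c v, \sum_(v in F) c v = 1
       & x = \sum_(v in F) c v *: p v]].

Definition relative_interior F : set 'rV[R]_d :=
  [set x | convex_hull F x /\
     \forall y \near x, affine_hull F y -> convex_hull F y].

End Hulls.

                                                    
Record geometric_complex (R : realType) (d : nat) := GeometricComplex {
  vertex : finType;
  face : {set {set vertex}};
  point : vertex -> 'rV[R]_d;
  face_vertex : forall v : vertex, [set v]%SET \in face;
  face_neq0 : forall F : {set vertex}, F \in face -> F != finset.set0;
  face_closed : forall F G : {set vertex},
    F \in face -> G \subset F -> G != finset.set0 -> G \in face;
  face_affinely_independent : forall F : {set vertex},
    F \in face -> affinely_independent point F;
  face_disjoint : forall F G : {set vertex}, F \in face -> G \in face ->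
    F != G ->
    relative_interior point F `&` relative_interior point G = set0
}.

Record coloured_complex (R : realType) (d : nat) := ColouredComplex {
  complex_of :> geometric_complex R d;
  black : pred (vertex complex_of)
}.

Definition homeomorphic (T U : topologicalType) (A : set T) (B : set U)
    : Prop :=
  exists (f : T -> U) (g : U -> T),
    [/\ {within A, continuous f} /\ {within B, continuous g},
        (forall x, A x -> B (f x)), (forall y, B y -> A (g y)),
        (forall x, A x -> g (f x) = x) & (forall y, B y -> f (g y) = y)].

Definition unit_sphere (R : realType) (m : nat) : set 'rV[R]_m.+1 :=
  [set x : 'rV[R]_m.+1 | \sum_(i < m.+1) x ord0 i ^+ 2 = 1].

Section Complexes.
Variables (R : realType) (d : nat).

Definition polyhedron (K : geometric_complex R d) : set 'rV[R]_d :=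
  [set x | exists2 F : {set vertex K},
     F \in face K & convex_hull (@point R d K) F x].

Definition triangulates (K : geometric_complex R d) (T : topologicalType)
    (X : set T) : Prop :=
  homeomorphic (polyhedron K) X.

Variable K : coloured_complex R d.

Definition antisymmetric_complex : Prop :=
  forall v : vertex K, exists w : vertex K,
    point w = - point v /\ black w != black v.

Definition no_antipodal_face : Prop :=
  forall F : {set vertex K}, F \in face K ->
    forall v w, v \in F -> w \in F -> point w <> - point v.

Definition monochromatic (F : {set vertex K}) : bool :=
  [forall v in F, forall w in F, black v == black w].

Definition maximal_face (F : {set vertex K}) : bool :=
  maxset [pred G : {set vertex K} | G \in face K] F.

Definition associated_graph : rel (vertex K) :=
  fun u v => (black u != black v) && ([set u; v]%SET \in face K).

Definition bijectively_labelled (L : finType) (lab : vertex K -> L)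
    (S : {set L}) (b : bool) : Prop :=
  let Vb := [set v : vertex K | black v == b]%SET in
  {in Vb &, injective lab} /\ [set lab v | v in Vb]%SET = S.

End Complexes.

Definition labelled_subcomplex (R : realType) (d e m n : nat)
    (K : coloured_complex R d) (labK : vertex K -> {set 'I_m})
    (L : coloured_complex R e) (labL : vertex L -> {set 'I_n}) : Prop :=
  exists f : vertex K -> vertex L,
    [/\ injective f,
        (forall v, point (f v) = pad_row e (point v)),
        (forall v, black (f v) = black v),
        (forall v, labL (f v) = widen_set n (labK v))
      & (forall F : {set vertex K},
           F \in face K -> [set f v | v in F]%SET \in face L)].

(* Main.v *)
(* Put n = 2k + d. The complex Q_n is the boundary of the convex hull of points p_A
   and -p_A of R^(d+1), A ranging over the stable k-sets of the n-cycle, with the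
   p_A black and the -p_A white. A face consists of points at which some nonzero
   linear functional y is maximal. Three properties of the points give the theorem.
   Points maximal for the same y are linearly independent, so the polytope is
   simplicial. There are vectors w_1, ..., w_n with y.w_i > 0 for all i in A whenever
   p_A is maximal for y; hence A and B are disjoint if p_A and -p_B share a face. At
   most d points p_A are maximal for a given y, so that no facet is monochromatic.

   The points are built by induction on d. Besides the points p_A (layer 0) one keeps
   auxiliary configurations, layer l for 0 < l <= k carrying the (k-l)-sets that are
   stable in the cycle on l+1, ..., n-l. Passing from n-1 to n, a set of layer l
   is the union of a set C of a layer m >= l and a set depending on l, m and n only,
   and it is put at (u^m P_m(C), +- t_m + generic error) for a small u: a copy of
   layer m shrunk by u^m and lifted to a height t_m of sign depending on the parity
   of m. The functional y = (y', v) then selects layers m on a scale determined by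
   the ratio of |y'| and |v|, and inside a layer it acts as y'. Old points of layer 0
   keep height 0, so Q_(n-1) is a subcomplex.

   Radial projection identifies the boundary of the hull, which is the unit level set
   of its gauge function, with the sphere. *)
Require Import Defs.
From mathcomp Require Import all_boot all_order all_algebra.
From mathcomp Require Import all_classical all_reals all_analysis.
From mathcomp Require Import zify ring lra.
Import numFieldNormedType.Exports.

Set Implicit Arguments.
Unset Strict Implicit.
Unset Printing Implicit Defensive.

Import Order.TTheory GRing.Theory Num.Theory.

(** * Stable sets *)

(** Call the head m of a cell its type. Heights have the sign (-1)^(m+1), and every removed position
    j of a set of type m has m - j odd, so one sign (-1)^j in the last coordinate of the witness of
    position j serves all m. Horizontally type m has size u^m |y'|, while heights of successive
    types differ by about u^(4m + const) |v|; so the optimal type changes where |y'|/|v| is about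
    u^(3m + const). The spacing 3 leaves room for witness coordinates u^(3j) between consecutive
    thresholds.

    Because of the generic errors, a cell optimal for y is only nearly optimal for y'. A compactness
    margin e replaces the whole pattern of nearly optimal cells and small witness values by an exact
    pattern of another functional, to which the induction hypothesis applies.

    The bound on black points does not close under induction, as points of types 0 and 1 may be
    optimal together. What closes is the number of optimal black points plus that of optimal points
    of layer 1: it grows by at most 1 per dimension, because the errors of layers 0 and 1 are chosen
    separately. *)

(* A cell of [ladder k d] valid at l encodes a (k - l)-set that is stable in the
   cycle on l + 1, ..., n - l, where n = 2k + d. The head m of a cell gives the
   layer, at n - 1, of the set that remains once the elements listed by [rim l m n]
   are removed; at d = 0 the bit selects one of the two classes modulo 2. *)
Fixpoint ladder (k d : nat) : finType :=
  if d is d'.+1 then ('I_k.+1 * ladder k d')%type : finType else bool.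

Arguments ladder : simpl never.

Fixpoint valid (k d l : nat) : ladder k d -> bool :=
  match d return ladder k d -> bool with
  | 0 => fun b => (l < k) || (l == k) && b
  | d'.+1 => fun c => (l <= c.1) && valid c.1 c.2
  end.
Arguments valid {k} d l c.

Definition rim (l m n i : nat) : bool :=
  [&& i <= n, l <= n - i, n - i < m & odd (m - (n - i))]
  || [&& l < i, i < m & odd (m - i)].

Fixpoint lab (k d l : nat) : ladder k d -> nat -> bool :=
  match d return ladder k d -> nat -> bool with
  | 0 => fun b i => [&& l < i, i + l <= k.*2 & odd i (+) b]
  | d'.+1 => fun c i => rim l c.1 (k.*2 + d'.+1) i || lab c.1 c.2 i
  end.
Arguments lab {k} d l c i.

(** Predicates on [nat] let n and l vary without casts between ordinals. The guard [l.*2.+1 < n]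
    says that the interval has at least two elements; in a singleton the two ends coincide and are
    not neighbours. *)
Definition stable_in (k l n : nat) (A : nat -> bool) : Prop :=
  [/\ forall i, A i -> l < i /\ i + l <= n,
      \sum_(i < n.+1) A i + l = k,
      forall i, A i -> A i.+1 -> False
    & l.*2.+1 < n -> A l.+1 -> A (n - l) -> False].

Lemma stable_in_ext k l n A B :
  A =1 B -> stable_in k l n A -> stable_in k l n B.
Proof.
move=> AB [a b c e]; split.
- by move=> i; rewrite -AB; apply: a.
- by rewrite -b; congr addn; apply: eq_bigr => i _; rewrite AB.
- by move=> i; rewrite -!AB; apply: c.
- by rewrite -!AB.
Qed.

Lemma sum_bool_add1 n (A B : nat -> bool) j :
  j <= n -> ~~ B j -> (forall i, A i = B i || (i == j)) ->
  \sum_(i < n.+1) A i = (\sum_(i < n.+1) B i).+1.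
Proof.
move=> jn Bj AB.
have -> : \sum_(i < n.+1) A i = \sum_(i < n.+1) (B i + (i == j :> nat)).
  apply: eq_bigr => i _; rewrite AB.
  by case: eqP => [->|]; rewrite ?(negbTE Bj) ?orbF ?addn0 ?orbT.
rewrite big_split /= -[RHS]addn1; congr addn.
rewrite (bigD1 (Ordinal (jn : j < n.+1))) //= eqxx big1 // => i.
by rewrite -val_eqE /= => /negbTE ->.
Qed.

(* The sets of layer l for n that are not sets of layer l for n - 1 are exactly
   the sets [grow l n A] with A in layer l + 1. *)
Definition grow (l n : nat) (A : nat -> bool) (i : nat) : bool :=
  A i || (i == if A (n - l.+1) then l.+1 else n - l).

Lemma grow_ext l n A B : A =1 B -> grow l n A =1 grow l n B.
Proof. by move=> AB i; rewrite /grow !AB. Qed.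

(** The new element is an end of the longer interval. The right end n - l is safe unless A contains
    n - l - 1; in that case cyclic stability of A excludes l + 2, so the left end l + 1 is safe. *)
Lemma stable_in_grow k l n A :
  l < k -> k.*2 <= n -> stable_in k l.+1 n A -> stable_in k l n (grow l n A).
Proof.
move=> lk kn [supp siz sep cyc].
have A1 i : i <= l.+1 -> ~~ A i.
  by move=> il; apply/negP => /supp; lia.
have A2 i : n - l <= i -> ~~ A i.
  by move=> il; apply/negP => /supp; lia.
have kA i : A i -> l.+1 < k.
  move=> Ai; have [_ i_n] := supp _ Ai.
  have i_n' : i < n.+1 by lia.
  by rewrite -siz (bigD1 (Ordinal i_n')) //= Ai; lia.
set j := if A (n - l.+1) then l.+1 else n - l.
have jE : (A (n - l.+1) /\ j = l.+1) \/ (~~ A (n - l.+1) /\ j = n - l).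
  by rewrite /j; case: ifP => h; [left|right].
have nAj : ~~ A j by case: jE => -[_ ->]; [apply: A1|apply: A2].
split.
- move=> i /orP[/supp|/eqP ->]; first lia.
  by case: jE => -[h]; rewrite /j => ->; lia.
- rewrite (@sum_bool_add1 n (grow l n A) A j) //; first by lia.
  by case: jE => -[h ->]; lia.
- move=> i /orP[Ai|/eqP ij] /orP[Ai1|/eqP ij1].
  + exact: (sep i).
  + case: jE => -[h jj]; rewrite -/j jj in ij1; first by have := supp _ Ai; lia.
    by move: Ai; rewrite (_ : i = n - l.+1) ?(negbTE h) //; lia.
  + case: jE => -[h jj]; rewrite -/j jj in ij; last by have := supp _ Ai1; lia.
    apply: cyc => //; first by have := supp _ h; have := kA _ h; lia.
    by rewrite -ij.
  + lia.
- move=> ln /orP[|/eqP e1] ; first by rewrite (negbTE (A1 _ _)).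
  case/orP => [|/eqP e2]; first by rewrite (negbTE (A2 _ _)).
  lia.
Qed.

(** A set stable for n + 1 fails to be stable for n in two ways: it contains the last point n + 1 -
    l, or it contains l + 1 and n - l, which become neighbours when that point is deleted. Removing
    n + 1 - l in the first case and l + 1 in the second undoes [grow]. *)
Lemma stable_in_split k l n A :
  l < k -> k.*2 <= n.+1 -> stable_in k l n.+1 A ->
  stable_in k l n A \/
  exists2 B, stable_in k l.+1 n.+1 B & A =1 grow l n.+1 B.
Proof.
move=> lk kn [supp siz sep cyc].
case An: (A (n.+1 - l)).
  right; exists (fun i => A i && (i != n.+1 - l)).
    split.
    - move=> i /andP[Ai ni]; have := supp _ Ai.
      case: (eqVneq i l.+1) => [il|]; last first.
        case: (eqVneq i (n.+1 - l.+1)) => [il|]; last by lia.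
        move=> ni2 _; case: (sep i Ai); rewrite (_ : i.+1 = n.+1 - l) //; lia.
      by case: cyc => //; [lia|rewrite -il].
    - rewrite (@sum_bool_add1 n.+1 A (fun i => A i && (i != n.+1 - l)) (n.+1 - l)) in siz.
      + by rewrite -[RHS]siz addnS.
      + lia.
      + by rewrite eqxx andbF.
      + by move=> i; case: eqP => [->|]; rewrite ?An ?andbT ?orbF ?orbT.
    - by move=> i /andP[Ai _] /andP[Ai1 _]; apply: (sep i).
    - move=> h /andP[h1 _] /andP[h2 _].
      by apply: (sep (n.+1 - l.+1)) => //; rewrite (_ : _.+1 = n.+1 - l) //; lia.
  move=> i; rewrite /grow.
  have -> : A (n.+1 - l.+1) && (n.+1 - l.+1 != n.+1 - l) = false.
    apply/negP => /andP[h _]; apply: (sep (n.+1 - l.+1)) => //.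
    by rewrite (_ : _.+1 = n.+1 - l) //; lia.
  by case: eqP => [->|]; rewrite ?An ?andbT ?orbF ?orbT.
case Ab: (A l.+1 && A (n - l) && (l.*2.+1 < n)).
  case/andP: Ab => /andP[Al Ar ln]; right.
  exists (fun i => A i && (i != l.+1)).
    split.
    - move=> i /andP[Ai ni]; have := supp _ Ai.
      have : i != n.+1 - l by apply/eqP => e; rewrite e An in Ai.
      lia.
    - rewrite (@sum_bool_add1 n.+1 A (fun i => A i && (i != l.+1)) l.+1) in siz.
      + by rewrite -[RHS]siz addnS.
      + lia.
      + by rewrite eqxx andbF.
      + by move=> i; case: eqP => [->|]; rewrite ?Al ?andbT ?orbF ?orbT.
    - by move=> i /andP[Ai _] /andP[Ai1 _]; apply: (sep i).
    - by move=> h /andP[h1 _] _; apply: (sep l.+1).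
  move=> i; rewrite /grow subSS Ar /=.
  have -> : n - l != l.+1 by lia.
  by case: eqP => [->|]; rewrite ?Al ?andbT ?orbF ?orbT.
left; split.
- move=> i Ai; have := supp _ Ai.
  have : i != n.+1 - l by apply/eqP => e; rewrite e An in Ai.
  lia.
- move: siz; rewrite big_ord_recr /=.
  have -> : A n.+1 = false; last by rewrite addn0.
  apply/negP => h; have := supp _ h => height.
  by move: An; rewrite (_ : n.+1 - l = n.+1) ?h //; lia.
- exact: sep.
- by move=> h1 h2 h3; rewrite h1 h2 h3 in Ab.
Qed.

(** [rim] is the closed form of iterating [grow] from layer m down to layer l. Since C is stable for
    n, it misses n + 1 - m; so the first step adds a right end, and afterwards left and right ends
    alternate. This is where the parity of m - j comes from. *)
Lemma rim_grow k l m n C :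
  l < m -> m <= k -> k.*2 <= n -> stable_in k m n C ->
  (fun i => rim l m n.+1 i || C i) =1
  grow l n.+1 (fun i => rim l.+1 m n.+1 i || C i).
Proof.
move=> lm mk kn [supp _ _ _] i; rewrite /grow.
have Cn : C (n.+1 - l.+1) = false by apply/negP => /supp; lia.
have rimn : rim l.+1 m n.+1 (n.+1 - l.+1) = (l.+1 < m) && odd (m - l.+1).
  rewrite /rim subKn ?leq_subr ?leqnn /=; last by lia.
  have -> : (n.+1 - l.+1 < m) = false by clear -lm mk kn; lia.
  by rewrite !andbF !orbF.
rewrite Cn orbF rimn [RHS]orbAC; congr orb.
have -> : rim l m n.+1 i = rim l.+1 m n.+1 i
    || (i == n.+1 - l) && odd (m - l)
    || [&& i == l.+1, l.+1 < m & odd (m - l.+1)].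
  rewrite /rim; case: (eqVneq i (n.+1 - l)) => [->|ni].
    rewrite subKn; last by lia.
    rewrite leqnn ltnn lm leq_subr /=; case: (odd (m - l)); rewrite /= ?orbT //.
    have -> : (n.+1 - l < m) = false by clear -lm mk kn; lia.
    have -> : (n.+1 - l == l.+1) = false by clear -lm mk kn; lia.
    by rewrite !andbF.
  rewrite /= orbF; case: (eqVneq i l.+1) => [->|nl].
    rewrite ltnn leqnn /= orbF.
    have -> : (n.+1 - l.+1 < m) = false by clear -lm mk kn; lia.
    by rewrite !andbF.
  rewrite /= orbF; congr orb.
    case: (leqP i n.+1) => //= hi.
    by have -> : (l <= n.+1 - i) = (l < n.+1 - i) by clear -ni hi lm mk kn; lia.
  by have -> : (l < i) = (l.+1 < i) by clear -nl; lia.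
case: (ltnP l.+1 m) => h; rewrite ?andbT ?andbF ?orbF /=.
  have -> : odd (m - l.+1) = ~~ odd (m - l).
    by rewrite -(subnSK lm) oddS negbK.
  by case: (odd (m - l)); rewrite /= ?andbT ?andbF ?orbF.
have -> : m - l = 1 by clear -lm h; lia.
by rewrite andbT.
Qed.

(** * Ladder cells encode the stable sets bijectively *)

Lemma rimxx l n i : rim l l n i = false.
Proof. by rewrite /rim; lia. Qed.

Lemma valid_le k d l (c : ladder k d) : valid d l c -> l <= k.
Proof.
elim: d l c => [|d IH] l c /=; first by lia.
by case/andP => h /IH; lia.
Qed.

Lemma sum_no_consecutive a r (A : nat -> bool) :
  (forall i, A i -> A i.+1 -> False) -> \sum_(a <= i < a + r.*2) A i <= r.
Proof.
move=> sep; elim: r a => [|r IH] a; first by rewrite addn0 big_geq.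
rewrite doubleS !addnS.
rewrite big_ltn; last by lia.
rewrite big_ltn; last by lia.
have := IH a.+2; rewrite !addSn.
have := sep a; case: (A a) => //=; case: (A a.+1) => //=; try lia.
Qed.

(** The interval has 2(k - l) - 1 points. One of its ends is missing from A, and the remaining
    points split into k - l - 1 consecutive pairs, each holding at most one element. At d = 0 this
    rules out the first alternative of [stable_in_split]. *)
Lemma stable_in_short k l n A :
  l.+1 < k -> n.+1 = k.*2 -> ~ stable_in k l n A.
Proof.
move=> lk nk [supp siz sep cyc].
have h a : a + (k - l.+1).*2 <= n.+1 ->
    (forall i, A i -> a <= i < a + (k - l.+1).*2) -> False.
  move=> an aA; suff: k - l <= k - l.+1 by lia.
  rewrite -{1}siz addnK -(big_mkord xpredT (fun i => A i : nat)).
  rewrite (@big_cat_nat _ _ _ a) //=; last by lia.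
  rewrite big_nat_cond big1 => [|i /andP[/andP[_ ia] _]]; last first.
    by case E : (A i) => //; have := aA _ E; lia.
  rewrite add0n (@big_cat_nat _ _ _ (a + (k - l.+1).*2)) //=; last by lia.
  rewrite [X in _ + X]big_nat_cond [X in _ + X]big1 => [|i /andP[/andP[ia _] _]]; last first.
    by case E : (A i) => //; have := aA _ E; lia.
  by rewrite addn0; apply: sum_no_consecutive.
case Al: (A l.+1).
  apply: (h l.+1) => [|i Ai]; first by lia.
  have : i != n - l.
    by apply/eqP => e; rewrite e in Ai; apply: cyc => //; lia.
  by have := supp _ Ai; lia.
apply: (h l.+2) => [|i Ai]; first by lia.
have : i != l.+1 by apply/eqP => e; rewrite e Al in Ai.
by have := supp _ Ai; lia.
Qed.

Lemma lab_stable k d l (c : ladder k d) :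
  valid d l c -> stable_in k l (k.*2 + d) (lab d l c).
Proof.
elim: d l c => [|d IH] l c.
  rewrite addn0 /= => hv.
  have lk : l <= k by move: hv; lia.
  move: hv => _; rewrite -(subKn lk); move: (k - l) (leq_subr l k) => r.
  elim: r => [|r IHr] rk.
    rewrite subn0; split.
    - by move=> i; lia.
    - by rewrite big1 // => i _; apply/eqP; rewrite eqb0; lia.
    - by move=> i; lia.
    - by lia.
  have lr : k - r.+1 < k by lia.
  (* Layer k - 1 is done by hand: [grow] applied to the empty set of layer k yields only the element
     k + 1, whereas the two parity classes {k} and {k + 1} both start here. *)
  case: r IHr rk lr => [_ rk lr|r IHr rk lr].
    have e1 : forall i, [&& k - 1 < i, i + (k - 1) <= k.*2 & odd i (+) c] =
       (i == if odd k (+) c then k else k.+1).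
      move=> i; case: ifP; lia.
    apply: (@stable_in_ext _ _ _ (fun i => i == if odd k (+) c then k else k.+1)).
      by move=> i; rewrite e1.
    split.
    - by move=> i; case: ifP; lia.
    - set j := if odd k (+) c then k else k.+1.
      rewrite (@sum_bool_add1 k.*2 (fun i => i == j) (fun=> false) j) //.
        by rewrite big1 //; lia.
      by rewrite /j; case: ifP; lia.
    - by move=> i; lia.
    - by case: ifP; lia.
  apply: (@stable_in_ext _ _ _ (grow (k - r.+2) k.*2
     (fun i => [&& k - r.+1 < i, i + (k - r.+1) <= k.*2 & odd i (+) c]))).
    by move=> i; rewrite /grow; case: ifP; lia.
  apply: stable_in_grow => //; rewrite (_ : (k - r.+2).+1 = k - r.+1); last by lia.
  by apply: IHr; lia.
case: c => m c /= /andP[lm hv]; rewrite addnS.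
have := IH _ _ hv; set C := lab d m c => SC.
have mk : m <= k := valid_le hv.
rewrite -(subKn lm); move: (m - l) (leq_subr l m) => r; elim: r => [|r IHr] rm.
  rewrite subn0; apply: (@stable_in_ext _ _ _ C).
    by move=> i; rewrite rimxx.
  case: SC => supp siz sep cyc; split => //.
  - by move=> i /supp; lia.
  - rewrite big_ord_recr /= (_ : C (k.*2 + d).+1 = false) ?addn0 //.
    by apply/negP => /supp; lia.
  - by move=> _ _ /supp; lia.
apply: (@stable_in_ext _ _ _ (grow (m - r.+1) (k.*2 + d).+1
          (fun i => rim (m - r.+1).+1 m (k.*2 + d).+1 i || C i))).
  move=> i; rewrite -(@rim_grow k) //; lia.
apply: stable_in_grow; [lia|lia|].
by rewrite (_ : (m - r.+1).+1 = m - r); [apply: IHr|]; lia.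
Qed.

Lemma lab_surjective k d l A :
  l <= k -> stable_in k l (k.*2 + d) A ->
  exists2 c : ladder k d, valid d l c & lab d l c =1 A.
Proof.
elim: d l A => [|d IH] l A lk.
  rewrite addn0 -(subKn lk); move: (k - l) (leq_subr l k) => r.
  elim: r A => [|r IHr] A rk.
    case=> supp _ _ _; exists true; first by rewrite /=; lia.
    move=> i /=; case Ai: (A i); last by lia.
    by have := supp _ Ai; lia.
  case: r IHr rk => [_ rk SA|r IHr rk SA].
    case: SA => supp siz sep cyc.
    exists (if odd k then A k.+1 else A k); first by rewrite /=; lia.
    move=> i /=.
    have siz' : A k + A k.+1 = 1.
      move: siz; rewrite -(big_mkord xpredT (fun i => A i : nat)).
      rewrite (@big_cat_nat _ _ _ k) //=; last by lia.
      rewrite big_nat_cond big1 => [|j /andP[/andP[_ ia] _]]; last first.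
        by case E : (A j) => //; have := supp _ E; lia.
      rewrite (@big_cat_nat _ _ _ k.+2) //=; try lia.
      rewrite [X in _ + (_ + X)]big_nat_cond [X in _ + (_ + X)]big1 => [|j /andP[/andP[ia _] _]]; last first.
        by case E : (A j) => //; have := supp _ E; lia.
      rewrite big_ltn; last by lia.
      rewrite big_ltn; last by lia.
      by rewrite big_geq //; lia.
    case Ai: (A i).
      have := supp _ Ai => hs; have : i = k \/ i = k.+1 by lia.
      case=> e; rewrite e in Ai hs *; rewrite Ai in siz'; case: ifP; move: siz'; rewrite ?Ai; lia.
    case: (eqVneq i k) => e.
      by rewrite e in Ai *; rewrite Ai in siz' *; case: ifP; lia.
    case: (eqVneq i k.+1) => e'; last by lia.
    by rewrite e' in Ai *; rewrite Ai in siz' *; case: ifP; lia.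
  have kk : k.*2.-1.+1 = k.*2 by lia.
  have lk' : k - r.+2 < k by lia.
  have := @stable_in_split k (k - r.+2) k.*2.-1 A lk'; rewrite kk.
  case/(_ (leqnn _) SA) => [|[B]].
    by move/(@stable_in_short k) => []; lia.
  rewrite (_ : (k - r.+2).+1 = k - r.+1); last by lia.
  move=> SB AB; have [|c _ cB] := IHr _ _ SB; first by lia.
  exists c; first by rewrite /=; lia.
  move=> i; rewrite AB /grow -!cB /=; case: ifP; lia.
rewrite -(subKn lk); move: (k - l) (leq_subr l k) => r.
elim: r A => [|r IHr] A rk SA.
  have S0 : stable_in k (k - 0) (k.*2 + d) A.
    rewrite subn0 in SA *; case: SA => supp siz sep cyc.
    have A0 i : A i = false.
      apply/negP => Ai; have [_ ik] := supp _ Ai.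
      have i_n : i < (k.*2 + d.+1).+1 by lia.
      by move: siz; rewrite (bigD1 (Ordinal i_n)) //= Ai; lia.
    split=> [i|||]; rewrite ?A0 //; first by rewrite big1 // => i _; rewrite A0.
  have [c hv cA] := IH _ _ (leq_subr _ _) S0.
  exists (@ord_max k, c); first by rewrite /= subn0 leqnn /= -{2}(subn0 k).
  by move=> i; rewrite /= subn0 rimxx /= -cA subn0.
have lk' : k - r.+1 < k by lia.
have kn : k.*2 <= (k.*2 + d).+1 by lia.
rewrite addnS in SA; case: (stable_in_split lk' kn SA) => [|[B]].
  move=> S0; have [c hv cA] := IH _ _ (leq_subr _ _) S0.
  have kr : k - r.+1 < k.+1 by lia.
  exists (Ordinal kr, c) => /=; first by rewrite leqnn.
  by move=> i; rewrite rimxx /= cA.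
rewrite (_ : (k - r.+1).+1 = k - r); last by lia.
move=> SB AB; rewrite -addnS in SB; have [|[m c] /= /andP[h1 h2] cB] := IHr _ _ SB; first by lia.
exists (m, c) => /=; first by rewrite h2 andbT; lia.
move=> i; rewrite AB addnS (@rim_grow k (k - r.+1) m); try lia.
- rewrite (_ : (k - r.+1).+1 = k - r); last by lia.
  by apply: grow_ext => j; rewrite -cB addnS.
- by have := valid_le h2; lia.
- exact: lab_stable.
Qed.

(** The head is visible in the set. Suppose m < m' and put N = 2k + d + 1. If m' - m is odd, the
    larger rim contains N - m, which the other set misses. If it is even, the larger rim contains m
    + 1 and N - m - 1; in the other set these would lie in the part of layer m, where they are
    cyclic neighbours. *)
Lemma lab_injective k d l (c c' : ladder k d) :
  valid d l c -> valid d l c' -> lab d l c =1 lab d l c' -> c = c'.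
Proof.
elim: d l c c' => [|d IH] l.
  move=> /= c c' h h' e; case: (ltnP l k) => lk; last first.
    by move: h h' lk; case: c e => e; case: c' e => e; lia.
  have := e k; have := e k.+1; rewrite /=; case: c {e h}; case: c' {h'} => //; lia.
move=> [m c] [m' c'] /= /andP[lm hm] /andP[lm' hm'].
wlog le : m m' c c' lm lm' hm hm' / m <= m'.
  move=> hw e; case/orP: (leq_total m m') => h; first exact: hw.
  by apply/esym/hw => // i; rewrite e.
move=> e; have := lab_stable hm; have := lab_stable hm'.
have mk := valid_le hm; have mk' := valid_le hm'.
case=> supp' _ _ _ [supp _ _ cyc].
have mm : m = m' :> nat.
  apply/eqP; move: le; rewrite leq_eqVlt => /orP[->//|lt].
  exfalso; set N := k.*2 + d.+1 in e.
  have out i : ~~ (m < i) || ~~ (i + m < N) || (lab d m c i == rim l m N i || lab d m c i).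
    case: (ltnP m i) => //= mi; case: (ltnP (i + m) N) => //= iN.
    suff -> : rim l m N i = false by rewrite /= eqxx.
    rewrite /rim; have -> : (i < m) = false by clear -mi; lia.
    have -> : (N - i < m) = false by clear -iN; lia.
    by rewrite !andbF.
  case odd_mm: (odd (m' - m)).
    have := e (N - m); have -> : rim l m' N (N - m).
      rewrite /rim leq_subr subKn; last by clear -mk; rewrite /N; lia.
      by rewrite lm lt odd_mm.
    rewrite /= /rim subKn; last by clear -mk; rewrite /N; lia.
    have -> : (N - m < m) = false by clear -mk; rewrite /N; lia.
    rewrite ltnn !andbF /=; case E : (lab d m c (N - m)) => //.
    by have := supp _ E; clear -mk; rewrite /N; lia.
  have lt2 : m.+1 < m' by move: lt odd_mm; clear; lia.
  have odd_mm1 : odd (m' - m.+1) by move: lt odd_mm; clear; lia.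
  apply: cyc; first by clear -lt2 mk'; lia.
    have := e m.+1; have -> : rim l m' N m.+1.
      by rewrite /rim ltnS lm lt2 odd_mm1 orbT.
    have := out m.+1; rewrite ltnSn /=.
    have -> /= : m.+1 + m < N by clear -lt2 mk'; rewrite /N; lia.
    by move=> /eqP <-.
  have -> : k.*2 + d - m = N - m.+1 by clear -mk; rewrite /N; lia.
  have := e (N - m.+1); have -> : rim l m' N (N - m.+1).
    rewrite /rim leq_subr subKn; last by clear -lt2 mk'; rewrite /N; lia.
    by rewrite lt2 odd_mm1 (leq_trans lm).
  have := out (N - m.+1).
  have -> /= : m < N - m.+1 by clear -lt2 mk'; rewrite /N; lia.
  have -> /= : N - m.+1 + m < N by clear -lt2 mk'; rewrite /N; lia.
  by move=> /eqP <-.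
have mm' : m = m' by apply: val_inj.
move: c' hm' e supp'; rewrite -mm' => c' hm' e supp'; congr (_, _).
apply: (IH m) => // i; have := e i.
case E1 : (lab d m c i); case E2 : (lab d m c' i) => //; rewrite !orbF ?orbT => h.
  have [h1 h2] := supp _ E1; move: h; rewrite /rim.
  have -> : (i < m) = false by clear -h1; lia.
  have -> : (k.*2 + d.+1 - i < m) = false by clear -h2; lia.
  by rewrite !andbF.
have [h1 h2] := supp' _ E2; move: h; rewrite /rim.
have -> : (i < m) = false by clear -h1; lia.
have -> : (k.*2 + d.+1 - i < m) = false by clear -h2; lia.
by rewrite !andbF.
Qed.

Local Open Scope classical_set_scope.
Local Open Scope ring_scope.

(** * Linear functionals *)

Section Dot.
Variable R : realType.

Definition dot n (y x : 'rV[R]_n) : R := \sum_i y ord0 i * x ord0 i.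

Lemma dotC n (y x : 'rV[R]_n) : dot y x = dot x y.
Proof. by apply: eq_bigr => i _; rewrite mulrC. Qed.

Lemma dotDr n (y a b : 'rV[R]_n) : dot y (a + b) = dot y a + dot y b.
Proof. by rewrite -big_split; apply: eq_bigr => i _; rewrite mxE mulrDr. Qed.

Lemma dotZr n (y a : 'rV[R]_n) c : dot y (c *: a) = c * dot y a.
Proof. by rewrite mulr_sumr; apply: eq_bigr => i _; rewrite mxE mulrCA. Qed.

Lemma dotNr n (y a : 'rV[R]_n) : dot y (- a) = - dot y a.
Proof. by rewrite -scaleN1r dotZr mulN1r. Qed.

Lemma dotBr n (y a b : 'rV[R]_n) : dot y (a - b) = dot y a - dot y b.
Proof. by rewrite dotDr dotNr. Qed.

Lemma dot0r n (y : 'rV[R]_n) : dot y 0 = 0.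
Proof. by rewrite -(scale0r 0) dotZr mul0r. Qed.

Lemma dot_sumr n (y : 'rV[R]_n) (I : Type) (r : seq I) (P : pred I) F :
  dot y (\sum_(i <- r | P i) F i) = \sum_(i <- r | P i) dot y (F i).
Proof.
elim/big_rec2: _ => [|i s x _ <-]; first exact: dot0r.
by rewrite dotDr.
Qed.

Lemma dotDl n (y a b : 'rV[R]_n) : dot (a + b) y = dot a y + dot b y.
Proof. by rewrite ![dot _ y]dotC dotDr. Qed.

Lemma dotZl n (y a : 'rV[R]_n) c : dot (c *: a) y = c * dot a y.
Proof. by rewrite ![dot _ y]dotC dotZr. Qed.

Lemma dotNl n (y a : 'rV[R]_n) : dot (- a) y = - dot a y.
Proof. by rewrite ![dot _ y]dotC dotNr. Qed.

Lemma dot0l n (y : 'rV[R]_n) : dot 0 y = 0.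
Proof. by rewrite dotC dot0r. Qed.

Lemma dot_self_gt0 n (y : 'rV[R]_n) : y != 0 -> 0 < dot y y.
Proof.
move=> y0; rewrite lt0r; apply/andP; split; last first.
  by apply: sumr_ge0 => i _; rewrite -expr2 sqr_ge0.
apply: contra y0; rewrite psumr_eq0 => [/allP h|i _]; last by rewrite -expr2 sqr_ge0.
apply/eqP/rowP => i; rewrite mxE; have := h i (mem_index_enum i).
by rewrite -expr2 sqrf_eq0 => /eqP.
Qed.

Lemma normr_coord n (y : 'rV[R]_n.+1) i : `|y ord0 i| <= `|y|.
Proof.
rewrite [`|y|]mx_normrE; exact: (le_bigmax _ (fun ij => `|y ij.1 ij.2|) (ord0, i)).
Qed.

Lemma normr_dot_le n (y a : 'rV[R]_n.+1) :
  `|dot y a| <= (\sum_i `|a ord0 i|) * `|y|.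
Proof.
rewrite (le_trans (ler_norm_sum _ _ _)) // mulr_suml ler_sum // => i _.
by rewrite normrM mulrC ler_wpM2l // normr_coord.
Qed.

Lemma continuous_bigsum (T : topologicalType) (I : Type) (r : seq I) (P : pred I)
    (f : I -> T -> R) x :
  (forall i, P i -> {for x, continuous (f i)}) ->
  {for x, continuous (fun z => \sum_(i <- r | P i) f i z)}.
Proof.
move=> cf; elim: r => [|i r IH].
  have -> : (fun z => \sum_(i <- [::] | P i) f i z) = cst 0.
    by apply/funext => z; rewrite big_nil.
  exact: cst_continuous.
case Pi : (P i).
  have -> : (fun z => \sum_(j <- i :: r | P j) f j z) =
      (fun z => f i z + \sum_(j <- r | P j) f j z).
    by apply/funext => z; rewrite big_cons Pi.
  exact: continuousD (cf _ Pi) IH.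
have -> // : (fun z => \sum_(j <- i :: r | P j) f j z) =
    (fun z => \sum_(j <- r | P j) f j z).
by apply/funext => z; rewrite big_cons Pi.
Qed.

Lemma continuous_dotl n (a : 'rV[R]_n.+1) : continuous (fun y => dot y a).
Proof.
move=> y; apply: continuous_bigsum => i _.
by apply: (@continuousM _ _ (fun z : 'rV[R]_n.+1 => z ord0 i) (cst (a ord0 i)));
  [exact: coord_continuous|exact: cst_continuous].
Qed.

Lemma compact_unit_sphere n : compact [set y : 'rV[R]_n.+1 | `|y| = 1].
Proof.
apply: bounded_closed_compact.
  exists 1; split; first by rewrite num_real.
  by move=> x x1 y /= ->; rewrite ltW.
have -> : [set y : 'rV[R]_n.+1 | `|y| = 1] = Num.norm @^-1` [set 1].
  by apply/seteqP; split.
apply: preimage_closed; first by move=> y _; exact: norm_continuous.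
exact: closed_eq.
Qed.

(* By homogeneity and compactness of the unit sphere. *)
Lemma uniform_margin n (J : finType) (Q : pred J) (a : J -> 'rV[R]_n.+1) :
  (forall y, y != 0 -> exists2 j, Q j & dot y (a j) < 0) ->
  exists2 e : R, 0 < e &
    forall y, y != 0 -> exists2 j, Q j & dot y (a j) <= - (e * `|y|).
Proof.
move=> h.
pose G (y : 'rV[R]_n.+1) : R := \sum_(j | Q j) (`|dot y (a j)| - dot y (a j)).
have cG : continuous G.
  move=> y; apply: continuous_bigsum => j _.
  apply: (@continuousB _ _ _ (fun z => `|dot z (a j)|) (fun z => dot z (a j))).
    apply: continuous_comp; first exact: continuous_dotl.
    exact: norm_continuous.
  exact: continuous_dotl.
have G0 j y : 0 <= `|dot y (a j)| - dot y (a j) by rewrite subr_ge0 ler_norm.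
have ne : [set y : 'rV[R]_n.+1 | `|y| = 1] !=set0.
  exists (const_mx 1); apply/eqP; rewrite eq_le; apply/andP; split; last first.
    by apply: le_trans (normr_coord _ ord0); rewrite mxE normr1.
  rewrite [`|_|]mx_normrE; apply: bigmax_le => // i _; by rewrite mxE normr1.
have [z] := EVT_min_rV ne (@compact_unit_sphere n) (continuous_subspaceT cG).
rewrite inE /= => z1 zmin.
have z0 : z != 0 by rewrite -normr_eq0 z1 oner_eq0.
have Gz : 0 < G z.
  have [j Qj dj] := h z z0; rewrite /G (bigD1 j) //= ltr_wpDr ?sumr_ge0 //.
  by rewrite subr_gt0 (lt_le_trans dj).
pose N := #|J|%:R + 1 : R.
have N0 : 0 < N by rewrite ltr_wpDl.
(* If every [dot y (a j)] exceeded -e |y|, each term of G at y/|y| would be at most 2e = G z / N; as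
   there are fewer than N terms, G would fall below its minimum G z. *)
exists (G z / N / 2); first by rewrite !divr_gt0.
move=> y y0; apply: contrapT => nex.
have ny : 0 < `|y| by rewrite normr_gt0.
have hy : G z <= G (`|y|^-1 *: y).
  by apply: zmin; rewrite inE /= normrZ gtr0_norm ?invr_gt0 // mulVf ?gt_eqF.
have : G (`|y|^-1 *: y) < G z; last by rewrite ltNge hy.
have : G (`|y|^-1 *: y) <= \sum_(j | Q j) (G z / N).
  apply: ler_sum => j Qj; rewrite dotZl.
  have : - (G z / N / 2 * `|y|) < dot y (a j).
    by rewrite ltNge; apply/negP => hj; apply: nex; exists j.
  rewrite -(ltr_pM2l (_ : 0 < `|y|^-1)) ?invr_gt0 // mulrN mulrCA mulVf ?gt_eqF // mulr1.
  move: (`|y|^-1 * _) => t ht; have gN : 0 < G z / N by rewrite divr_gt0.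
  by case: (lerP 0 t) => t0; [rewrite ger0_norm // subrr ltW|rewrite ltr0_norm //; lra].
rewrite sumr_const => /le_lt_trans; apply.
rewrite -[X in _ < X](mulfVK (lt0r_neq0 N0)) -mulr_natr.
rewrite ltr_pM2l ?divr_gt0 //.
by rewrite /N (le_lt_trans (_ : _ <= #|J|%:R)) ?ler_nat ?max_card // ltrDl.
Qed.

(** * Linear independence, dual functionals, separation from a span *)

Definition indep n (J : finType) (p : J -> 'rV[R]_n) (F : {set J}) : Prop :=
  forall c : J -> R, \sum_(j in F) c j *: p j = 0 -> forall j, j \in F -> c j = 0.

Lemma indep_row_free n (J : finType) (p : J -> 'rV[R]_n) (F : {set J}) :
  indep p F -> row_free (\matrix_(i < #|F|) p (enum_val i)).
Proof.
move=> iF; rewrite -kermx_eq0; apply/rowV0P => v /sub_kermxP vM.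
apply/rowP => i; have j0F := enum_valP i.
have := iF (fun j => v ord0 (enum_rank_in j0F j)).
rewrite big_enum_val /=.
under eq_bigr do rewrite enum_valK_in.
have -> : \sum_(i < #|F|) v ord0 i *: p (enum_val i) =
    v *m \matrix_(i < #|F|) p (enum_val i).
  by rewrite mulmx_sum_row; apply: eq_bigr => j _; rewrite rowK.
by move=> /(_ vM) /(_ _ j0F); rewrite enum_valK_in mxE.
Qed.

Lemma indep_dual n (J : finType) (p : J -> 'rV[R]_n) (F : {set J}) (b : J -> R) :
  indep p F -> exists y, forall j, j \in F -> dot y (p j) = b j.
Proof.
move=> /indep_row_free/row_freeP[B MB].
exists (B *m \col_i b (enum_val i))^T => j jF.
have := congr1 (fun A => (A *m \col_i b (enum_val i)) (enum_rank_in jF j) ord0) MB.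
rewrite -mulmxA mul1mx !mxE enum_rankK_in // => <-.
by apply: eq_bigr => i _; rewrite !mxE enum_rankK_in // mulrC.
Qed.

Lemma indep_card n (J : finType) (p : J -> 'rV[R]_n) (F : {set J}) :
  indep p F -> (#|F| <= n)%N.
Proof. by move=> /indep_row_free/eqP <-; exact: rank_leq_col. Qed.

Lemma indep_sub n (J : finType) (p : J -> 'rV[R]_n) (F G : {set J}) :
  F \subset G -> indep p G -> indep p F.
Proof.
move=> /fintype.subsetP FG iG c h j jF.
have := iG (fun j => if j \in F then c j else 0); rewrite (bigID (mem F)) /=.
rewrite [X in _ + X]big1 ?addr0 => [|i /andP[_ /negbTE ->]]; last by rewrite scale0r.
rewrite (eq_bigl (mem F)) => [|i]; last first.
  by rewrite /= andbC; case: (boolP (i \in F)) => // /FG ->.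
rewrite (eq_bigr (fun i => c i *: p i)) => [|i /= ->//].
by move=> /(_ h j (FG _ jF)); rewrite jF.
Qed.

(** A vector outside the row space is detected by some column of the cokernel; multiplying the
    column by the value found there makes that value a positive square. *)
Lemma span_split n (J : finType) (p : J -> 'rV[R]_n) (F : {set J}) (x : 'rV[R]_n) :
  (exists c : J -> R, x = \sum_(j in F) c j *: p j) \/
  (exists u, (forall j, j \in F -> dot u (p j) = 0) /\ 0 < dot u x).
Proof.
case: (set_0Vmem F) => [->|[j0 j0F]].
  have [->|x0] := eqVneq x 0; first by left; exists (fun=> 0); rewrite big_set0.
  by right; exists x; split=> [j|]; [rewrite inE|exact: dot_self_gt0].
pose M := \matrix_(i < #|F|) p (enum_val i).
have [/submxP[v xv]|nx] := boolP (x <= M)%MS.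
  left; exists (fun j => v ord0 (enum_rank_in j0F j)).
  rewrite xv mulmx_sum_row [RHS]big_enum_val /=; apply: eq_bigr => i _.
  by rewrite enum_valK_in rowK.
right; have : x *m cokermx M != 0 by rewrite -submxE.
move=> /rV0Pn[i xi].
pose t := (x *m cokermx M) ord0 i.
exists (t *: (col i (cokermx M))^T); split=> [j jF|].
  rewrite dotZl; have /matrixP/(_ (enum_rank_in j0F j) i) := mulmx_coker M.
  rewrite !mxE => h; rewrite (_ : dot _ _ = 0) ?mulr0 // -[RHS]h.
  by apply: eq_bigr => l _; rewrite !mxE enum_rankK_in // mulrC.
rewrite dotZl (_ : dot _ _ = t) -?expr2 ?exprn_even_gt0 //.
by rewrite /t mxE; apply: eq_bigr => l _; rewrite !mxE mulrC.
Qed.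

End Dot.

(** * Generic heights *)

Section Heights.
Variable R : realType.

Definition sgb (b : bool) : R := if b then 1 else -1.

Lemma normr_sgb b : `|sgb b| = 1.
Proof. by case: b; rewrite /sgb ?normrN normr1. Qed.

Definition pt n (x : 'rV[R]_n) (h : R) : 'rV[R]_n.+1 :=
  \row_(j < n.+1) (if insub (val j) is Some i then x ord0 i else h).

Definition trunc n (y : 'rV[R]_n.+1) : 'rV[R]_n :=
  \row_(i < n) y ord0 (widen_ord (leqnSn n) i).

Definition lastc n (y : 'rV[R]_n.+1) : R := y ord0 ord_max.

Lemma pt_widen n (x : 'rV[R]_n) h i : pt x h ord0 (widen_ord (leqnSn n) i) = x ord0 i.
Proof.
rewrite mxE /=; case: insubP => [j _ ji|]; last by rewrite ltn_ord.
by congr (x _ _); apply: val_inj.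
Qed.

Lemma pt_max n (x : 'rV[R]_n) h : pt x h ord0 ord_max = h.
Proof. by rewrite mxE /=; case: insubP => [j jn jE|//]; rewrite /= ltnn in jn. Qed.

Lemma trunc_pt n (x : 'rV[R]_n) h : trunc (pt x h) = x.
Proof. by apply/rowP => i; rewrite mxE pt_widen. Qed.

Lemma lastc_pt n (x : 'rV[R]_n) h : lastc (pt x h) = h.
Proof. exact: pt_max. Qed.

Lemma pt_inj n (y z : 'rV[R]_n.+1) : trunc y = trunc z -> lastc y = lastc z -> y = z.
Proof.
move=> /rowP t l; apply/rowP => i.
have := ltn_ord i; rewrite ltnS leq_eqVlt => /orP[/eqP e|i_n].
  by have -> : i = ord_max by apply: val_inj.
have -> : i = widen_ord (leqnSn n) (Ordinal i_n) by apply: val_inj.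
by have := t (Ordinal i_n); rewrite !mxE.
Qed.

Lemma pt_eta n (y : 'rV[R]_n.+1) : pt (trunc y) (lastc y) = y.
Proof. by apply: pt_inj; rewrite ?trunc_pt ?lastc_pt. Qed.

Lemma dot_pt n (y : 'rV[R]_n.+1) x h :
  dot y (pt x h) = dot (trunc y) x + lastc y * h.
Proof.
rewrite /dot big_ord_recr /= pt_max; congr (_ + _).
by apply: eq_bigr => i _; rewrite pt_widen mxE.
Qed.

Lemma sum_pt n (J : finType) (F : {set J}) (c : J -> R) (q : J -> 'rV[R]_n) h :
  \sum_(j in F) c j *: pt (q j) (h j) =
  pt (\sum_(j in F) c j *: q j) (\sum_(j in F) c j * h j).
Proof.
apply: pt_inj; rewrite ?trunc_pt ?lastc_pt.
  apply/rowP => i; rewrite mxE !summxE; apply: eq_bigr => j _.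
  by rewrite !mxE -[in RHS](pt_widen _ (h j)) mxE.
by rewrite /lastc summxE; apply: eq_bigr => j _; rewrite mxE pt_max.
Qed.

Lemma trunc0 n : trunc (0 : 'rV[R]_n.+1) = 0.
Proof. by apply/rowP => i; rewrite !mxE. Qed.

Lemma lastc0 n : lastc (0 : 'rV[R]_n.+1) = 0.
Proof. by rewrite /lastc mxE. Qed.

Lemma indep_pt n (J : finType) (q : J -> 'rV[R]_n) h (F : {set J}) :
  indep q F -> indep (fun j => pt (q j) (h j)) F.
Proof.
move=> iF c; rewrite sum_pt => /(congr1 (@trunc n)); rewrite trunc_pt trunc0.
exact: iF.
Qed.

(** Each [bad t] excludes at most one number, so one of #|T| + 1 equally spaced points of the
    interval survives. *)
Lemma avoid_finitely_many (T : finType) (bad : T -> R -> Prop) (lo hi : R) :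
  (forall t x x', bad t x -> bad t x' -> x = x') -> lo < hi ->
  exists2 x, lo < x < hi & forall t, ~ bad t x.
Proof.
move=> sub lohi; apply: contrapT => nex.
pose x (i : 'I_#|T|.+1) : R := lo + (hi - lo) * (i.+1%:R / (#|T|.+2)%:R).
have xin i : lo < x i < hi.
  have h1 : 0 < i.+1%:R / (#|T|.+2)%:R :> R by rewrite divr_gt0 // ltr0n.
  have h2 : i.+1%:R / (#|T|.+2)%:R < 1 :> R.
    by rewrite ltr_pdivrMr ?ltr0n // mul1r ltr_nat ltnS ltn_ord.
  rewrite /x ltrDl mulr_gt0 ?subr_gt0 //=.
  by rewrite -ltrBrDl gtr_pMr // subr_gt0.
have bx i : exists t, bad t (x i).
  apply: contrapT => nb; apply: nex; exists (x i) => // t bt; apply: nb.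
  by exists t.
pose f i := projT1 (cid (bx i)).
have finj : injective f.
  move=> i j fij; have := projT2 (cid (bx i)); have := projT2 (cid (bx j)).
  rewrite -/(f i) -/(f j) fij => bj bi; have := sub _ _ _ bi bj.
  rewrite /x => /addrI/mulfI; rewrite subr_eq0 gt_eqF // => /(_ isT).
  move=> /(@mulIf _ _ _); rewrite invr_eq0 pnatr_eq0 => /(_ isT)/eqP.
  by rewrite eqr_nat eqSS => /eqP /val_inj.
by have := leq_card f finj; rewrite card_ord ltnn.
Qed.

(** The points outside [old] are placed one at a time, each avoiding finitely many heights.
    Independence is claimed only for sets on a pair of hyperplanes y = 1 and y = -1 with [lastc y]
    nonzero, which is how optimal sets arise after scaling y. The function f is there to separate
    the errors of layer 0 from those of layer 1. *)
Lemma generic_heights n (J : finType) (q : J -> 'rV[R]_n) (old : {set J})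
    (h0 lo hi f : J -> R) :
  (forall c, c \notin old -> lo c < hi c) ->
  exists h : J -> R,
  [/\ forall c, c \in old -> h c = h0 c,
      forall c, c \notin old -> lo c < h c < hi c,
      forall c c', c \notin old -> c' \notin old -> c != c' ->
        h c - f c != h c' - f c'
    & forall (F : {set J}) y, lastc y != 0 ->
        (forall c, c \in F -> `|dot y (pt (q c) (h c))| = 1) ->
        indep (fun c => pt (q c) (h c)) (F :&: old) ->
        indep (fun c => pt (q c) (h c)) F].
Proof.
move=> lohi.
suff H (s : seq J) : exists h : J -> R,
  [/\ forall c, c \in old -> h c = h0 c,
      forall c, c \in s -> c \notin old -> lo c < h c < hi c,
      forall c c', c \in s -> c' \in s ->
        c \notin old -> c' \notin old -> c != c' ->
        h c - f c != h c' - f c'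
    & forall (F : {set J}) y, lastc y != 0 ->
        (forall c, c \in F -> (c \in s) || (c \in old)) ->
        (forall c, c \in F -> `|dot y (pt (q c) (h c))| = 1) ->
        indep (fun c => pt (q c) (h c)) (F :&: old) ->
        indep (fun c => pt (q c) (h c)) F].
  have [h [h1 h2 h3 h4]] := H (enum J); exists h; split => //.
  - by move=> c; apply: h2; rewrite mem_enum.
  - by move=> c c'; apply: h3; rewrite mem_enum.
  - by move=> F y y0; apply: (h4 F y) => // c; rewrite mem_enum.
elim: s => [|c s [h [h1 h2 h3 h4]]].
  exists h0; split => // F y _ Fold _; rewrite (finset.setIidPl _) //.
  by apply/fintype.subsetP => c /Fold.
case cs : ((c \in s) || (c \in old)).
  have cs' c' : c' \in c :: s -> c' \notin old -> c' \in s.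
    by rewrite inE => /orP[/eqP -> co|//]; rewrite (negbTE co) orbF in cs.
  exists h; split => //.
  - by move=> c' c's c'o; apply: h2 => //; apply: cs'.
  - by move=> c' c'' a b co co'; apply: h3 => //; apply: cs'.
  - move=> F y y0 FF; apply: (h4 F y y0) => c' /FF.
    by rewrite inE -orbA => /orP[/eqP ->|].
move/negbT: cs; rewrite negb_or => /andP[cs co].
pose p j := pt (q j) (h j).
(* The new point must not fall into the span of F when some y takes the signs b on F and at the new
   point. The signs alone fix the value of every such y at a combination of F, so two bad heights
   have the same [dot y], hence are equal because [lastc y] is nonzero. *)
pose bad (t : {set J} * {ffun J -> bool} + J) (x : R) := match t with
  | inl (F, b) => exists (y : 'rV[R]_n.+1) (a : J -> R),
     [/\ lastc y != 0, forall j, j \in F -> dot y (p j) = sgb (b j),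
       dot y (pt (q c) x) = sgb (b c) & pt (q c) x = \sum_(j in F) a j *: p j]
  | inr c' => x - f c = h c' - f c'
  end.
have badsub t x x' : bad t x -> bad t x' -> x = x'.
  case: t => [[F b]|c'] /=; last by move=> <- /addIr ->.
  case=> y [a [y0 yF yc ca]] [y' [a' [_ yF' yc' ca']]].
  have : dot y (pt (q c) x) = dot y (pt (q c) x').
    rewrite yc -yc' ca' !dot_sumr; apply: eq_bigr => j jF.
    by rewrite !dotZr yF // yF'.
  by rewrite !dot_pt => /addrI/(mulfI y0).
have [x xlohi xbad] := avoid_finitely_many badsub (lohi c co).
pose h' j := if j == c then x else h j.
have h'E j : j != c -> h' j = h j by rewrite /h' => /negbTE ->.
exists h'; split.
- by move=> j jo; rewrite h'E ?h1 //; apply: contraNneq co => <-.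
- move=> j; rewrite inE => /orP[/eqP -> _|js jo]; first by rewrite /h' eqxx.
  by rewrite h'E ?h2 //; apply: contraNneq cs => <-.
- have key j : j \in s -> x - f c != h' j - f j.
    move=> js; rewrite h'E; last by apply: contraNneq cs => <-.
    by apply/eqP => e; apply: (xbad (inr j)).
  move=> j j'; rewrite !inE => /orP[/eqP ->|js] /orP[/eqP ->|j's] jo jo'.
  + by rewrite eqxx.
  + by move=> _; rewrite {1}/h' eqxx key.
  + by move=> _; rewrite eq_sym {1}/h' eqxx key.
  + move=> jj; rewrite !h'E ?h3 //; apply: contraNneq cs => <- //.
- move=> F y y0 FF Fy Fi.
  have [cF|cF] := boolP (c \in F); last first.
    have FE j : j \in F -> h' j = h j.
      by move=> jF; rewrite h'E //; apply: contraNneq cF => <-.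
    have : indep p F.
      apply: (h4 F y y0).
      - move=> j jF; have := FF _ jF; rewrite inE -orbA => /orP[/eqP jc|//].
        by rewrite -jc jF in cF.
      - by move=> j jF; rewrite -FE // Fy.
      - move=> a ha j jF; apply: (Fi a) => //; rewrite -[RHS]ha.
        by apply: eq_bigr => i; rewrite inE => /andP[/FE ->].
    move=> i a ha j jF; apply: (i a) => //; rewrite -[RHS]ha.
    by apply: eq_bigr => l /FE; rewrite /p => ->.
  have FE j : j \in F :\ c -> h' j = h j.
    by rewrite !inE => /andP[/h'E].
  have iF' : indep p (F :\ c).
    apply: (h4 _ y y0).
    - move=> j; rewrite !inE => /andP[jc /FF]; rewrite inE (negbTE jc) //.
    - by move=> j jF; rewrite -FE // Fy //; move: jF; rewrite !inE => /andP[].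
    - move=> a ha j; rewrite !inE => /andP[/andP[jc jF] jo].
      have E : (F :\ c) :&: old = F :&: old.
        apply/finset.setP => i; rewrite !finset.in_setI finset.in_setD1.
        by have [->|] := eqVneq i c; rewrite ?(negbTE co) ?andbF.
      apply: (Fi a); last by rewrite inE jF.
      rewrite -[RHS]ha E; apply: eq_bigr => i; rewrite inE => /andP[iF io].
      by rewrite h'E //; apply: contraNneq co => <-.
  move=> a ha; rewrite (big_setD1 c) //= in ha.
  have hs : \sum_(j in F :\ c) a j *: pt (q j) (h' j) = \sum_(j in F :\ c) a j *: p j.
    by apply: eq_bigr => j /FE; rewrite /p => ->.
  rewrite hs in ha.
  have [ac|ac] := eqVneq (a c) 0.
    rewrite ac scale0r add0r in ha.
    move=> j jF; have [->//|jc] := eqVneq j c.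
    by apply: (iF' _ ha); rewrite !inE jc.
  exfalso; apply: (xbad (inl (F :\ c, [ffun j => 0 < dot y (pt (q j) (h' j))]))).
  have sgE j : j \in F -> dot y (pt (q j) (h' j)) = sgb (0 < dot y (pt (q j) (h' j))).
    move=> jF; have := Fy _ jF; rewrite /sgb; case: ltrP => h5.
      by rewrite gtr0_norm.
    by rewrite ler0_norm // => /eqP; rewrite eqr_oppLR => /eqP.
  exists y, (fun j => - a j / a c); split => //=.
  - by move=> j jF; rewrite ffunE -sgE ?FE //; move: jF; rewrite !inE => /andP[].
  - by rewrite ffunE -sgE // /h' eqxx.
  - have : a c *: pt (q c) (h' c) = - \sum_(j in F :\ c) a j *: p j.
      by apply/eqP; rewrite -addr_eq0 ha.
    move=> /(congr1 (fun z => (a c)^-1 *: z)); rewrite scalerA mulVf // scale1r.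
    rewrite {1}/h' eqxx => ->; rewrite -sumrN scaler_sumr; apply: eq_bigr => j _.
    by rewrite -scaleNr scalerA mulrC.
Qed.

End Heights.

(** * Layered configurations *)

Section Levels.
Variables (R : realType) (k : nat).

Section Patterns.
Variables (d : nat) (P : nat -> ladder k d -> 'rV[R]_d.+1) (w : nat -> 'rV[R]_d.+1).

Definition layer_opt l y : {set ladder k d} :=
  [set c | valid d l c &&
    [forall c', valid d l c' ==> (dot y (P l c') <= dot y (P l c))]]%SET.

(** The absolute value makes the white points -p_c compete too: these are the black vertices of the
    face of the whole hull that y selects. *)
Definition black_opt y : {set ladder k d} :=
  [set c | valid d 0 c &&
    [forall c', valid d 0 c' ==> (`|dot y (P 0 c')| <= dot y (P 0 c))]]%SET.

Definition abs_opt y : {set ladder k d} :=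
  [set c | valid d 0 c &&
    [forall c', valid d 0 c' ==> (`|dot y (P 0 c')| <= `|dot y (P 0 c)|)]]%SET.

Lemma layer_optP l y c : reflect
  (valid d l c /\ forall c', valid d l c' -> dot y (P l c') <= dot y (P l c))
  (c \in layer_opt l y).
Proof.
rewrite inE; apply: (iffP andP) => -[vc].
  by move=> /'forall_implyP h; split => // c'; apply: h.
by move=> h; split => //; apply/'forall_implyP => c'; apply: h.
Qed.

Lemma black_optP y c : reflect
  (valid d 0 c /\ forall c', valid d 0 c' -> `|dot y (P 0 c')| <= dot y (P 0 c))
  (c \in black_opt y).
Proof.
rewrite inE; apply: (iffP andP) => -[vc].
  by move=> /'forall_implyP h; split => // c'; apply: h.
by move=> h; split => //; apply/'forall_implyP => c'; apply: h.
Qed.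

Lemma abs_optP y c : reflect
  (valid d 0 c /\ forall c', valid d 0 c' -> `|dot y (P 0 c')| <= `|dot y (P 0 c)|)
  (c \in abs_opt y).
Proof.
rewrite inE; apply: (iffP andP) => -[vc].
  by move=> /'forall_implyP h; split => // c'; apply: h.
by move=> h; split => //; apply/'forall_implyP => c'; apply: h.
Qed.

(* [P l] carries the sets of layer l. The witnesses [w i] certify disjointness: if
   p_A and -p_B are both optimal for y then y.w_i is positive on A and negative
   on B. *)
Record layers : Prop := Layers {
  lay_zero : forall c, P k c = 0;
  lay_pos : forall l y, (0 < l < k)%N -> y != 0 ->
    exists2 c, valid d l c & 0 < dot y (P l c);
  lay_sign : forall l y c i, (0 < l)%N -> y != 0 -> c \in layer_opt l y ->
    lab d l c i -> 0 < dot y (w i);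
  lay_ind : forall l y, (0 < l < k)%N -> y != 0 -> indep (P l) (layer_opt l y);
  lay_vtx : forall l c, (0 < l)%N -> valid d l c -> exists2 y, y != 0 &
    forall c', valid d l c' -> c' != c -> dot y (P l c') < dot y (P l c) }.

(* [top_count] forbids monochromatic facets: they would have d + 1 black vertices,
   while some cell of layer 1 is always optimal. *)
Record top : Prop := Top {
  top_pos : forall y, y != 0 -> exists2 c, valid d 0 c & dot y (P 0 c) != 0;
  top_sign : forall y c i, y != 0 -> c \in black_opt y -> lab d 0 c i -> 0 < dot y (w i);
  top_ind : forall y, y != 0 -> indep (P 0) (abs_opt y);
  top_count : forall y, y != 0 -> (#|black_opt y| + #|layer_opt 1 y| <= d.+1)%N;
  top_vtx : forall c, valid d 0 c -> exists2 y, y != 0 & c \in black_opt y }.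

Definition near_layer_opt (e : R) l y c : Prop := valid d l c /\
  forall c', valid d l c' -> dot y (P l c') < dot y (P l c) + e * `|y|.

Definition near_black_opt (e : R) y c : Prop := valid d 0 c /\
  forall c', valid d 0 c' -> `|dot y (P 0 c')| < dot y (P 0 c) + e * `|y|.

Lemma min_eps (T : finType) (S : T -> R -> Prop) :
  (forall t, exists2 e, 0 < e & S t e) ->
  (forall t e e', S t e -> 0 < e' <= e -> S t e') ->
  exists2 e, 0 < e <= 1 & forall t, S t e.
Proof.
move=> h mono.
suff H (s : seq T) : exists2 e, 0 < e <= 1 & forall t, t \in s -> S t e.
  by have [e e0 he] := H (enum T); exists e => // t; apply: he; rewrite mem_enum.
elim: s => [|t s [e /andP[e0 e1] he]]; first by exists 1 => //; rewrite ltr01 lexx.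
have [e' e'0 he'] := h t; exists (Num.min e e').
  by rewrite lt_min e0 e'0 /= ge_min e1.
have m0 : 0 < Num.min e e' by rewrite lt_min e0.
move=> t'; rewrite inE => /orP[/eqP ->|t's].
  by apply: mono he' _; rewrite m0 ge_min lexx orbT.
by apply: mono (he _ t's) _; rewrite m0 ge_min lexx.
Qed.

(* There are finitely many patterns of optimal cells; a pattern which is not
   realised exactly is not realised approximately either, by [uniform_margin]. *)
Lemma pattern_margin N : exists2 e : R, 0 < e <= 1 &
  forall y, y != 0 -> exists2 y0, y0 != 0 &
  [/\ forall l c, (0 < l <= k)%N -> near_layer_opt e l y c -> c \in layer_opt l y0,
      forall c, near_black_opt e y c -> c \in black_opt y0
    & forall i, (i < N)%N -> dot y (w i) < e * `|y| -> dot y0 (w i) <= 0].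
Proof.
pose T := ({ffun 'I_k.+1 -> {set ladder k d}} * {set 'I_N})%type.
pose J := ('I_k.+1 * ladder k d * ladder k d * bool + 'I_N)%type.
pose Q (t : T) (j : J) := match j with
  | inl (l, c, c', b) => (c \in t.1 l) && valid d l c'
  | inr i => i \in t.2 end.
pose a (j : J) : 'rV[R]_d.+1 := match j with
  | inl (l, c, c', b) =>
      P l c - (if l == ord0 then sgb R b else 1) *: P l c'
  | inr i => - w i end.
(* An alternative for each pattern t of weak inequalities: some nonzero functional satisfies all of
   them, or every functional violates one of them by a uniform margin. *)
pose S (t : T) (e : R) := (exists2 y0, y0 != 0 & forall j, Q t j -> 0 <= dot y0 (a j))
  \/ forall y, y != 0 -> exists2 j, Q t j & dot y (a j) <= - (e * `|y|).
have [||e e0 he] := @min_eps T S.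
- move=> t; case: (pselect (exists2 y0, y0 != 0 & forall j, Q t j -> 0 <= dot y0 (a j))).
    by move=> h; exists 1 => //; left.
  move=> h; have [|e e0 he] := @uniform_margin R d J (Q t) a; last by exists e => //; right.
  move=> y y0; apply: contrapT => h'; apply: h; exists y => // j Qj.
  by rewrite leNgt; apply/negP => dj; apply: h'; exists j.
- move=> t e e' [h|h] /andP[e'0 ee']; [by left|right => y /h[j Qj dj]].
  exists j => //; apply: le_trans dj _.
  by rewrite lerN2 ler_wpM2r.
exists e => // y y0.
pose t : T := ([ffun l : 'I_k.+1 => if l == ord0 then [set c | `[< near_black_opt e y c >]]%SET
   else [set c | `[< near_layer_opt e l y c >]]%SET], [set i : 'I_N | dot y (w i) < e * `|y|]%SET).
have [|/(_ _ y0)[j]] := he t.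
  case=> z z0 hz; exists z => //; split.
  - move=> l c /andP[l0 lk] nc; have [vc _] := nc; apply/layer_optP; split => // c' vc'.
    have lk' : (l < k.+1)%N by [].
    have := hz (inl (Ordinal lk', c, c', true)).
    rewrite /= ffunE -val_eqE /= eqn0Ngt l0 /= inE asboolT //= => /(_ vc').
    by rewrite scale1r dotBr subr_ge0.
  - move=> c nc; have [vc _] := nc; apply/black_optP; split => // c' vc'.
    have q b : 0 <= dot z (a (inl (ord0, c, c', b))).
      by apply: hz; rewrite /= ffunE eqxx inE asboolT.
    have := q true; have := q false; rewrite /a eqxx /sgb !dotBr !dotZr ler_norml.
    by move=> h1 h2; apply/andP; split; lra.
  - move=> i iN wi; have := hz (inr (Ordinal iN)); rewrite /= inE wi => /(_ isT).
    by rewrite dotNr oppr_ge0.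
case: j => [[[[l c] c'] b]|i]; rewrite /Q /a /=; last first.
  by rewrite inE dotNr => h; rewrite lerN2 leNgt h.
rewrite ffunE; case: eqP => [->|ln]; rewrite inE => /andP[/asboolP[vc h] vc'].
  have := h _ vc'; rewrite dotBr dotZr => h1 h2; exfalso.
  have := ler_norm (sgb R b * dot y (P 0 c')); rewrite normrM normr_sgb mul1r.
  rewrite /= in h2; lra.
have := h _ vc'; rewrite dotBr dotZr mul1r => h1 h2; exfalso; lra.
Qed.

End Patterns.
End Levels.

(* [lia] preprocesses the real-valued hypotheses as well, which is very slow. *)
Ltac lian := repeat match goal with
  | H : is_true (leq _ _) |- _ => revert H
  | H : is_true (leq _ _ && leq _ _) |- _ => revert H
  | H : is_true (~~ (@eq_op nat _ _)) |- _ => revert H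
  | H : @eq nat _ _ |- _ => revert H
  | H : @eq bool (odd _) _ |- _ => revert H
  | H : @eq bool (leq _ _) _ |- _ => revert H
  end; clear; lia.

(** * Raising the dimension *)

Section Step.
Variables (R : realType) (k d : nat).
Variables (P : nat -> ladder k d -> 'rV[R]_d.+1) (w : nat -> 'rV[R]_d.+1).
Hypothesis k_gt0 : (0 < k)%N.

Lemma lab_last d' l (c : ladder k d') i :
  (k <= l)%N -> valid d' l c -> lab d' l c i = false.
Proof.
move=> kl vc; have lk := valid_le vc; have {lk kl} lk : l = k by lia.
apply/negP => lc; have [supp siz _ _] := lab_stable vc.
have [_ ik] := supp _ lc; have i_n : (i < (k.*2 + d').+1)%N by lia.
by move: siz; rewrite (bigD1 (Ordinal i_n)) //= lc lk; lia.
Qed.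

Lemma valid_last_unique d' l (c c' : ladder k d') :
  (k <= l)%N -> valid d' l c -> valid d' l c' -> c = c'.
Proof.
elim: d' l c c' => [|d' IH] l.
  by move=> /= c c' kl; rewrite ltnNge kl /= => /andP[_ ->] /andP[_ ->].
move=> [m c] [m' c'] kl /= /andP[lm vc] /andP[lm' vc'].
have e0 : m = ord_max by apply: val_inj; apply/eqP; rewrite eqn_leq (leq_trans kl lm) -ltnS ltn_ord.
have e' : m' = ord_max by apply: val_inj; apply/eqP; rewrite eqn_leq (leq_trans kl lm') -ltnS ltn_ord.
by subst m m'; rewrite (IH _ _ _ (leqnn k) vc vc').
Qed.

Lemma valid_last_ex d' : exists c : ladder k d', valid d' k c.
Proof.
elim: d' => [|d' [c vc]]; first by exists true; rewrite /= eqxx orbT.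
by exists (ord_max, c); rewrite /= leqnn.
Qed.

(** * Scales, offsets and heights *)

Variables (C0 c0 e u : R).
Hypothesis C0_ge1 : 1 <= C0.
Hypothesis c0_01 : 0 < c0 <= 1.
Hypothesis e_01 : 0 < e <= 1.
Hypothesis u_gt0 : 0 < u.
Hypothesis u_small : 100 * C0 * u <= c0 * e.
Hypothesis P_last : forall c, P k c = 0.
Hypothesis P_le : forall m c y, (m <= k)%N -> `|dot y (P m c)| <= C0 * `|y|.
Hypothesis w_le : forall i y, (i <= k.*2 + d)%N -> `|dot y (w i)| <= C0 * `|y|.
Hypothesis P_ge : forall m (y : 'rV[R]_d.+1), (0 < m < k)%N ->
  exists2 c, valid d m c & c0 * `|y| <= dot y (P m c).
Hypothesis P0_ge : forall (y : 'rV[R]_d.+1), exists2 c, valid d 0 c & c0 * `|y| <= `|dot y (P 0 c)|.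

Let u_c0 : 100 * C0 * u <= c0.
Proof. by apply: le_trans u_small _; rewrite ler_piMr //; case/andP: c0_01 e_01 => /ltW ? _ /andP[]. Qed.
Let u_e : 100 * C0 * u <= e.
Proof. by apply: le_trans u_small _; rewrite ler_piMl //; case/andP: e_01 c0_01 => /ltW ? _ /andP[]. Qed.
Let u_100 : 100 * u <= 1.
Proof.
have [_ c1] := andP c0_01; apply: le_trans (le_trans u_c0 c1).
by rewrite mulrAC ler_peMr // mulr_ge0 // ltW.
Qed.

Let u_le1 : u <= 1. Proof. by have := u_gt0; have := u_100; lra. Qed.

Lemma upow_le a b : (a <= b)%N -> u ^+ b <= u ^+ a.
Proof. by move=> ab; apply: ler_wiXn2l => //; rewrite ltW. Qed.

Lemma upow_gt0 a : 0 < u ^+ a. Proof. exact: exprn_gt0. Qed.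

Lemma upow_lt a b : (a < b)%N -> 100 * u ^+ b <= u ^+ a.
Proof.
move=> ab; have := upow_le ab; rewrite exprS => h.
have : 100 * (u * u ^+ a) <= u ^+ a.
  by rewrite mulrA ler_piMl // ltW ?upow_gt0.
lra.
Qed.

Let C0_gt0 : 0 < C0. Proof. exact: lt_le_trans ltr01 C0_ge1. Qed.
Let c0_gt0 : 0 < c0. Proof. by case/andP: c0_01. Qed.
Let e_gt0 : 0 < e. Proof. by case/andP: e_01. Qed.

Lemma shrink a b (Y : R) : (a < b)%N -> 0 <= Y ->
  100 * (u ^+ b * (C0 * Y)) <= u ^+ a * (c0 * Y).
Proof.
move=> ab Y0; have h : u ^+ b <= u ^+ a * u by rewrite -exprSr upow_le.
have h1 : 100 * (u ^+ b * (C0 * Y)) <= u ^+ a * (100 * C0 * u * Y).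
  rewrite (_ : u ^+ a * _ = 100 * (u ^+ a * u * (C0 * Y))); last by ring.
  by rewrite ler_wpM2l // ler_wpM2r // mulr_ge0 // ltW.
apply: le_trans h1 _; rewrite ler_wpM2l ?(ltW (upow_gt0 _)) //.
by rewrite ler_wpM2r // u_c0.
Qed.

(** The exponent exceeds every m + gap_exp l s m with l <= m < k, which is at most 4k; moreover xi =
    u^(k+1) u^(3k) is what [xi_small] needs. *)
Definition xi : R := u ^+ (4 * k + 1).

(* Heights of the new points, up to the sign (-1)^(m+1) and a generic error of size
   at most xi. They increase with m, with gaps (see [offset_gap]) on the scale
   u^(m + gap_exp l s m), which is what makes the optimal types m at a given y fall in
   a short range. *)
Definition offset (l m : nat) : R :=
  if l == 0%N then u ^+ 2 - u ^+ (4 * m + 2)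
  else (if odd (m - l) then u ^+ (4 * l + 1) else u ^+ (4 * l + 4)) - u ^+ (4 * m + 4).

(** The order of |y'|/|v|, as a power of u, at which higher types take over from type m; s is the
    sign of v. At m = l > 0 the exponent depends on whether the next active type is l + 1 or l + 2,
    so that the thresholds fit between the multiples 3j used by [next_wts]. *)
Definition gap_exp (l : nat) (s : bool) (m : nat) : nat :=
  if l == 0%N then (3 * m + 2)%N
  else if m == l then (if odd l.+1 == s then (3 * l + 1)%N else (3 * l + 4)%N)
  else (3 * m + 4)%N.

(** The types whose height can count in favour when v has sign s: for l = 0 the antipode is
    available, at m = l the offset vanishes, and otherwise the sign (-1)^(m+1) has to agree with
    that of v. *)
Definition active (l : nat) (s : bool) (m : nat) : bool :=
  [|| l == 0%N, m == l | odd m == s].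

Lemma offsetxx l : offset l l = 0.
Proof. by rewrite /offset subnn /=; case: eqP => [->|_]; rewrite ?muln0 subrr. Qed.

Lemma offset_gap l s m m' : active l s m -> active l s m' -> (l <= m < m')%N ->
  u ^+ (m + gap_exp l s m) / 2 <= offset l m' - offset l m <= u ^+ (m + gap_exp l s m).
Proof.
move=> am am' /andP[lm mm'].
have key a b x : (a < b)%N -> x = u ^+ a - u ^+ b -> u ^+ a / 2 <= x <= u ^+ a.
  by move=> ab ->; have := upow_lt ab; have := upow_gt0 b => h1 h2; lra.
case: (posnP l) => [l0|l0].
  rewrite /offset /gap_exp l0 /=; apply: (key _ (4 * m' + 2)%N); first by lian.
  by rewrite (_ : (m + (3 * m + 2) = 4 * m + 2)%N); [ring|lian].
have l00 : (l == 0%N) = false by lian.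
have [ml|ml] := eqVneq m l.
  rewrite ml offsetxx subr0 /offset /gap_exp l00 eqxx.
  have sm : odd m' = s.
    by move: am'; rewrite /active l00 gtn_eqF /=; [move=> /eqP|rewrite -ml].
  have -> : odd (m' - l) = (odd l.+1 == s).
    by rewrite -sm oddB ?oddS; [case: (odd m'); case: (odd l)|lian].
  case: ifP => _.
    by apply: (key _ (4 * m' + 4)%N); [|congr (_ ^+ _ - _)]; lian.
  by apply: (key _ (4 * m' + 4)%N); [|congr (_ ^+ _ - _)]; lian.
have lm' : (l < m)%N by rewrite ltn_neqAle eq_sym ml.
have ml' : m' != l by rewrite gtn_eqF // (ltn_trans lm').
rewrite /offset /gap_exp l00 (negbTE ml).
move: am am'; rewrite /active l00 (negbTE ml) (negbTE ml') /= => /eqP sm /eqP sm'.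
have -> : odd (m' - l) = odd (m - l) by rewrite !oddB ?sm ?sm' //; lian.
apply: (key _ (4 * m' + 4)%N); first by lian.
by rewrite (_ : (m + (3 * m + 4) = 4 * m + 4)%N); [ring|lian].
Qed.

Lemma offset_big l m : (l < m)%N -> (l < k)%N -> 4 * xi <= offset l m.
Proof.
move=> lm lk; rewrite /offset /xi; have [l0|l0] := posnP l.
  have h1 := @upow_lt 2 (4 * m + 2) ltac:(lian).
  have h2 := @upow_lt 2 (4 * k + 1) ltac:(lian).
  rewrite ?l0 /=; have := upow_gt0 2; lra.
have l00 : (l == 0%N) = false by lian.
rewrite ?l00; case: ifP => _.
  have h1 := @upow_lt (4 * l + 1) (4 * m + 4) ltac:(lian).
  have h2 := @upow_lt (4 * l + 1) (4 * k + 1) ltac:(lian).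
  have := upow_gt0 (4 * l + 1); lra.
have h1 := @upow_lt (4 * l + 4) (4 * m + 4) ltac:(lian).
have h2 := @upow_lt (4 * l + 4) (4 * k + 1) ltac:(lian).
have := upow_gt0 (4 * l + 4); lra.
Qed.

Lemma xi_gap l s m : (l <= m)%N -> (m < k)%N -> 100 * xi <= u ^+ (m + gap_exp l s m).
Proof.
move=> lm mk; apply: upow_lt; rewrite /gap_exp.
case: ifP => _; first by lian.
case: ifP => [/eqP ml|_]; last by lian.
by case: ifP => _; lian.
Qed.

Lemma xi_gt0 : 0 < xi. Proof. exact: upow_gt0. Qed.

Variable height : nat -> ladder k d.+1 -> R.
Hypothesis hhE : forall l (c : ladder k d.+1), `|height l c - sgb R (odd c.1) * offset l c.1| <= xi.
Hypothesis hh_old : forall l (c : ladder k d.+1), (0 < l)%N -> c.1 = l :> nat -> 0 < sgb R (~~ odd k) * height l c.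

(* [lra] on the goal alone. Its preprocessing fails when section variables are
   cleared, so they are listed, and listed again whenever one is added. *)
Ltac lrac := clear -R k d P w k_gt0 C0 c0 e u C0_ge1 c0_01 e_01 u_gt0 u_small P_last
  P_le w_le P_ge P0_ge u_c0 u_e u_100 u_le1 C0_gt0 c0_gt0 e_gt0 height hhE hh_old; lra.

Definition next_pts (l : nat) (c : ladder k d.+1) : 'rV[R]_d.+2 :=
  if (l < k)%N then pt (u ^+ c.1 *: P c.1 c.2) (height l c) else 0.

(** Here j is the depth of i below the nearer end of the cycle. A rim element of depth j belongs to
    optimal cells only for v of sign (-1)^j, and then |v| u^(3j) outweighs the old witness. For i in
    the remaining set the old witness wins whenever the two terms disagree in sign. The element 2k +
    d + 1 is new and has no old witness. *)
Definition next_wts (i : nat) : 'rV[R]_d.+2 :=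
  if i == (k.*2 + d.+1)%N then pt 0 1
  else let j := minn (minn i (k.*2 + d.+1 - i)) k in
       pt (w i) (sgb R (~~ odd j) * u ^+ (3 * j)).

Lemma dot_next_pts l c y : (l < k)%N ->
  dot y (next_pts l c) = u ^+ c.1 * dot (trunc y) (P c.1 c.2) + lastc y * height l c.
Proof. by move=> lk; rewrite /next_pts lk dot_pt dotZr. Qed.

Lemma sgb_val (v : R) : v = sgb R (0 <= v) * `|v|.
Proof.
have [h|h] : 0 <= v \/ v < 0 by case: (lerP 0 v) => h; [left|right].
  by rewrite h /sgb mul1r ger0_norm.
by rewrite leNgt h /sgb /= mulN1r ltr0_norm // opprK.
Qed.

Lemma sgbM b b' : sgb R b * sgb R b' = sgb R (b == b').
Proof. by case: b; case: b'; rewrite /sgb; ring. Qed.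

Lemma hh_val l c (v : R) :
  `|v * height l c - sgb R ((0 <= v) == odd c.1) * (`|v| * offset l c.1)| <= `|v| * xi.
Proof.
have -> : v * height l c - sgb R ((0 <= v) == odd c.1) * (`|v| * offset l c.1) =
    v * (height l c - sgb R (odd c.1) * offset l c.1).
  rewrite -sgbM [in RHS]mulrBr; congr (_ - _); rewrite [in RHS](sgb_val v); ring.
by rewrite normrM ler_wpM2l.
Qed.

(* Signed optimality: for the bottom layer both signs of every point compete,
   for the other layers only the points themselves. *)
Definition dom (l : nat) y (c : ladder k d.+1) : Prop := valid d.+1 l c /\
  forall c' b, valid d.+1 l c' -> (l == 0%N) || b ->
    sgb R b * dot y (next_pts l c') <= dot y (next_pts l c).

Lemma layer_opt_dom l y c : (0 < l)%N -> (c \in layer_opt next_pts l y) <-> dom l y c.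
Proof.
move=> l0; rewrite /dom eqn0Ngt l0 /=; split.
  by move=> /layer_optP[vc h]; split => // c' [] // vc' _; rewrite /sgb mul1r h.
move=> [vc h]; apply/layer_optP; split => // c' vc'.
by have := h c' true vc' isT; rewrite /sgb mul1r.
Qed.

Lemma black_opt_dom y c : (c \in black_opt next_pts y) <-> dom 0 y c.
Proof.
split.
  move=> /black_optP[vc h]; split => // c' b vc' _; apply: le_trans (h _ vc').
  by apply: le_trans (ler_norm _) _; rewrite normrM normr_sgb mul1r.
move=> [vc h]; apply/black_optP; split => // c' vc'; rewrite ler_norml.
have := h c' true vc' isT; have := h c' false vc' isT; rewrite /sgb; lra.
Qed.

(** * Comparing the types at an optimum *)

Lemma validS l (c : ladder k d.+1) : valid d.+1 l c -> [/\ (l <= c.1)%N, (c.1 <= k)%N & valid d c.1 c.2].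
Proof. by move=> /= /andP[h1 h2]; split => //; rewrite -ltnS. Qed.

Lemma lower_cmp l m y : (l <= m <= k)%N -> (l < k)%N -> active l (0 <= lastc y) m ->
  exists (c : ladder k d.+1) b, [/\ valid d.+1 l c, (l == 0%N) || b, c.1 = m :> nat &
    (if (m < k)%N then u ^+ m * (c0 * `|trunc y|) else 0) +
      `|lastc y| * offset l m - `|lastc y| * xi <= sgb R b * dot y (next_pts l c)].
Proof.
move=> /andP[lm mk] lk act; have mk1 : (m < k.+1)%N by [].
set v := lastc y; set s := 0 <= v in act.
have := hh_val l; have [m0|m0] := posnP m => hv.
  have [c vc hc] := P0_ge (trunc y).
  have l0 : l = 0%N by lian.
  subst m l; pose b := 0 <= dot (trunc y) (P 0 c).
  exists (ord0, c), b; split => //=.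
  have := hv (ord0, c) v; rewrite /= offsetxx !mulr0 subr0 => h.
  rewrite k_gt0 dot_next_pts //= expr0 !mul1r addr0 mulrDr -/v.
  have -> : sgb R b * dot (trunc y) (P 0 c) = `|dot (trunc y) (P 0 c)|.
    by rewrite {1}[dot _ _]sgb_val mulrA sgbM eqxx /sgb mul1r.
  have : `|sgb R b * (v * height 0 (ord0, c))| <= `|v| * xi by rewrite normrM normr_sgb mul1r.
  by rewrite ler_norml => /andP[]; lra.
pose b := (l != 0%N) || (s == odd m).
have [c vc hc] : exists2 c, valid d m c &
    (if (m < k)%N then c0 * `|trunc y| else 0) <= sgb R b * dot (trunc y) (P m c).
  case: ifP => mk'.
    have [|c vc hc] := @P_ge m (sgb R b *: trunc y); first by rewrite m0.
    by exists c => //; move: hc; rewrite normrZ normr_sgb mul1r dotZl.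
  have [c vc] := valid_last_ex d; have -> : m = k by lian.
  by exists c => //; rewrite P_last dot0r mulr0.
exists (Ordinal mk1, c), b; split => //=; first by rewrite lm.
  by rewrite /b; case: (l == 0%N).
have h := hv (Ordinal mk1, c) v; rewrite /= -/s in h.
rewrite dot_next_pts //= mulrDr -/v.
have h1 : (if (m < k)%N then u ^+ m * (c0 * `|trunc y|) else 0) <=
    sgb R b * (u ^+ m * dot (trunc y) (P m c)).
  rewrite [X in _ <= X]mulrCA; apply: le_trans (ler_wpM2l (ltW (upow_gt0 m)) hc).
  by case: ifP => _; rewrite ?mulr0.
have h2 : `|v| * offset l m - `|v| * xi <= sgb R b * (v * height l (Ordinal mk1, c)).
  have : `|sgb R b * (v * height l (Ordinal mk1, c) - sgb R (s == odd m) * (`|v| * offset l m))|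
     <= `|v| * xi by rewrite normrM normr_sgb mul1r.
  rewrite mulrBr [sgb R b * (sgb R _ * _)]mulrA sgbM.
  have -> : sgb R (b == (s == odd m)) * (`|v| * offset l m) = `|v| * offset l m.
    have [ml|ml] := eqVneq m l; first by rewrite ml offsetxx !mulr0.
    rewrite [b == _](_ : _ = true) /sgb ?mul1r //; move: act; rewrite /active /b (negbTE ml) /=.
    by case: (l == 0%N) => /=; rewrite ?eqxx // => /eqP ->; rewrite eqxx.
  by rewrite ler_norml => /andP[]; lra.
by rewrite -addrA; exact: lerD.
Qed.

Lemma upper_self l y c : (l < k)%N -> dot y (next_pts l c) <=
  u ^+ c.1 * (C0 * `|trunc y|)
  + sgb R ((0 <= lastc y) == odd c.1) * (`|lastc y| * offset l c.1) + `|lastc y| * xi.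
Proof.
move=> lk; rewrite dot_next_pts // -addrA lerD //.
  rewrite ler_wpM2l ?(ltW (upow_gt0 _)) //; apply: le_trans (ler_norm _) _.
  by apply: P_le; rewrite -ltnS.
by have := hh_val l c (lastc y); rewrite ler_norml => /andP[_]; rewrite lerBlDl.
Qed.

Lemma norm_eq0_pt (y : 'rV[R]_d.+2) : `|trunc y| <= 0 -> `|lastc y| <= 0 -> y = 0.
Proof.
rewrite !normr_le0 => /eqP t /eqP l.
by apply: pt_inj; rewrite ?t ?l ?trunc0 ?lastc0.
Qed.

(** A cell of an inactive type m > l loses to type l: its height counts against it by at least 4 xi
    |v|, more than both errors, and its horizontal part is smaller by a factor of order u. *)
Lemma dom_active l y c : (l < k)%N -> y != 0 -> dom l y c ->
  c.1 = l :> nat \/ odd c.1 = (0 <= lastc y).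
Proof.
move=> lk y0 [vc h]; have [lc ck _] := validS vc.
case: (eqVneq (c.1 : nat) l) => [|cl]; [by left|right].
apply/eqP/negPn/negP => nodd; move/eqP: y0; apply.
have lcl : (l < c.1)%N by rewrite ltn_neqAle eq_sym cl.
have all_ : active l (0 <= lastc y) l by rewrite /active eqxx orbT.
have [|c' [b [vc' lb c'1]]] := @lower_cmp l l y _ lk all_; first by rewrite leqnn ltnW.
rewrite lk offsetxx mulr0 addr0 => h1.
have := le_trans h1 (le_trans (h _ _ vc' lb) (upper_self y c lk)).
rewrite eq_sym (negbTE nodd) /sgb mulN1r => h2.
have h3 := shrink lcl (normr_ge0 (trunc y)).
have h4 := ler_wpM2l (normr_ge0 (lastc y)) (offset_big lcl lk).
have h5 : 0 <= u ^+ l * (c0 * `|trunc y|).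
  by rewrite !mulr_ge0 ?(ltW (upow_gt0 _)) //; case/andP: c0_01 => /ltW.
have h6 : 0 <= `|lastc y| * xi by rewrite mulr_ge0 // ltW ?xi_gt0.
have h7 : u ^+ l * (c0 * `|trunc y|) = 0 by lra.
have h8 : `|lastc y| * xi = 0 by lra.
apply: norm_eq0_pt.
  move/eqP: h7; rewrite mulf_eq0 (gt_eqF (upow_gt0 _)) /= mulf_eq0 (gt_eqF c0_gt0) /=.
  by move/eqP => ->.
by move/eqP: h8; rewrite mulf_eq0 (gt_eqF xi_gt0) orbF => /eqP ->.
Qed.

Lemma self_sign l y c : (l < k)%N -> y != 0 -> dom l y c ->
  sgb R ((0 <= lastc y) == odd c.1) * (`|lastc y| * offset l c.1) = `|lastc y| * offset l c.1.
Proof.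
move=> lk y0 dc; case: (dom_active lk y0 dc) => [->|->]; first by rewrite offsetxx !mulr0.
by rewrite eqxx /sgb mul1r.
Qed.

Lemma self_active l y c : (l < k)%N -> y != 0 -> dom l y c ->
  active l (0 <= lastc y) c.1.
Proof.
move=> lk y0 dc; rewrite /active.
by case: (dom_active lk y0 dc) => ->; rewrite eqxx ?orbT.
Qed.

(** Together with [dom_lower] this traps |y'|/|v|: were |v| larger, the gain in height at type m
    would beat the whole horizontal part of c; were |y'| larger, the horizontal part of a lower type
    would beat the gain in height. *)
Lemma dom_upper l y c m : (l < k)%N -> y != 0 -> dom l y c ->
  (c.1 < m <= k)%N -> active l (0 <= lastc y) m ->
  `|lastc y| * u ^+ gap_exp l (0 <= lastc y) c.1 <= 4 * C0 * `|trunc y|.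
Proof.
move=> lk y0 dc /andP[cm mk] am; have [vc h] := dc; have [lc ck _] := validS vc.
set V : R := `|lastc y|; set s := 0 <= lastc y.
have [|c' [b [vc' lb c'1 h1]]] := @lower_cmp l m y _ lk am; first by lian.
have := le_trans h1 (le_trans (h _ _ vc' lb) (upper_self y c lk)).
rewrite self_sign // -/V => h2.
have /andP[h3 _] : u ^+ (c.1 + gap_exp l s c.1) / 2 <= offset l m - offset l c.1 <= u ^+ (c.1 + gap_exp l s c.1).
  by apply: offset_gap => //; [exact: self_active|lian].
have h4 : 100 * xi <= u ^+ (c.1 + gap_exp l s c.1) by apply: xi_gap => //; lian.
have h5 : 0 <= (if (m < k)%N then u ^+ m * (c0 * `|trunc y|) else 0).
  case: ifP => // _; rewrite !mulr_ge0 ?(ltW (upow_gt0 _)) //.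
  by case/andP: c0_01 => /ltW.
have V0 : 0 <= V by exact: normr_ge0.
have h6 : V * (u ^+ (c.1 + gap_exp l s c.1) / 4) <= u ^+ c.1 * (C0 * `|trunc y|).
  have : V * (u ^+ (c.1 + gap_exp l s c.1) / 4) <= V * (offset l m - offset l c.1 - 2 * xi).
    by apply: ler_wpM2l => //; move: h3 h4 xi_gt0; lrac.
  by move: h2 h5; lrac.
rewrite exprD in h6; rewrite -(ler_pM2l (upow_gt0 c.1)).
have -> : u ^+ c.1 * (V * u ^+ gap_exp l s c.1) = 4 * (V * (u ^+ c.1 * u ^+ gap_exp l s c.1 / 4)) by field.
have -> : u ^+ c.1 * (4 * C0 * `|trunc y|) = 4 * (u ^+ c.1 * (C0 * `|trunc y|)) by ring.
by rewrite ler_pM2l.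
Qed.

Lemma dom_lower l y c m : (l < k)%N -> y != 0 -> dom l y c ->
  (l <= m < c.1)%N -> active l (0 <= lastc y) m ->
  c0 * `|trunc y| <= 4 * (`|lastc y| * u ^+ gap_exp l (0 <= lastc y) m).
Proof.
move=> lk y0 dc /andP[lm mc] am; have [vc h] := dc; have [lc ck _] := validS vc.
set V : R := `|lastc y|; set s := 0 <= lastc y.
have mk : (m < k)%N by lian.
have [|c' [b [vc' lb c'1]]] := @lower_cmp l m y _ lk am; first by lian.
rewrite mk => h1.
have := le_trans h1 (le_trans (h _ _ vc' lb) (upper_self y c lk)).
rewrite self_sign // -/V => h2.
have /andP[_ h3] : u ^+ (m + gap_exp l s m) / 2 <= offset l c.1 - offset l m <= u ^+ (m + gap_exp l s m).
  by apply: offset_gap => //; [exact: self_active|lian].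
have h4 : 100 * xi <= u ^+ (m + gap_exp l s m) by apply: xi_gap.
have h5 := shrink mc (normr_ge0 (trunc y)).
have h7 : 0 <= u ^+ m * (c0 * `|trunc y|).
  by rewrite !mulr_ge0 ?(ltW (upow_gt0 _)) // ltW.
have V0 : 0 <= V by exact: normr_ge0.
have h6 : u ^+ m * (c0 * `|trunc y|) / 2 <= V * (2 * u ^+ (m + gap_exp l s m)).
  have : V * (offset l c.1 - offset l m + 2 * xi) <= V * (2 * u ^+ (m + gap_exp l s m)).
    by apply: ler_wpM2l => //; move: h3 h4 xi_gt0; lrac.
  by move: h2 h5 h7; lrac.
rewrite exprD in h6; rewrite -(ler_pM2l (upow_gt0 m)).
have -> : u ^+ m * (4 * (V * u ^+ gap_exp l s m)) = 2 * (V * (2 * (u ^+ m * u ^+ gap_exp l s m))) by ring.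
by move: h6; lrac.
Qed.

(** The two bounds put |y'|/|v| at least at the order of u^a and at most at that of u^b. The factor
    100 in [u_small] absorbs the constants 4, C0 and c0. *)
Lemma clash a b (y : 'rV[R]_d.+2) : (a < b)%N -> y != 0 ->
  `|lastc y| * u ^+ a <= 4 * C0 * `|trunc y| ->
  c0 * `|trunc y| <= 4 * (`|lastc y| * u ^+ b) -> False.
Proof.
move=> ab y0 h1 h2; move/eqP: y0; apply.
have h3 : u ^+ b <= u * u ^+ a by rewrite -exprS upow_le.
have h4 : `|lastc y| * u ^+ b <= u * (4 * C0 * `|trunc y|).
  apply: le_trans (ler_wpM2l (normr_ge0 _) h3) _.
  by rewrite mulrCA ler_wpM2l // ltW.
have h5 : 100 * C0 * u * `|trunc y| <= c0 * `|trunc y| by rewrite ler_wpM2r.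
have h6 : 0 <= u * (4 * C0 * `|trunc y|) by rewrite !mulr_ge0 // ltW.
have t0 : c0 * `|trunc y| <= 0 by move: h2 h4 h5 h6; lrac.
have t1 : `|trunc y| <= 0 by rewrite -(pmulr_rle0 _ c0_gt0).
apply: norm_eq0_pt => //; rewrite -(pmulr_lle0 _ (upow_gt0 a)).
by apply: le_trans h1 _; rewrite mulr_ge0_le0 // mulr_ge0 // ltW.
Qed.

Lemma trunc_neq0 a (y : 'rV[R]_d.+2) : y != 0 -> `|lastc y| * u ^+ a <= 4 * C0 * `|trunc y| -> trunc y != 0.
Proof.
move=> y0 h; apply: contra y0 => /eqP t0; apply/eqP/norm_eq0_pt; first by rewrite t0 normr0.
by move: h; rewrite t0 normr0 mulr0 pmulr_lle0 ?upow_gt0.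
Qed.

Lemma far_le a (y : 'rV[R]_d.+2) : (a <= 3 * k)%N -> `|lastc y| * u ^+ a <= 4 * C0 * `|trunc y| ->
  `|lastc y| * u ^+ (3 * k) <= 4 * C0 * `|trunc y|.
Proof. by move=> ak; apply: le_trans; rewrite ler_wpM2l // upow_le. Qed.

(** The hypothesis, which recurs below as [far], says that y is not too steep. It bounds |v| xi =
    u^(k+1) (|v| u^(3k)), and the spare power of u brings the errors below the margin e at the scale
    u^m of layer m. *)
Lemma xi_small m (y : 'rV[R]_d.+2) : (m <= k)%N -> trunc y != 0 ->
  `|lastc y| * u ^+ (3 * k) <= 4 * C0 * `|trunc y| ->
  2 * (`|lastc y| * xi) < u ^+ m * (e * `|trunc y|).
Proof.
move=> mk t0 h; have Y0 : 0 < `|trunc y| by rewrite normr_gt0.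
have -> : `|lastc y| * xi = u ^+ k.+1 * (`|lastc y| * u ^+ (3 * k)).
  by rewrite mulrCA -exprD /xi; congr (_ * _ ^+ _); lian.
have h1 : u ^+ k.+1 <= u * u ^+ m by rewrite -exprS upow_le.
have h2 : u ^+ k.+1 * (`|lastc y| * u ^+ (3 * k)) <= u * u ^+ m * (4 * C0 * `|trunc y|).
  by apply: ler_pM => //; rewrite ?(ltW (upow_gt0 _)) // mulr_ge0 // ltW ?upow_gt0.
have h3 : u ^+ m * `|trunc y| * (100 * C0 * u) <= u ^+ m * `|trunc y| * e.
  by rewrite ler_wpM2l // mulr_ge0 // ltW ?upow_gt0.
have h4 : 0 < u ^+ m * `|trunc y| * e by rewrite !mulr_gt0 ?upow_gt0.
by move: h2 h3 h4; lrac.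
Qed.

Lemma hh_close l (c c' : ladder k d.+1) (v : R) : c.1 = c'.1 :> nat -> v * height l c <= v * height l c' + 2 * (`|v| * xi).
Proof.
move=> cc; have := hh_val l c v; have := hh_val l c' v; rewrite -cc !ler_norml.
move=> /andP[h1 _] /andP[_ h2]; move: h1 h2; lrac.
Qed.

Lemma dom_near l (y : 'rV[R]_d.+2) (c : ladder k d.+1) : (l < k)%N -> dom l y c -> (0 < c.1)%N -> trunc y != 0 ->
  `|lastc y| * u ^+ (3 * k) <= 4 * C0 * `|trunc y| ->
  near_layer_opt P e c.1 (trunc y) c.2.
Proof.
move=> lk [vc h] c1 t0 far; have [lc ck vc2] := validS vc; split => // c' vc'.
have vcc : valid d.+1 l (c.1, c') by rewrite /= lc.
have := h (c.1, c') true vcc (orbT _); rewrite /sgb mul1r !dot_next_pts //= => h1.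
have h2 := @hh_close l c (c.1, c') (lastc y) erefl.
have h3 := xi_small ck t0 far.
rewrite -(ltr_pM2l (upow_gt0 c.1)) mulrDr.
by move: h1 h2 h3; lrac.
Qed.

Lemma dom_near0 (y : 'rV[R]_d.+2) (c : ladder k d.+1) : dom 0 y c -> c.1 = 0%N :> nat -> trunc y != 0 ->
  `|lastc y| * u ^+ (3 * k) <= 4 * C0 * `|trunc y| ->
  near_black_opt P e (trunc y) c.2.
Proof.
move=> [vc h] c1 t0 far; have [lc ck vc2] := validS vc; rewrite c1 in vc2.
split => // c' vc'.
have h0 (c'' : ladder k d.+1) : c''.1 = 0%N :> nat -> `|lastc y * height 0 c''| <= `|lastc y| * xi.
  by move=> e0; have := hh_val 0 c'' (lastc y); rewrite e0 offsetxx !mulr0 subr0.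
have h3 := xi_small (leq0n k) t0 far; rewrite expr0 mul1r in h3.
have vcc : valid d.+1 0 ((ord0, c') : ladder k d.+1) by [].
have h1 := h0 c c1; have h2 := h0 (ord0, c') erefl.
have h4 b := h (ord0, c') b vcc isT.
rewrite ltr_norml; move: h1 h2 (h4 true) (h4 false); rewrite !dot_next_pts //= c1 expr0 !mul1r /sgb.
rewrite !ler_norml => /andP[h5 h6] /andP[h7 h8] h9 h10.
by apply/andP; split; move: h3 h5 h6 h7 h8 h9 h10; lrac.
Qed.

(** * Signs of the witnesses *)

Hypothesis sign_old : forall l y c i, (0 < l)%N -> y != 0 -> c \in layer_opt P l y ->
  lab d l c i -> 0 < dot y (w i).
Hypothesis sign_old0 : forall y c i, y != 0 -> c \in black_opt P y -> lab d 0 c i -> 0 < dot y (w i).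
Hypothesis pat : forall y, y != 0 -> exists2 y0, y0 != 0 &
  [/\ forall l c, (0 < l <= k)%N -> near_layer_opt P e l y c -> c \in layer_opt P l y0,
      forall c, near_black_opt P e y c -> c \in black_opt P y0
    & forall i, (i < (k.*2 + d).+1)%N -> dot y (w i) < e * `|y| -> dot y0 (w i) <= 0].

Ltac lrac ::= clear -R k d P w k_gt0 C0 c0 e u C0_ge1 c0_01 e_01 u_gt0 u_small P_last
  P_le w_le P_ge P0_ge u_c0 u_e u_100 u_le1 C0_gt0 c0_gt0 e_gt0 height hhE hh_old sign_old
  sign_old0 pat; lra.

(** Were y'.w_i below the margin, the functional realising the pattern of y' would have an optimal
    cell whose set contains i while being nonpositive on w_i, against the old sign property. *)
Lemma near_sign l (y : 'rV[R]_d.+2) (c : ladder k d.+1) i : (l < k)%N -> dom l y c -> trunc y != 0 ->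
  `|lastc y| * u ^+ (3 * k) <= 4 * C0 * `|trunc y| ->
  lab d c.1 c.2 i -> e * `|trunc y| <= dot (trunc y) (w i).
Proof.
move=> lk dc t0 far li; have [vc _] := dc; have [lc ck vc2] := validS vc.
have [supp _ _ _] := lab_stable vc2; have [i1 i2] := supp _ li.
have [y0 y00 [p1 p2 p3]] := pat t0.
have iN : (i < (k.*2 + d).+1)%N by lian.
rewrite leNgt; apply/negP => /(p3 _ iN); apply/negP; rewrite -ltNge.
have [c1|c1] := posnP c.1.
  rewrite c1 in li; apply: (sign_old0 y00 _ li); apply: p2.
  have l0 : l = 0%N by lian.
  by apply: dom_near0 => //; rewrite -l0.
by apply: (sign_old c1 y00 _ li); apply: p1; [rewrite c1|apply: dom_near dc _ _ _].
Qed.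

Lemma step_sign l (y : 'rV[R]_d.+2) (c : ladder k d.+1) i : (l < k)%N -> y != 0 -> dom l y c ->
  lab d.+1 l c i -> 0 < dot y (next_wts i).
Proof.
move=> lk y0 dc; have [vc _] := dc; have [lc ck vc2] := validS vc.
rewrite /= -/(lab d c.1 c.2 i); set n := (k.*2 + d.+1)%N.
set s := 0 <= lastc y; set V : R := `|lastc y|; set Y : R := `|trunc y|.
have act := dom_active lk y0 dc; rewrite -/s in act.
case/orP => [ri|li].
  have [j [lj jm oj ij]] : exists j, [/\ (l <= j)%N, (j < c.1)%N, odd (c.1 - j) &
      ((i <= n)%N /\ (n - i)%N = j) \/ (i = j /\ (l < j)%N)].
    case/orP: ri => [/and4P[h1 h2 h3 h4]|/and3P[h1 h2 h3]].
      by exists (n - i)%N; split => //; left.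
    by exists i; split => //; [exact: ltnW|right].
  have sj : s = ~~ odd j.
    case: act => [cl|<-]; first by move: lj jm; rewrite cl; clear; lia.
    by move: oj; rewrite oddB ?(ltnW jm) //; case: (odd c.1); case: (odd j).
  (* The nearest active type below that of c: one less for l = 0, where all types are active;
     otherwise two less, or l if that would pass below l. *)
  pose m' := if l == 0%N then c.1.-1 else maxn l (c.1 - 2).
  have m'1 : (l <= m' < c.1)%N.
    by rewrite /m'; case: eqP => [l0|_]; move: lj jm; rewrite ?l0; clear; lia.
  have m'a : active l s m'.
    rewrite /active /m'; case: eqP => //= /eqP l0.
    have [h|h] := leqP (c.1 - 2) l; first by rewrite eqxx.
    case: act => [cl|<-]; first by move: h; rewrite cl; clear; lia.
    by rewrite oddB; [rewrite addbF eqxx orbT|move: h; clear; lia].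
  (* This explains the two exponents at m = l: if the next active type is l + 1 then j = l and 3l +
     1 exceeds 3j; if it is l + 2 then j = l + 1 and 3l + 4 is required. *)
  have ddj : (3 * j < gap_exp l s m')%N.
    rewrite /gap_exp /m'; case: eqP => [l0|/eqP l0]; first by move: jm; clear; lia.
    have [h|h] := leqP (c.1 - 2) l; last first.
      rewrite ifF; last by apply/eqP; move: h; clear; lia.
      by move: h jm; clear; lia.
    rewrite eqxx; case: eqP => os.
      suff : j = l by move=> ->; clear; lia.
      suff : odd j = odd l by move: h lj jm; clear; lia.
      by move: os; rewrite sj oddS; case: (odd j); case: (odd l).
    by move: h lj jm; clear; lia.
  have hL := dom_lower lk y0 dc m'1 m'a; rewrite -/Y -/V -/s in hL.
  have V0 : 0 < V.
    rewrite normr_gt0; apply: contra y0 => /eqP v0; apply/eqP/norm_eq0_pt.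
      by move: hL; rewrite /V v0 normr0 mul0r mulr0 pmulr_rle0.
    by rewrite v0 normr0.
  have vE : lastc y = sgb R (~~ odd j) * V by rewrite -sj -sgb_val.
  rewrite /next_wts -/n; case: eqP => [i_n|i_n].
    have j0 : j = 0%N.
      by case: ij => -[h1 h2]; move: h1 h2 jm ck; rewrite i_n /n; clear; lia.
    by rewrite dot_pt dot0r add0r mulr1 vE j0 /sgb mul1r.
  have -> : minn (minn i (n - i)) k = j.
    case: ij => -[h1 h2]; first by move: h1 h2 jm ck; rewrite /n; clear; lia.
    by move: h1 h2 jm ck; rewrite /n; clear; lia.
  rewrite dot_pt vE mulrACA sgbM eqxx /sgb mul1r.
  have iN : (i <= k.*2 + d)%N.
    by case: ij i_n => -[h1 h2]; move: h1 h2 jm ck; rewrite /n; clear; lia.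
  have := w_le (trunc y) iN; rewrite ler_norml => /andP[hw _]; rewrite -/Y in hw.
  have h3 : u ^+ gap_exp l s m' <= u * u ^+ (3 * j) by rewrite -exprS upow_le.
  have h4 : c0 * Y <= 4 * (V * (u * u ^+ (3 * j))).
    by apply: le_trans hL _; rewrite ler_wpM2l // ler_wpM2l // ltW.
  have h5 : 100 * C0 * u * (V * u ^+ (3 * j)) <= c0 * (V * u ^+ (3 * j)).
    by rewrite ler_wpM2r // mulr_ge0 ?(ltW V0) // ltW ?upow_gt0.
  have h6 : 0 < V * u ^+ (3 * j) by rewrite mulr_gt0 ?upow_gt0.
  have h7 : C0 * Y < V * u ^+ (3 * j).
    rewrite -(ltr_pM2l c0_gt0).
    have h8 : c0 * (C0 * Y) <= C0 * (4 * (V * (u * u ^+ (3 * j)))).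
      by rewrite mulrCA ler_wpM2l // ltW.
    have h9 : 0 < c0 * (V * u ^+ (3 * j)) by rewrite mulr_gt0.
    by move: h5 h8 h9; lrac.
  by move: h7 hw; lrac.
have ck' : (c.1 < k)%N.
  by rewrite ltnNge; apply/negP => kc; rewrite (lab_last _ kc) in li.
have [supp _ _ _] := lab_stable vc2; have [i1 i2] := supp _ li.
rewrite /next_wts -/n ifF; last by apply/eqP; move: i2; rewrite /n; clear; lia.
set j := minn (minn i (n - i)) k.
have cj : (c.1 < j)%N by move: i1 i2 ck'; rewrite /j /n; clear; lia.
have jk : (j <= k)%N by rewrite geq_minr.
have vE : lastc y * (sgb R (~~ odd j) * u ^+ (3 * j)) = sgb R (s == ~~ odd j) * (V * u ^+ (3 * j)).
  by rewrite {1}(sgb_val (lastc y)) -/s -/V -sgbM; ring.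
rewrite dot_pt vE.
have iN : (i <= k.*2 + d)%N by move: i2; clear; lia.
(* If the last coordinates agree in sign, the v term is nonnegative: either y is not too steep and
   [near_sign] applies, or the v term alone outweighs C0 |y'|. *)
case sj : (s == ~~ odd j).
  rewrite /sgb mul1r; have [far|far] := lerP (V * u ^+ (3 * k)) (4 * C0 * Y).
    have t0 : trunc y != 0 by apply: trunc_neq0 y0 far.
    have h1 := near_sign lk dc t0 far li.
    have h2 : 0 < e * `|trunc y| by rewrite mulr_gt0 // normr_gt0.
    have h3 : 0 <= V * u ^+ (3 * j) := mulr_ge0 (normr_ge0 _) (ltW (upow_gt0 _)).
    by move: h1 h2 h3; lrac.
  have := w_le (trunc y) iN; rewrite ler_norml => /andP[hw _]; rewrite -/Y in hw.
  have h1 : V * u ^+ (3 * k) <= V * u ^+ (3 * j).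
    by apply: ler_wpM2l; [exact: normr_ge0|rewrite upow_le // leq_mul2l jk orbT].
  have h2 : 0 <= C0 * Y := mulr_ge0 (ltW C0_gt0) (normr_ge0 _).
  by move: far hw h1 h2; lrac.
(* Now j is itself an active type above that of c. Losing to c bounds |v| u^(3j) by a multiple of u
   |y'|, which is below the margin e |y'|. *)
have {}sj : odd j = s by move: sj; case: (s); case: (odd j).
have aj : active l s j by rewrite /active sj eqxx !orbT.
have jk' : (c.1 < j <= k)%N by rewrite cj.
have hU := dom_upper lk y0 dc jk' aj; rewrite -/V -/Y -/s in hU.
have ddj : (gap_exp l s c.1 < 3 * j)%N.
  rewrite /gap_exp; case: eqP => [l0|/eqP l0].
    case: act => [|sc]; first by rewrite l0 => ->; move: cj; clear; lia.
    by rewrite -sj in sc; move: cj sc; clear; lia.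
  case: eqP => [cl|/eqP cl].
    rewrite cl in cj *; case: eqP => os; first by move: cj; clear; lia.
    by rewrite -sj in os; move: cj os; clear; rewrite oddS; case oj : (odd j); case ol : (odd l) => //= h _; move: h oj ol; clear; lia.
  case: act => [h|sc]; first by rewrite h eqxx in cl.
  by rewrite -sj in sc; move: cj sc; clear; lia.
have far : V * u ^+ (3 * k) <= 4 * C0 * Y.
  by apply: far_le hU; move: ddj jk; clear; lia.
have t0 : trunc y != 0 by apply: trunc_neq0 y0 far.
have h1 := near_sign lk dc t0 far li; rewrite -/Y in h1.
have Y0 : 0 < Y by rewrite normr_gt0.
have h2 : V * u ^+ (3 * j) <= u * (4 * C0 * Y).
  have h3 : u ^+ (3 * j) <= u * u ^+ gap_exp l s c.1 by rewrite -exprS upow_le.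
  apply: le_trans (ler_wpM2l (normr_ge0 _) h3) _.
  by rewrite mulrCA ler_wpM2l // ltW.
have h3 : 100 * C0 * u * Y <= e * Y by rewrite ler_wpM2r // ltW.
have h4 : 0 < e * Y by rewrite mulr_gt0.
by rewrite /sgb mulN1r; move: h1 h2 h3 h4; lrac.
Qed.

(** * The origin inside the new layers; independence *)

Lemma last_val l (y : 'rV[R]_d.+2) : (l < k)%N -> lastc y != 0 ->
  exists2 c : ladder k d.+1, valid d.+1 l c &
    0 < sgb R ((0 <= lastc y) == odd k) * dot y (next_pts l c).
Proof.
move=> lk v0; have [c vc] := valid_last_ex d.
exists (ord_max, c); first by rewrite /= (ltnW lk).
rewrite dot_next_pts //= P_last dot0r mulr0 add0r.
have V0 : 0 < `|lastc y| by rewrite normr_gt0.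
have h1 := hh_val l (ord_max, c) (lastc y); rewrite /= in h1.
set b := (0 <= lastc y) == odd k in h1 *.
have h2 : `|sgb R b * (lastc y * height l (ord_max, c)) - `|lastc y| * offset l k| <= `|lastc y| * xi.
  rewrite -[X in _ - X]mul1r -[1]/(sgb R true) -(eqxx b) -sgbM -mulrA -mulrBr.
  by rewrite normrM normr_sgb mul1r.
have h3 := ler_wpM2l (ltW V0) (offset_big lk lk).
have h4 : 0 < `|lastc y| * xi by rewrite mulr_gt0 ?xi_gt0.
by move: h2 h3 h4; rewrite ler_norml => /andP[h5 _]; move: h5; lrac.
Qed.

(** The point of type k has no horizontal part, so it is positive for one sign of v. For the other
    sign a point of type l serves: [hh_old] gives it a height opposite to that of type k, and its
    horizontal part can be chosen nonnegative. This is why the heights at type l > 0 may not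
    vanish. *)
Lemma step_pos l (y : 'rV[R]_d.+2) : (0 < l < k)%N -> y != 0 ->
  exists2 c, valid d.+1 l c & 0 < dot y (next_pts l c).
Proof.
move=> /andP[l0 lk] y0; have lk1 : (l < k.+1)%N by rewrite ltnW.
have [c vc hc] := @P_ge l (trunc y) (introT andP (conj l0 lk)).
have vcc : valid d.+1 l ((Ordinal lk1, c) : ladder k d.+1) by rewrite /= leqnn.
have hc0 : 0 <= u ^+ l * dot (trunc y) (P l c).
  by rewrite mulr_ge0 ?(ltW (upow_gt0 _)) // (le_trans _ hc) // mulr_ge0 // ltW.
have [v0|v0] := eqVneq (lastc y) 0.
  exists (Ordinal lk1, c) => //; rewrite dot_next_pts //= v0 mul0r addr0 mulr_gt0 ?upow_gt0 //.
  apply: lt_le_trans hc; rewrite mulr_gt0 // normr_gt0; apply: contra y0 => /eqP t0.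
  by apply/eqP/norm_eq0_pt; rewrite ?t0 ?v0 normr0.
have [c' vc' hc'] := last_val lk v0.
case sk : ((0 <= lastc y) == odd k).
  by exists c' => //; move: hc'; rewrite sk /sgb mul1r.
exists (Ordinal lk1, c) => //; rewrite dot_next_pts //= ltr_wpDl //.
rewrite (sgb_val (lastc y)) mulrAC mulr_gt0 ?normr_gt0 //.
have -> : (0 <= lastc y) = ~~ odd k by move: sk; case: (0 <= lastc y); case: (odd k).
exact: hh_old.
Qed.

Lemma step_pos0 (y : 'rV[R]_d.+2) : y != 0 ->
  exists2 c, valid d.+1 0 c & dot y (next_pts 0 c) != 0.
Proof.
move=> y0; have [v0|v0] := eqVneq (lastc y) 0; last first.
  have [c vc hc] := last_val k_gt0 v0; exists c => //.
  by move: hc; apply: contraTneq => ->; rewrite mulr0 ltxx.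
have [c vc hc] := P0_ge (trunc y); exists (ord0, c) => //.
rewrite dot_next_pts //= v0 mul0r addr0 expr0 mul1r -normr_gt0.
apply: lt_le_trans hc; rewrite mulr_gt0 // normr_gt0; apply: contra y0 => /eqP t0.
by apply/eqP/norm_eq0_pt; rewrite ?t0 ?v0 normr0.
Qed.

Lemma indep_fiber (m : 'I_k.+1) n (p : ladder k d -> 'rV[R]_n)
    (q : ladder k d.+1 -> 'rV[R]_n) (a : R) (F : {set ladder k d.+1}) (G : {set ladder k d}) :
  a != 0 -> indep p G -> (forall c, c \in F -> c.1 = m /\ c.2 \in G) ->
  (forall c, c \in F -> q c = a *: p c.2) -> indep q F.
Proof.
move=> a0 iG FG qE co hco c cF.
have inj : {in F &, injective (fun c : ladder k d.+1 => c.2)}.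
  move=> [x1 x2] [z1 z2] xF zF /= e2.
  have [/= h1 _] := FG _ xF; have [/= h2 _] := FG _ zF.
  by rewrite h1 h2 e2.
have sub : [set c.2 | c in F]%SET \subset G.
  by apply/fintype.subsetP => _ /imsetP[c' c'F ->]; case: (FG _ c'F).
have := indep_sub sub iG => /(_ (fun C => a * co (m, C))).
rewrite big_imset //= (eq_bigr (fun c => co c *: q c)) => [/(_ hco c.2)|c' c'F].
  rewrite imset_f // => /(_ isT)/eqP; rewrite mulf_eq0 (negbTE a0) /= => /eqP.
  by have [<- _] := FG _ cF; rewrite -surjective_pairing.
by have [<- _] := FG _ c'F; rewrite -surjective_pairing qE // scalerA mulrC.
Qed.

Let q (c : ladder k d.+1) : 'rV[R]_d.+1 := u ^+ c.1 *: P c.1 c.2.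

Hypothesis ind_old : forall l y, (0 < l < k)%N -> y != 0 -> indep (P l) (layer_opt P l y).
Hypothesis gen : forall l (F : {set ladder k d.+1}) y, (0 < l < k)%N -> lastc y != 0 ->
  (forall c, c \in F -> `|dot y (pt (q c) (height l c))| = 1) ->
  indep (fun c => pt (q c) (height l c)) F.

Ltac lrac ::= clear -R k d P w k_gt0 C0 c0 e u C0_ge1 c0_01 e_01 u_gt0 u_small P_last
  P_le w_le P_ge P0_ge u_c0 u_e u_100 u_le1 C0_gt0 c0_gt0 e_gt0 height hhE hh_old sign_old
  sign_old0 pat q ind_old gen; lra.

Lemma flat_old l (y : 'rV[R]_d.+2) c : (l < k)%N -> y != 0 -> lastc y = 0 ->
  dom l y c -> c.1 = l :> nat.
Proof.
move=> lk y0 v0 dc; have [vc _] := dc; have [lc ck _] := validS vc.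
apply/eqP; rewrite eqn_leq lc andbT leqNgt; apply/negP => lc'.
have al : active l (0 <= lastc y) l by rewrite /active eqxx orbT.
have := dom_lower lk y0 dc (introT andP (conj (leqnn l) lc')) al.
rewrite v0 normr0 mul0r mulr0 pmulr_rle0 // => t0; move/eqP: y0; apply.
by apply: norm_eq0_pt; rewrite ?v0 ?normr0.
Qed.

(** A horizontal y sees only type l, where the old independence applies. Otherwise the maximum is
    positive, and dividing y by it puts the optimal points on the hyperplane y = 1, as genericity
    requires. *)
Lemma step_ind l (y : 'rV[R]_d.+2) : (0 < l < k)%N -> y != 0 -> indep (next_pts l) (layer_opt next_pts l y).
Proof.
move=> lk0 y0; have /andP[l0 lk] := lk0.
have P'E : next_pts l = fun c => pt (q c) (height l c) by apply/funext => c; rewrite /next_pts lk.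
have lk1 : (l < k.+1)%N by rewrite ltnW.
have [v0|v0] := eqVneq (lastc y) 0.
  have t0 : trunc y != 0.
    by apply: contra y0 => /eqP t0; apply/eqP/norm_eq0_pt; rewrite ?t0 ?v0 normr0.
  rewrite P'E; apply: indep_pt.
  apply: (@indep_fiber (Ordinal lk1) _ (P l) _ (u ^+ l) _ (layer_opt P l (trunc y))).
  - by rewrite gt_eqF ?upow_gt0.
  - exact: ind_old.
  - move=> c /(layer_opt_dom _ _ l0) dc; have cl := flat_old lk y0 v0 dc.
    split; first by apply: val_inj.
    have [vc h] := dc; have [lc ck vc2] := validS vc; rewrite cl in vc2.
    apply/layer_optP; split => // C vC.
    have vcc : valid d.+1 l ((Ordinal lk1, C) : ladder k d.+1) by rewrite /= leqnn.
    have := h _ true vcc (orbT _); rewrite /sgb mul1r !dot_next_pts // v0 !mul0r !addr0 /= cl.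
    by rewrite ler_pM2l ?upow_gt0.
  - move=> c /(layer_opt_dom _ _ l0) dc; rewrite /q.
    by rewrite (flat_old lk y0 v0 dc).
have [c0' vc0 hc0] := step_pos lk0 y0.
have [->|[c cm]] := set_0Vmem (layer_opt next_pts l y); first by move=> co _ j; rewrite inE.
have /layer_optP[vc hc] := cm.
have N0 : 0 < dot y (next_pts l c) by apply: lt_le_trans hc0 (hc _ vc0).
rewrite P'E; apply: (gen (y := (dot y (next_pts l c))^-1 *: y)) => //.
  by rewrite /lastc mxE mulf_neq0 // invr_eq0 gt_eqF.
move=> c' /layer_optP[vc' hc']; rewrite dotZl.
have -> : dot y (pt (q c') (height l c')) = dot y (next_pts l c).
  by rewrite -[pt _ _](congr1 (fun f => f c') P'E); apply/eqP; rewrite eq_le hc // hc'.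
by rewrite mulVf ?normr1 // gt_eqF.
Qed.

Lemma upper_signed l y c b : (l < k)%N -> lastc y != 0 -> sgb R b * dot y (next_pts l c) <=
  u ^+ c.1 * (C0 * `|trunc y|)
  + sgb R (b == ((0 <= lastc y) == odd c.1)) * (`|lastc y| * offset l c.1) + `|lastc y| * xi.
Proof.
move=> lk v0; have tN : trunc (- y) = - trunc y by apply/rowP => i; rewrite !mxE.
have lN : lastc (- y) = - lastc y by rewrite /lastc mxE.
case: b; rewrite /sgb ?mul1r; first exact: upper_self.
have := upper_self (- y) c lk; rewrite tN lN !normrN dotNl mulN1r oppr_ge0.
have -> : (lastc y <= 0) = ~~ (0 <= lastc y) by rewrite -ltNge lt_neqAle v0.
by case: (0 <= lastc y); case: (odd c.1).
Qed.

(** * Exposing the new points *)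

Hypothesis vtx_old : forall m C, (0 < m)%N -> valid d m C -> exists2 y, y != 0 &
  forall C', valid d m C' -> C' != C -> dot y (P m C') + e * `|y| <= dot y (P m C).

Ltac lrac ::= clear -R k d P w k_gt0 C0 c0 e u C0_ge1 c0_01 e_01 u_gt0 u_small P_last
  P_le w_le P_ge P0_ge u_c0 u_e u_100 u_le1 C0_gt0 c0_gt0 e_gt0 height hhE hh_old sign_old
  sign_old0 pat q ind_old gen vtx_old; lra.

Lemma vtx_value m C y : (0 < m < k)%N ->
  (forall C', valid d m C' -> C' != C -> dot y (P m C') + e * `|y| <= dot y (P m C)) ->
  c0 * `|y| <= dot y (P m C).
Proof.
move=> mk h; have [C' vC' hC'] := P_ge y mk.
have [CC|CC] := eqVneq C' C; first by rewrite -CC.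
apply: le_trans hC' _; apply: le_trans (h _ vC' CC).
by rewrite lerDl mulr_ge0 // ltW.
Qed.

(** The ratio u^(3m) of horizontal to vertical size lies strictly between the thresholds of the
    active types below m and that of m, so type m wins. Inside type m, [y0] exposes C with margin e,
    which exceeds the generic errors. *)
Lemma step_vtx_new l (c : ladder k d.+1) : (l < k)%N -> (l < c.1)%N -> valid d.+1 l c ->
  exists2 y, y != 0 & forall c' b, valid d.+1 l c' -> (l == 0%N) || b -> (c' != c) || ~~ b ->
    sgb R b * dot y (next_pts l c') < dot y (next_pts l c).
Proof.
move=> lk lc vc; have [_ ck vc2] := validS vc; case: c lc vc ck vc2 => m C /= lm _ mk vC.
have m0 : (0 < m)%N by lian.
have [y0 y00 hy0] := vtx_old m0 vC.
pose y := pt (u ^+ (3 * m) *: y0) (sgb R (odd m) * `|y0|).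
have Y0 : 0 < `|y0| by rewrite normr_gt0.
have tY : trunc y = u ^+ (3 * m) *: y0 by rewrite trunc_pt.
have lY : lastc y = sgb R (odd m) * `|y0| by rewrite lastc_pt.
have ntY : `|trunc y| = u ^+ (3 * m) * `|y0|.
  by rewrite tY normrZ gtr0_norm ?upow_gt0.
have nlY : `|lastc y| = `|y0| by rewrite lY normrM normr_sgb mul1r normr_id.
have ly0 : lastc y != 0 by rewrite -normr_eq0 nlY gt_eqF.
have sY : (0 <= lastc y) = odd m.
  by rewrite lY /sgb; case: (odd m); rewrite ?mul1r ?mulN1r ?oppr_ge0 ?(ltW Y0) // leNgt Y0.
exists y; first by apply: contra ly0 => /eqP ->; rewrite /lastc mxE.
have self : (if (m < k)%N then u ^+ m * (c0 * `|trunc y|) else 0) + `|y0| * offset l m - `|y0| * xi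
    <= dot y (next_pts l (m, C)).
  rewrite dot_next_pts //=; have := hh_val l (m, C) (lastc y); rewrite nlY sY /= eqxx /sgb mul1r.
  rewrite ler_norml => /andP[h1 _].
  suff h2 : (if (m < k)%N then u ^+ m * (c0 * `|trunc y|) else 0) <=
      u ^+ m * dot (trunc y) (P m C).
    by rewrite -addrA; apply: lerD h2 _; move: h1; lrac.
  case: ifP => mk'; last first.
    have -> : m = k :> nat by lian.
    by rewrite P_last dot0r mulr0.
  rewrite ler_wpM2l ?(ltW (upow_gt0 _)) // ntY tY dotZl mulrCA ler_wpM2l ?(ltW (upow_gt0 _)) //.
  by apply: vtx_value => //; rewrite m0.
move=> [m' C'] b /= /andP[lm' vC'] lb ne.
have mk' : (m' <= k)%N by rewrite -ltnS.
have := @upper_signed l y (m', C') b lk ly0; rewrite nlY ntY sY /= => up.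
have c0Y : 0 <= u ^+ m * (c0 * `|trunc y|) by rewrite !mulr_ge0 ?(ltW (upow_gt0 _)) // ltW.
have self0 : `|y0| * offset l m - `|y0| * xi <= dot y (next_pts l (m, C)).
  by apply: le_trans self; rewrite -addrA lerDr; case: ifP.
have al : active l (odd m) l by rewrite /active eqxx orbT.
have am : active l (odd m) m by rewrite /active eqxx !orbT.
have lmm : (l <= l < m)%N by rewrite leqnn.
have /andP[ttm _] := offset_gap al am lmm; rewrite offsetxx subr0 in ttm.
have ddl : (gap_exp l (odd m) l < 3 * m)%N.
  rewrite /gap_exp eqxx; case: eqP => [->|l0]; first by move: m0; clear; lia.
  case: eqP => om; first by move: lm; clear; lia.
  suff : m != l.+1 :> nat by move: lm; clear; lia.
  by apply/eqP => e0; apply: om; rewrite e0.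
have big : u ^+ (m' + 3 * m) * C0 + 3 * xi < offset l m.
  have h1 : 100 * xi <= u ^+ (l + gap_exp l (odd m) l) by apply: xi_gap.
  have h2 : u ^+ (m' + 3 * m) <= u ^+ (l + gap_exp l (odd m) l) * u.
    by rewrite -exprSr upow_le //; move: lm' ddl; clear; lia.
  have h3 : u ^+ (m' + 3 * m) * C0 <= u ^+ (l + gap_exp l (odd m) l) * u * C0.
    by rewrite ler_wpM2r // ltW.
  have h4 : u ^+ (l + gap_exp l (odd m) l) * (100 * C0 * u) <= u ^+ (l + gap_exp l (odd m) l) * 1.
    rewrite ler_wpM2l ?(ltW (upow_gt0 _)) //; apply: le_trans u_c0 _.
    by case/andP: c0_01.
  have h5 := upow_gt0 (l + gap_exp l (odd m) l).
  by move: h1 h3 h4 h5 ttm; lrac.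
have bigY : u ^+ m' * (C0 * (u ^+ (3 * m) * `|y0|)) + 3 * (`|y0| * xi) < `|y0| * offset l m.
  have := big; rewrite -(ltr_pM2l Y0) exprD; congr (_ < _); ring.
have tt0 : 0 <= `|y0| * offset l m'.
  rewrite mulr_ge0 //; have [->|ml] := eqVneq (m' : nat) l; first by rewrite offsetxx.
  apply: le_trans (_ : 4 * xi <= _); first by rewrite mulr_ge0 // ltW ?xi_gt0.
  by apply: offset_big => //; rewrite ltn_neqAle eq_sym ml.
have xiY : 0 < `|y0| * xi by rewrite mulr_gt0 ?xi_gt0.
case sb : (b == (odd m == odd m')); last first.
  rewrite sb {2}/sgb mulN1r in up.
  by move: up self0 bigY tt0 xiY; lrac.
have am' : active l (odd m) m'.
  rewrite /active; move: sb lb; case: b {ne up} => [/eqP sb _|_].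
    by rewrite [_ == odd m]eq_sym -sb !orbT.
  by rewrite orbF => ->.
rewrite sb /sgb mul1r in up; rewrite -/(sgb R b) in up *.
have [mm|mm|mm] := ltngtP m' m.
- have /andP[gap _] := offset_gap am' am (introT andP (conj lm' mm)).
  have dd' : (gap_exp l (odd m) m' < 3 * m)%N.
    rewrite /gap_exp; case: eqP => [l0|l0]; first by move: mm; clear; lia.
    case: eqP => [ml|ml]; last first.
      move: am'; rewrite /active; case: eqP => // _; case: eqP => // _ /= /eqP om.
      by move: mm om; clear; lia.
    by move: ddl; rewrite /gap_exp eqxx; case: eqP.
  have h1 : 100 * xi <= u ^+ (m' + gap_exp l (odd m) m').
    by apply: xi_gap => //; apply: leq_trans mm mk.
  have h2 : u ^+ (m' + 3 * m) <= u ^+ (m' + gap_exp l (odd m) m') * u.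
    by rewrite -exprSr upow_le //; move: dd'; clear; lia.
  have h3 : u ^+ (m' + 3 * m) * C0 <= u ^+ (m' + gap_exp l (odd m) m') * u * C0.
    by rewrite ler_wpM2r // ltW.
  have h4 : u ^+ (m' + gap_exp l (odd m) m') * (100 * C0 * u) <= u ^+ (m' + gap_exp l (odd m) m') * 1.
    rewrite ler_wpM2l ?(ltW (upow_gt0 _)) //; apply: le_trans u_c0 _.
    by case/andP: c0_01.
  have h5 := upow_gt0 (m' + gap_exp l (odd m) m').
  have h6 : u ^+ (m' + 3 * m) * C0 + 3 * xi < offset l m - offset l m'.
    by move: h1 h3 h4 h5 gap; lrac.
  have h7 : u ^+ m' * (C0 * (u ^+ (3 * m) * `|y0|)) + 3 * (`|y0| * xi) <
      `|y0| * offset l m - `|y0| * offset l m'.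
    have := h6; rewrite -(ltr_pM2l Y0) exprD; congr (_ < _); ring.
  by move: up self0 h7 xiY; lrac.
- have mk2 : (m < k)%N by apply: leq_trans mm mk'.
  rewrite mk2 ntY in self.
  have /andP[_ gap] := offset_gap am am' (introT andP (conj (ltnW lm) mm)).
  have dd' : (3 * m < gap_exp l (odd m) m)%N.
    rewrite /gap_exp; case: eqP => _; first by clear; lia.
    by rewrite gtn_eqF //; clear; lia.
  have h1 := @shrink m m' (u ^+ (3 * m) * `|y0|) mm (mulr_ge0 (ltW (upow_gt0 _)) (ltW Y0)).
  have h2 : u ^+ (m + gap_exp l (odd m) m) <= u ^+ m * u ^+ (3 * m) * u.
    by rewrite -exprD -exprSr upow_le //; move: dd'; clear; lia.
  have h3 : 100 * xi <= u ^+ (m + gap_exp l (odd m) m) by apply: xi_gap => //; apply: ltnW.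
  have h4 : `|y0| * u ^+ (m + gap_exp l (odd m) m) <= `|y0| * (u ^+ m * u ^+ (3 * m) * u).
    by rewrite ler_wpM2l.
  have h5 := ler_wpM2l (ltW Y0) h3.
  have h6 := ler_wpM2l (ltW Y0) gap.
  have h7 : u ^+ m * u ^+ (3 * m) * `|y0| * (100 * u) <= u ^+ m * u ^+ (3 * m) * `|y0| * c0.
    rewrite ler_wpM2l //; first by rewrite !mulr_ge0 // ltW ?upow_gt0.
    apply: le_trans u_c0; rewrite -mulrA ler_pM2l // ler_peMl // ltW //.
  have h8 : 0 < u ^+ m * u ^+ (3 * m) * `|y0| * c0 by rewrite !mulr_gt0 ?upow_gt0.
  by move: up self h1 h4 h5 h6 h7 h8; lrac.
have mm' : m' = m by apply: val_inj.
subst m'; rewrite eqxx in sb; have {}sb : b by case: b sb {lb ne up}.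
rewrite sb orbF in ne; rewrite sb /sgb mul1r.
have CC : C' != C by apply: contra ne => /eqP ->.
have := hy0 _ vC' CC => h1; rewrite !dot_next_pts //= tY !dotZl.
have h2 := @hh_close l (m, C') (m, C) (lastc y) erefl; rewrite nlY in h2.
have h3 : u ^+ m * (u ^+ (3 * m) * (dot y0 (P m C') + e * `|y0|)) <=
    u ^+ m * (u ^+ (3 * m) * dot y0 (P m C)).
  by rewrite !ler_pM2l ?upow_gt0.
have h4 : 2 * (`|y0| * xi) < u ^+ m * (u ^+ (3 * m) * (e * `|y0|)).
  have h5 : xi <= u ^+ m * u ^+ (3 * m) * u.
    by rewrite -exprD -exprSr upow_le //; move: mk; clear; lia.
  have h6 := ler_wpM2l (ltW Y0) h5.
  have h7 : u ^+ m * u ^+ (3 * m) * `|y0| * (100 * u) <= u ^+ m * u ^+ (3 * m) * `|y0| * e.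
    rewrite ler_wpM2l //; first by rewrite !mulr_ge0 // ltW ?upow_gt0.
    apply: le_trans u_e; rewrite -mulrA ler_pM2l // ler_peMl // ltW //.
  have h8 : 0 < u ^+ m * u ^+ (3 * m) * `|y0| * e by rewrite !mulr_gt0 ?upow_gt0.
  by move: h6 h7 h8; lrac.
by move: h2 h3 h4; lrac.
Qed.

Lemma old_value (y' : 'rV[R]_d.+1) (c : ladder k d.+1) : valid d.+1 0 c -> (0 < c.1)%N ->
  y' != 0 -> `|dot (pt y' 0) (next_pts 0 c)| < c0 * `|y'|.
Proof.
move=> vc c1 y0; have [_ ck vc2] := validS vc.
rewrite dot_next_pts // lastc_pt trunc_pt mul0r addr0 normrM gtr0_norm ?upow_gt0 //.
have h1 := shrink c1 (normr_ge0 y'); rewrite expr0 mul1r in h1.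
have h2 : 0 < c0 * `|y'| by rewrite mulr_gt0 // normr_gt0.
have h3 := ler_wpM2l (ltW (upow_gt0 c.1)) (P_le c.2 y' ck).
by move: h1 h2 h3; lrac.
Qed.

Lemma dot_old (y' : 'rV[R]_d.+1) C :
  dot (pt y' 0) (next_pts 0 (ord0, C)) = dot y' (P 0 C).
Proof. by rewrite dot_next_pts // lastc_pt trunc_pt mul0r addr0 expr0 mul1r. Qed.

(** A horizontal functional sees the new points shrunk by u, below c0 |y'|, a value that some old
    point attains up to sign. Hence faces at n - 1 stay faces at n. *)
Lemma black_opt_ext (y' : 'rV[R]_d.+1) C : y' != 0 -> C \in black_opt P y' ->
  (ord0, C) \in black_opt next_pts (pt y' 0).
Proof.
move=> y0 /black_optP[vC hC]; apply/black_optP; split => //= -[m C'] /= vC'.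
rewrite dot_old; have [m0|m0] := posnP m.
  have -> : m = ord0 by apply: val_inj.
  by rewrite dot_old hC //; rewrite m0 in vC'.
have vcc : valid d.+1 0 ((m, C') : ladder k d.+1) by [].
apply: ltW; apply: lt_le_trans (old_value vcc m0 y0) _.
have [C1 vC1 hC1] := P0_ge y'; exact: le_trans hC1 (hC _ vC1).
Qed.

(** * Layer 0: independence and the facet count *)

Variable tilt : bool.
Hypothesis hh_inj : forall c c' : ladder k d.+1, (0 < c.1)%N -> (0 < c'.1)%N -> c != c' ->
  height 0 c - height 1 c != height 0 c' - height 1 c'.
Hypothesis hh_flat : ~~ tilt -> forall C, height 0 (ord0, C) = 0.
Hypothesis hh_tilt : tilt -> forall C, height 0 (ord0, C) < 0.
Hypothesis tilt_sym : tilt -> forall C, valid d 0 C ->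
  exists2 C', valid d 0 C' & P 0 C' = - P 0 C.
Hypothesis tilt_ind : tilt ->
  indep (fun C => pt (P 0 C) (height 0 (ord0, C))) [set C | valid d 0 C]%SET.
Hypothesis ind_old0 : ~~ tilt -> forall y, y != 0 -> indep (P 0) (abs_opt P y).
Hypothesis gen0 : forall (F : {set ladder k d.+1}) y, lastc y != 0 ->
  (forall c, c \in F -> `|dot y (pt (q c) (height 0 c))| = 1) ->
  indep (fun c => pt (q c) (height 0 c)) (F :&: [set c | ~~ tilt && (c.1 == ord0)]%SET) ->
  indep (fun c => pt (q c) (height 0 c)) F.
Hypothesis count_old : forall y, y != 0 -> (#|black_opt P y| + #|layer_opt P 1 y| <= d.+1 + tilt)%N.

Ltac lrac ::= clear -R k d P w k_gt0 C0 c0 e u C0_ge1 c0_01 e_01 u_gt0 u_small P_last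
  P_le w_le P_ge P0_ge u_c0 u_e u_100 u_le1 C0_gt0 c0_gt0 e_gt0 height hhE hh_old sign_old
  sign_old0 pat q ind_old gen vtx_old tilt hh_inj hh_flat hh_tilt tilt_sym tilt_ind
  ind_old0 gen0 count_old; lra.

(** Flat old points all have height 0 and are not generic, so independence of the optimal ones among
    them comes from the old configuration at y'. If y' = 0 they have value 0 and none is optimal. *)
Lemma step_ind0 (y : 'rV[R]_d.+2) : y != 0 -> indep (next_pts 0) (abs_opt next_pts y).
Proof.
move=> y0; have P'E : next_pts 0 = fun c => pt (q c) (height 0 c).
  by apply/funext => c; rewrite /next_pts k_gt0.
have [c1 vc1 hc1] := step_pos0 y0.
have flat (F : {set ladder k d.+1}) : ~~ tilt -> trunc y != 0 ->
    (forall c, c \in F -> c \in abs_opt next_pts y /\ c.1 = ord0) ->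
    indep (fun c => pt (q c) (height 0 c)) F.
  move=> nt t0 hF; apply: indep_pt.
  apply: (@indep_fiber ord0 _ (P 0) _ 1 _ (abs_opt P (trunc y))).
  - by rewrite oner_eq0.
  - exact: ind_old0.
  - move=> c /hF[ct cm]; split => //; have /abs_optP[vc hc] := ct.
    have [_ _ vc2] := validS vc; rewrite cm in vc2; apply/abs_optP; split => // C vC.
    have := hc (ord0, C) vC; case: c {ct vc vc2} cm hc => m C' /= -> _.
    by rewrite !dot_next_pts //= !hh_flat // !mulr0 !addr0 expr0 !mul1r.
  - by move=> c /hF[_ cm]; rewrite /q cm expr0.
have [v0|v0] := eqVneq (lastc y) 0.
  have t0 : trunc y != 0.
    by apply: contra y0 => /eqP t0; apply/eqP/norm_eq0_pt; rewrite ?t0 ?v0 normr0.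
  have yE : y = pt (trunc y) 0 by rewrite -v0 pt_eta.
  have c0E c : c \in abs_opt next_pts y -> c.1 = ord0.
    move=> /abs_optP[vc hc]; apply: val_inj; apply/eqP; rewrite -leqn0 leqNgt; apply/negP => c1'.
    have [C vC hC] := P0_ge (trunc y).
    have := old_value vc c1' t0; rewrite -yE => /(le_lt_trans (hc (ord0, C) vC)).
    by rewrite {1}yE dot_old ltNge hC.
  case: (boolP tilt) => [tl|nt]; last first.
    by rewrite P'E; apply: flat => // c ct; split => //; apply: c0E.
  rewrite P'E.
  apply: (@indep_fiber ord0 _ (fun C => pt (P 0 C) (height 0 (ord0, C))) _ 1 _
            [set C | valid d 0 C]%SET).
  - by rewrite oner_eq0.
  - exact: tilt_ind.
  - move=> c ct; have cm := c0E _ ct; split => //; have /abs_optP[vc _] := ct.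
    by have [_ _ vc2] := validS vc; rewrite cm in vc2; rewrite inE.
  - move=> [m C] /c0E /= ->; by rewrite /q /= expr0 !scale1r.
have [->|[c ct]] := set_0Vmem (abs_opt next_pts y); first by move=> co _ j; rewrite inE.
have /abs_optP[vc hc] := ct.
have N0 : 0 < `|dot y (next_pts 0 c)|.
  by apply: lt_le_trans (hc _ vc1); rewrite normr_gt0.
rewrite P'E; apply: (gen0 (y := `|dot y (next_pts 0 c)|^-1 *: y)) => //.
- by rewrite /lastc mxE mulf_neq0 // invr_eq0 gt_eqF.
- move=> c' /abs_optP[vc' hc']; rewrite dotZl normrM gtr0_norm ?invr_gt0 //.
  have -> : `|dot y (pt (q c') (height 0 c'))| = `|dot y (next_pts 0 c)|.
    by rewrite -[pt _ _](congr1 (fun f => f c') P'E); apply/eqP; rewrite eq_le hc // hc'.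
  by rewrite mulVf // gt_eqF.
case: (boolP tilt) => [tl|nt].
  by move=> co _ j; rewrite !inE andbF.
have [t0|t0] := eqVneq (trunc y) 0; last first.
  by apply: flat => // c'; rewrite !inE => /andP[-> /eqP].
move=> co _ c'; rewrite finset.in_setI => /andP[/abs_optP[vc' hc']]; rewrite inE /= => /eqP c'0.
have := hc' _ vc; rewrite leNgt => /negP[].
suff -> : dot y (next_pts 0 c') = 0 by rewrite normr0.
case: c' c'0 {vc' hc'} => m C' /= ->.
by rewrite dot_next_pts // t0 dot0l mulr0 add0r hh_flat // mulr0.
Qed.

(** Cases by the types of the optimal black cells. Without any, independence of layer 1 suffices, or
    its having one cell when k = 1. If all are old, the old sum bounds the new one. If a type m > 0
    occurs, the black cells of that type and the optimal cells of layer 1 both project into one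
    optimal set of layer m, overlapping in at most one cell. *)
Lemma step_count (y : 'rV[R]_d.+2) : y != 0 ->
  (#|black_opt next_pts y| + #|layer_opt next_pts 1 y| <= d.+2)%N.
Proof.
move=> y0; set s := 0 <= lastc y.
have act0 c : c \in black_opt next_pts y -> c.1 = 0%N :> nat \/ odd c.1 = s.
  by move=> /black_opt_dom; apply: dom_active.
have far0 c : c \in black_opt next_pts y -> (c.1 < k)%N ->
    `|lastc y| * u ^+ (3 * c.1 + 2) <= 4 * C0 * `|trunc y|.
  move=> /black_opt_dom dc ck; have := @dom_upper 0 y c c.1.+1 k_gt0 y0 dc.
  by rewrite ltnSn ck /active /gap_exp /=; apply.
have low0 c : c \in black_opt next_pts y -> (0 < c.1)%N ->
    c0 * `|trunc y| <= 4 * (`|lastc y| * u ^+ (3 * c.1.-1 + 2)).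
  move=> /black_opt_dom dc ck; have := @dom_lower 0 y c c.1.-1 k_gt0 y0 dc.
  by rewrite leq0n ltn_predL ck /active /gap_exp /=; apply.
have mx1k c : c \in layer_opt next_pts 1 y -> (1 <= c.1)%N.
  by move=> /layer_optP[vc _]; have [] := validS vc.
(* The exponents 3m + 2 of layer 0 interlace with those of layer 1: whichever of the two types were
   smaller, [clash] would apply. *)
have typ1 c c' : c \in layer_opt next_pts 1 y -> c' \in black_opt next_pts y -> (0 < c'.1)%N -> c.1 = c'.1 :> nat.
  move=> cm c'b c'1; have c1 := mx1k _ cm.
  have [_ ck _] : [/\ (1 <= c.1)%N, (c.1 <= k)%N & valid d c.1 c.2].
    by case/layer_optP: cm => vc _; apply: validS.
  have [_ c'k _] : [/\ (0 <= c'.1)%N, (c'.1 <= k)%N & valid d c'.1 c'.2].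
    by case/black_optP: c'b => vc _; apply: validS.
  have [k1|k1] := leqP k 1; first by lian.
  have dc : dom 1 y c by apply/layer_opt_dom.
  have sc' : odd c'.1 = s by case: (act0 _ c'b) => // h; rewrite h in c'1.
  have ac' : active 1 s c'.1 by rewrite /active sc' eqxx !orbT.
  have sc := dom_active k1 y0 dc; rewrite -/s in sc.
  have [lt|lt|//] := ltngtP c.1 c'.1; exfalso.
    have := dom_upper k1 y0 dc (introT andP (conj lt c'k)) ac'; rewrite -/s => hU.
    apply: (clash _ y0 hU (low0 _ c'b c'1)).
    rewrite /gap_exp /=; case: eqP => [c11|c11].
      rewrite c11 in lt; case: eqP => os; first by move: (nat_of_ord c'.1) lt => x; clear; lia.
      suff : (2 < c'.1)%N by move: (nat_of_ord c'.1) => x; clear; lia.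
      rewrite ltn_neqAle lt andbT; apply/eqP => h.
      by apply: os; rewrite -sc' -h.
    case: sc => // sc; rewrite -sc' in sc; move: (nat_of_ord c'.1) (nat_of_ord c.1) lt sc c1 => x x'; clear; lia.
  have := dom_lower k1 y0 dc (introT andP (conj c'1 lt)) ac'; rewrite -/s => hL.
  have c'k' : (c'.1 < k)%N by apply: leq_trans lt ck.
  apply: (clash _ y0 (far0 _ c'b c'k') hL).
  rewrite /gap_exp /=; case: eqP => [c11|_]; last by clear; lia.
  case: eqP => os; last by rewrite c11.
  by exfalso; rewrite -sc' c11 in os.
(* The exponents allow two different types only if they are consecutive; both being of the parity of
   an active type unless 0, they are 0 and 1. *)
have typ0 c c' : c \in black_opt next_pts y -> c' \in black_opt next_pts y -> (0 < c'.1)%N ->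
    c.1 = c'.1 :> nat \/ (c.1 = 0%N :> nat /\ c'.1 = 1%N :> nat).
  move=> cb c'b c'1.
  have main a b : a \in black_opt next_pts y -> b \in black_opt next_pts y -> (a.1 < b.1)%N ->
      a.1 = 0%N :> nat /\ b.1 = 1%N :> nat.
    move=> ab bb lt; have [_ bk' _] : [/\ (0 <= b.1)%N, (b.1 <= k)%N & valid d b.1 b.2].
      by case/black_optP: bb => vc _; apply: validS.
    have b0 : (0 < b.1)%N by apply: leq_ltn_trans lt.
    have [h|h] := ltnP (3 * a.1 + 2) (3 * b.1.-1 + 2).
      by case: (clash h y0 (far0 _ ab (leq_trans lt bk')) (low0 _ bb b0)).
    have ba : b.1 = a.1.+1 :> nat by move: lt h b0; clear; lia.
    case: (act0 _ ab) => [a0|sa]; first by rewrite ba a0.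
    by case: (act0 _ bb) => [b00|]; [rewrite b00 in b0|rewrite ba oddS sa; case: (s)].
  have [lt|lt|] := ltngtP c.1 c'.1; [by right; apply: main|right|by left].
  by have [h _] := main _ _ c'b cb lt; rewrite h in c'1.
have card_snd (F : {set ladder k d.+1}) (m : nat) : (forall c, c \in F -> c.1 = m :> nat) ->
    #|F| = #|[set c.2 | c in F]%SET|.
  move=> hF; rewrite card_in_imset // => -[x1 x2] [z1 z2] xF zF /= ->.
  by move: (hF _ xF) (hF _ zF) => /= h1 h2; congr (_, _); apply: val_inj; rewrite /= h1 h2.
have mxk y' m C : (k <= m)%N -> valid d m C -> C \in layer_opt P m y'.
  move=> km vC; have mE : m = k by apply/eqP; rewrite eqn_leq km (valid_le vC).
  by rewrite mE in vC *; apply/layer_optP; split => // C' _; rewrite !P_last.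
have [|/forallPn[c]] := boolP [forall c, c \notin black_opt next_pts y].
  move=> /forallP b0; have -> : black_opt next_pts y = finset.set0.
    by apply/finset.setP => c; rewrite (negbTE (b0 c)) finset.in_set0.
  rewrite cards0 add0n; have [k1|k1] := leqP k 1; last first.
    by apply: (@indep_card _ _ _ (next_pts 1)); apply: step_ind.
  apply: (@leq_trans 1) => //; apply/card_le1_eqP => c c' /layer_optP[vc _] /layer_optP[vc' _].
  exact: (valid_last_unique k1).
rewrite negbK => cb.
(* When all optimal black cells are old, every optimal cell of layer 1 has type 1. Both sets then
   embed in the optimal sets of one old functional z, and the tilt costs at most one unit. *)
have [|/forallPn[c2]] := boolP [forall c, (c \in black_opt next_pts y) ==> (c.1 == ord0)].
  move=> /forall_inP b0; have c10 : c.1 = 0%N :> nat by rewrite (eqP (b0 _ cb)).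
  have hU := far0 _ cb; rewrite c10 in hU; have {}hU := hU k_gt0.
  have far : `|lastc y| * u ^+ (3 * k) <= 4 * C0 * `|trunc y|.
    by apply: far_le hU; move: k_gt0; clear; lia.
  have t0 := trunc_neq0 y0 far; have [z z0 [p1 p2 _]] := pat t0.
  have m1 c' : c' \in layer_opt next_pts 1 y -> c'.1 = 1%N :> nat.
    move=> cm; have c'1 := mx1k _ cm.
    have [_ ck _] : [/\ (1 <= c'.1)%N, (c'.1 <= k)%N & valid d c'.1 c'.2].
      by case/layer_optP: cm => vc _; apply: validS.
    have [k1|k1] := leqP k 1; first by lian.
    apply/eqP; rewrite eqn_leq c'1 andbT leqNgt; apply/negP => c'2.
    have dc : dom 1 y c' by apply/layer_opt_dom.
    have a1 : active 1 s 1 by rewrite /active eqxx.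
    have hL := dom_lower k1 y0 dc (introT andP (conj (leqnn 1) c'2)) a1.
    by apply: (clash _ y0 hU hL); rewrite /gap_exp /=; case: eqP.
  apply: (@leq_trans (d.+1 + tilt)); last by rewrite -[d.+2]addn1 leq_add2l leq_b1.
  apply: leq_trans (count_old z0).
  rewrite (card_snd _ 0%N) => [|c' /b0 /eqP ->//]; rewrite (card_snd (layer_opt next_pts 1 y) 1%N) //.
  apply: leq_add; apply: subset_leq_card; apply/fintype.subsetP => _ /imsetP[c' c'F ->].
    by apply: p2; apply: dom_near0 => //; [apply/black_opt_dom|rewrite (eqP (b0 _ c'F))].
  have c'1 := m1 _ c'F; have /layer_optP[vc' _] := c'F; have [_ c'k vc2] := validS vc'.
  rewrite c'1 in vc2; have [k1|k1] := leqP k 1.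
    exact: mxk.
  rewrite -c'1; apply: p1; first by rewrite c'1.
  by apply: (@dom_near 1) => //; [apply/layer_opt_dom|rewrite c'1].
rewrite negb_imply => /andP[{cb}cb c10]; move: {c}c2 cb c10 => c cb c10.
have c1 : (0 < c.1)%N by rewrite lt0n.
set m := nat_of_ord c.1 in c1.
have [_ ck vc2] : [/\ (0 <= c.1)%N, (c.1 <= k)%N & valid d c.1 c.2].
  by case/black_optP: cb => vc _; apply: validS.
pose B0 := [set c' in black_opt next_pts y | c'.1 == ord0]%SET.
pose Bm := [set c' in black_opt next_pts y | c'.1 != ord0]%SET.
have BE : #|black_opt next_pts y| = (#|B0| + #|Bm|)%N.
  rewrite -(cardsID [set c' : ladder k d.+1 | c'.1 == ord0]%SET (black_opt next_pts y)).
  by congr (_ + _)%N; apply: eq_card => c'; rewrite !inE // andbC.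
have BmE c' : c' \in Bm -> c'.1 = m :> nat.
  rewrite inE => /andP[c'b c'0].
  case: (typ0 c' c c'b cb c1) => //.
  by move=> [h _]; case/eqP: c'0; apply: val_inj.
have B0E c' : c' \in B0 -> c'.1 = 0%N :> nat by rewrite inE => /andP[_ /eqP ->].
have ME c' : c' \in layer_opt next_pts 1 y -> c'.1 = m :> nat by move=> h; apply: typ1.
have vM c' : c' \in layer_opt next_pts 1 y -> valid d m c'.2.
  move=> h; have /layer_optP[vc' _] := h; have [_ _ v2] := validS vc'.
  by rewrite (ME _ h) in v2.
have vB c' : c' \in Bm -> valid d m c'.2.
  move=> h; have := h; rewrite inE => /andP[/black_optP[vc' _] _]; have [_ _ v2] := validS vc'.
  by rewrite (BmE _ h) in v2.
have [z z0 [zB zM zB0]] : exists2 z, z != 0 & [/\ forall c', c' \in Bm -> c'.2 \in layer_opt P m z,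
    forall c', c' \in layer_opt next_pts 1 y -> c'.2 \in layer_opt P m z &
    forall c', c' \in B0 -> c'.2 \in black_opt P z].
  have good : `|lastc y| * u ^+ (3 * k) <= 4 * C0 * `|trunc y| ->
    exists2 z, z != 0 & [/\ forall c', c' \in Bm -> c'.2 \in layer_opt P m z,
      forall c', c' \in layer_opt next_pts 1 y -> c'.2 \in layer_opt P m z &
      forall c', c' \in B0 -> c'.2 \in black_opt P z].
    move=> far; have t0 := trunc_neq0 y0 far; have [z z0 [p1 p2 _]] := pat t0.
    exists z => //; have mk : (0 < m <= k)%N by rewrite c1.
    have [km|km] := leqP k m.
      split; [by move=> c' /vB; apply: mxk|by move=> c' /vM; apply: mxk|].
      by move=> c' h; apply: p2; apply: dom_near0 (B0E _ h) t0 far; apply/black_opt_dom; move: h; rewrite inE => /andP[].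
    split.
    - move=> c' h; have e1 := BmE _ h; rewrite -e1; apply: p1; first by rewrite e1.
      by apply: (@dom_near 0) => //; [apply/black_opt_dom; move: h; rewrite inE => /andP[]|rewrite e1].
    - move=> c' h; have e1 := ME _ h; rewrite -e1; apply: p1; first by rewrite e1.
      apply: (@dom_near 1) => //; [by apply: leq_ltn_trans c1 km|by apply/layer_opt_dom|by rewrite e1].
    - by move=> c' h; apply: p2; apply: dom_near0 (B0E _ h) t0 far; apply/black_opt_dom; move: h; rewrite inE => /andP[].
  have [km|km] := ltnP m k.
    by apply: good; apply: far_le (far0 _ cb km); move: km; rewrite -/m; clear; lia.
  (* For m = k the steepness is not bounded by type m. If no old cell is optimal any z will do,
     since layer k is a single point at 0; otherwise the old cell supplies the bound. *)
  have [B00|[c' c'B]] := set_0Vmem B0.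
    have w0 : (const_mx 1 : 'rV[R]_d.+1) != 0.
      by apply/eqP => /rowP/(_ ord0); rewrite !mxE => /eqP; rewrite oner_eq0.
    exists (const_mx 1) => //; split.
    - by move=> c' /vB; apply: mxk.
    - by move=> c' /vM; apply: mxk.
    - by move=> c'; rewrite B00 inE.
  have h := B0E _ c'B; apply: good; have cb' : c' \in black_opt next_pts y by move: c'B; rewrite inE => /andP[].
  have := far0 _ cb'; rewrite h => /(_ k_gt0); apply: far_le; move: k_gt0; clear; lia.
pose s1 := [set c'.2 | c' in Bm]%SET; pose s2 := [set c'.2 | c' in layer_opt next_pts 1 y]%SET.
(* A cell in both projections is optimal in layers 0 and 1 at once. Two such cells would have equal
   differences between their heights in the two layers, which [hh_inj] excludes. *)
have s12 : (#|s1| + #|s2| <= #|layer_opt P m z| + 1)%N.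
  rewrite -cardsUI leq_add //.
    apply: subset_leq_card; apply/fintype.subsetP => C; rewrite finset.in_setU.
    by case/orP => /imsetP[c' c'F ->]; [apply: zB|apply: zM].
  apply/card_le1_eqP => C C'; rewrite !finset.in_setI.
  move=> /andP[/imsetP[a aB ->] /imsetP[a' a'M aa']] /andP[/imsetP[b bB ->] /imsetP[b' b'M bb']].
  have pairE (x x' : ladder k d.+1) : x.1 = x'.1 :> nat -> x.2 = x'.2 -> x = x'.
    by case: x x' => [x1 x2] [x1' x2'] /= h ->; congr (_, _); apply: val_inj.
  have {}a'E : a' = a by apply: pairE => //; rewrite (ME _ a'M) (BmE _ aB).
  have {}b'E : b' = b by apply: pairE => //; rewrite (ME _ b'M) (BmE _ bB).
  rewrite a'E in a'M; rewrite b'E in b'M; have a1 := BmE _ aB; have b1 := BmE _ bB.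
  have [ab|ab] := eqVneq a b; first by rewrite ab.
  exfalso; have [k1|k1] := leqP k 1.
    case/eqP: ab; apply: pairE; first by rewrite a1.
    by apply: (valid_last_unique (leq_trans k1 c1)); apply: vB.
  have v0 : lastc y != 0.
    apply/eqP => v0; have := low0 _ cb c1; rewrite v0 normr0 mul0r mulr0 pmulr_rle0 // => t0.
    by move/eqP: y0; apply; apply: norm_eq0_pt; rewrite ?v0 ?normr0.
  have eqv : dot y (next_pts 1 a) = dot y (next_pts 1 b).
    have /layer_optP[va ha] := a'M; have /layer_optP[vb hb] := b'M.
    by apply/eqP; rewrite eq_le ha // hb.
  have eqv0 : dot y (next_pts 0 a) = dot y (next_pts 0 b).
    have := aB; rewrite inE => /andP[/black_opt_dom[va ha] _]; have := bB; rewrite inE => /andP[/black_opt_dom[vb hb] _].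
    apply/eqP; rewrite eq_le.
    by have := ha b true vb isT; have := hb a true va isT; rewrite /sgb !mul1r => -> ->.
  have : (0 < a.1)%N by rewrite a1. move=> a0; have b0 : (0 < b.1)%N by rewrite b1.
  have := hh_inj a0 b0 ab; rewrite -subr_eq0 => /negP[].
  move: eqv eqv0; rewrite !dot_next_pts // => e1 e0.
  have : lastc y * (height 0 a - height 1 a - (height 0 b - height 1 b)) == 0.
    by apply/eqP; move: e1 e0; lrac.
  by rewrite mulf_eq0 (negbTE v0).
have card_m : (#|layer_opt P m z| <= d.+1)%N.
  have [km|km] := ltnP m k; first by apply: indep_card; apply: ind_old => //; rewrite c1.
  apply: (@leq_trans 1) => //; apply/card_le1_eqP => C C' /layer_optP[vC _] /layer_optP[vC' _].
  exact: (valid_last_unique km).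
rewrite BE (card_snd Bm m) // (card_snd (layer_opt next_pts 1 y) m) // -addnA -/s1 -/s2.
have [B00|[c' c'B]] := set_0Vmem B0.
  by rewrite B00 cards0 add0n; apply: leq_trans s12 _; rewrite addn1 ltnS.
have m1 : m = 1%N.
  have c'b : c' \in black_opt next_pts y by move: c'B; rewrite inE => /andP[].
  case: (typ0 c' c c'b cb c1) => [h|[_ //]].
  by move: c1; rewrite /m -h (B0E _ c'B).
have s_true : s by case: (act0 _ cb) => [h|<-]; [rewrite -/m m1 in h|rewrite -/m m1].
have V0 : 0 < lastc y.
  have h0 : 0 <= lastc y := s_true.
  rewrite lt_neqAle h0 andbT eq_sym; apply/eqP => v0; have := low0 _ cb c1.
  rewrite v0 normr0 mul0r mulr0 pmulr_rle0 // => t0.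
  by move/eqP: y0; apply; apply: norm_eq0_pt; rewrite ?v0 ?normr0.
(* Types 0 and 1 meet only for v > 0. When tilted, p_C' has height below 0, and the antipode of the
   point p_C with P 0 C = - P 0 C' has the same horizontal value but height above 0, so p_C' is not
   optimal. *)
have [tl|nt] := boolP tilt.
  exfalso; have : c' \in black_opt next_pts y by move: c'B; rewrite inE => /andP[].
  have := c'B; rewrite inE => /andP[_ /eqP]; case: c' {c'B} => m' C' /= ->.
  move=> /black_opt_dom[/= vC' h]; have [C vC PC] := tilt_sym tl vC'.
  have := h (ord0, C) false vC isT; rewrite !dot_next_pts //= PC dotNr expr0 !mul1r /sgb.
  have h1 : lastc y * height 0 (ord0, C) < 0 by rewrite pmulr_rlt0 // hh_tilt.
  have h2 : lastc y * height 0 (ord0, C') < 0 by rewrite pmulr_rlt0 // hh_tilt.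
  by move: h1 h2; lrac.
have hB0 : (#|B0| <= #|black_opt P z|)%N.
  rewrite (card_snd B0 0%N) //; apply: subset_leq_card.
  by apply/fintype.subsetP => _ /imsetP[a aF ->]; apply: zB0.
have := count_old z0; rewrite (negbTE nt) addn0 => h.
apply: leq_trans (leq_add hB0 s12) _; rewrite m1 addnA addn1 ltnS //.
Qed.

(** * The new configuration *)

Hypothesis vtx_old0 : forall C, valid d 0 C -> exists2 y, y != 0 & C \in black_opt P y.

Ltac lrac ::= clear -R k d P w k_gt0 C0 c0 e u C0_ge1 c0_01 e_01 u_gt0 u_small P_last
  P_le w_le P_ge P0_ge u_c0 u_e u_100 u_le1 C0_gt0 c0_gt0 e_gt0 height hhE hh_old sign_old
  sign_old0 pat q ind_old gen vtx_old tilt hh_inj hh_flat hh_tilt tilt_sym tilt_ind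
  ind_old0 gen0 count_old vtx_old0; lra.

Lemma pt_neq0 n (x : 'rV[R]_n) h : x != 0 -> pt x h != 0.
Proof. by apply: contra => /eqP e0; rewrite -(trunc_pt x h) e0 trunc0. Qed.

Lemma step_layers : layers next_pts next_wts.
Proof.
split.
- by move=> c; rewrite /next_pts ltnn.
- exact: step_pos.
- move=> l y c i l0 y0 cm; have [lk|kl] := ltnP l k.
    by apply: step_sign lk y0 _; apply/layer_opt_dom.
  by have /layer_optP[vc _] := cm; rewrite lab_last.
- exact: step_ind.
- move=> l c l0 vc; have [lk|kl] := ltnP l k; last first.
    exists (const_mx 1); first by apply/eqP => /rowP/(_ ord0); rewrite !mxE => /eqP; rewrite oner_eq0.
    by move=> c' vc' /eqP[]; apply: valid_last_unique vc' vc.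
  have [lc ck vc2] := validS vc.
  have [cl|cl] := eqVneq (c.1 : nat) l; last first.
    have lc' : (l < c.1)%N by rewrite ltn_neqAle eq_sym cl.
    have [y y0 hy] := step_vtx_new lk lc' vc; exists y => // c' vc' cc'.
    by have := hy c' true vc' (orbT _); rewrite cc' /sgb mul1r; apply.
  rewrite cl in vc2; have [y y0 hy] := vtx_old l0 vc2.
  exists (pt y 0); first exact: pt_neq0.
  move=> c' vc' cc'; rewrite !dot_next_pts // lastc_pt trunc_pt !mul0r !addr0 cl.
  have [lc' c'k vc'2] := validS vc'.
  have [c'l|c'l] := eqVneq (c'.1 : nat) l.
    rewrite c'l ltr_pM2l ?upow_gt0 //; rewrite c'l in vc'2.
    have := hy _ vc'2; case: eqP => [e2|_ /(_ isT) h].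
      case/eqP: cc'; case: c c' cl c'l e2 {lc ck vc vc2 hy vc' lc' c'k vc'2} => [x1 x2] [z1 z2] /= h1 h2 ->.
      by congr (_, _); apply: val_inj; rewrite /= h1 h2.
    have e0 : 0 < e * `|y| by rewrite mulr_gt0 // normr_gt0.
    by move: h e0; lrac.
  have lt : (l < c'.1)%N by rewrite ltn_neqAle eq_sym c'l.
  have l0k : (0 < l < k)%N by rewrite l0.
  have h1 := ler_wpM2l (ltW (upow_gt0 l)) (vtx_value l0k hy).
  have h2 := shrink lt (normr_ge0 y).
  have h3 := ler_wpM2l (ltW (upow_gt0 c'.1)) (le_trans (ler_norm _) (P_le c'.2 y c'k)).
  have h4 : 0 < u ^+ l * (c0 * `|y|) by rewrite !mulr_gt0 ?upow_gt0 // normr_gt0.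
  by move: h1 h2 h3 h4; lrac.
Qed.

Lemma step_top : top next_pts next_wts.
Proof.
split.
- exact: step_pos0.
- by move=> y c i y0 cb; apply: step_sign k_gt0 y0 _; apply/black_opt_dom.
- exact: step_ind0.
- exact: step_count.
- move=> c vc; have [_ ck vc2] := validS vc.
  have [c10|c1] := posnP c.1.
    rewrite c10 in vc2; have [y y0 hy] := vtx_old0 vc2.
    exists (pt y 0); first exact: pt_neq0.
    have -> : c = (ord0, c.2) by case: (c) c10 => m C /= h; congr (_, _); apply: val_inj.
    exact: black_opt_ext.
  have [y y0 hy] := step_vtx_new k_gt0 c1 vc; exists y => //; apply/black_opt_dom; split => // c' b vc' _.
  case E : ((c' != c) || ~~ b); first by apply/ltW/hy.
  by move: E => /negbT; rewrite negb_or !negbK => /andP[/eqP -> ->]; rewrite /sgb mul1r.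
Qed.

End Step.

(** * Choice of the constants and of generic heights *)

Section StepExists.
Variables (R : realType) (k d : nat).
Variables (P : nat -> ladder k d -> 'rV[R]_d.+1) (w : nat -> 'rV[R]_d.+1).
Hypothesis k_gt0 : (0 < k)%N.
Hypothesis lay : layers P w.
Hypothesis pos0 : forall y, y != 0 -> exists2 c, valid d 0 c & dot y (P 0 c) != 0.

Let one : 'rV[R]_d.+1 := const_mx 1.
Let one_neq0 : one != 0.
Proof. by apply/eqP => /rowP/(_ ord0); rewrite !mxE => /eqP; rewrite oner_eq0. Qed.

Lemma upper_const : exists2 C0 : R, 1 <= C0 &
  (forall m c y, (m <= k)%N -> `|dot y (P m c)| <= C0 * `|y|) /\
  (forall i y, (i <= k.*2 + d)%N -> `|dot y (w i)| <= C0 * `|y|).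
Proof.
pose nrm (a : 'rV[R]_d.+1) : R := \sum_i `|a ord0 i|.
have n0 a : 0 <= nrm a by apply: sumr_ge0.
pose S1 : R := \sum_(m : 'I_k.+1) \sum_(c : ladder k d) nrm (P m c).
pose S2 : R := \sum_(i < (k.*2 + d).+1) nrm (w i).
have S10 : 0 <= S1 by do 2 apply: sumr_ge0 => ? _.
have S20 : 0 <= S2 by apply: sumr_ge0.
exists (1 + S1 + S2); first by rewrite -addrA lerDl addr_ge0.
have key a y : nrm a <= 1 + S1 + S2 -> `|dot y a| <= (1 + S1 + S2) * `|y|.
  by move=> h; apply: le_trans (normr_dot_le y a) _; rewrite ler_wpM2r.
split=> [m c y mk|i y iN]; apply: key.
  have mk1 : (m < k.+1)%N by [].
  have : nrm (P m c) <= S1.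
    rewrite /S1 (bigD1 (Ordinal mk1)) //= (bigD1 c) //= -addrA lerDl.
    by rewrite addr_ge0 //; apply: sumr_ge0 => ? _ //; apply: sumr_ge0.
  by move: (nrm _) S20 => a h1 h2; lra.
have : nrm (w i) <= S2.
  have iN1 : (i < (k.*2 + d).+1)%N by [].
  by rewrite /S2 (bigD1 (Ordinal iN1)) //= lerDl sumr_ge0.
by move: (nrm _) S10 => a h1 h2; lra.
Qed.

Lemma lower_const : exists2 c0 : R, 0 < c0 <= 1 &
  (forall m y, (0 < m < k)%N -> exists2 c, valid d m c & c0 * `|y| <= dot y (P m c)) /\
  (forall y, exists2 c, valid d 0 c & c0 * `|y| <= `|dot y (P 0 c)|).
Proof.
pose S (m : 'I_k.+1) (e : R) :=
  ((0 < m < k)%N -> forall y, exists2 c, valid d m c & e * `|y| <= dot y (P m c)) /\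
  (m = 0%N :> nat -> forall y, exists2 c, valid d 0 c & e * `|y| <= `|dot y (P 0 c)|).
have [||e e0 he] := @min_eps R _ S.
- move=> m; have [mk|mk] := boolP (0 < m < k)%N.
    have [|e e0 he] := @uniform_margin R d _ (valid d m) (fun c => - P m c).
      move=> y y0; have [c vc hc] := lay_pos lay mk y0; exists c => //.
      by rewrite dotNr oppr_lt0.
    exists e => //; split => [_ y|m0]; last by rewrite m0 in mk.
    have [->|y0] := eqVneq y 0.
      have [c vc _] := he _ one_neq0; exists c => //.
      by rewrite normr0 mulr0 dot0l.
    by have [c vc hc] := he y y0; exists c => //; move: hc; rewrite dotNr lerN2.
  have [|e e0 he] := @uniform_margin R d _ (fun j : ladder k d * bool => valid d 0 j.1)
      (fun j => sgb R j.2 *: P 0 j.1).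
    move=> y y0; have [c vc hc] := pos0 y0; exists (c, ~~ (0 <= dot y (P 0 c))) => //=.
    rewrite dotZr /sgb; have [h|h] := leP 0 (dot y (P 0 c)).
      by rewrite /= mulN1r oppr_lt0 lt_neqAle eq_sym hc.
    by rewrite /= mul1r.
  exists e => //; split => [mk'|_ y]; first by rewrite mk' in mk.
  have [->|y0] := eqVneq y 0.
    have [[c b] vc _] := he _ one_neq0; exists c => //.
    by rewrite normr0 mulr0 dot0l normr0.
  have [[c b] /= vc hc] := he y y0; exists c => //.
  have := ler_norm (- dot y (sgb R b *: P 0 c)); rewrite normrN dotZr normrM normr_sgb mul1r.
  by apply: le_trans; rewrite lerNr -dotZr.
- move=> m e e' [h1 h2] /andP[e'0 ee']; split.
    move=> mk y; have [c vc hc] := h1 mk y; exists c => //.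
    by apply: le_trans hc; rewrite ler_wpM2r.
  move=> m0 y; have [c vc hc] := h2 m0 y; exists c => //.
  by apply: le_trans hc; rewrite ler_wpM2r.
exists e => //; split=> [m y mk|y].
  have mk1 : (m < k.+1)%N by case/andP: mk => _ /ltnW.
  by have [h _] := he (Ordinal mk1); apply: h.
by have [_ h] := he ord0; apply: h.
Qed.

Lemma vertex_const : exists2 e : R, 0 < e <= 1 & forall m C, (0 < m)%N -> valid d m C ->
  exists2 y, y != 0 &
    forall C', valid d m C' -> C' != C -> dot y (P m C') + e * `|y| <= dot y (P m C).
Proof.
pose S (t : 'I_k.+1 * ladder k d) (e : R) := (0 < t.1)%N -> valid d t.1 t.2 ->
  exists2 y, y != 0 & forall C', valid d t.1 C' -> C' != t.2 ->
    dot y (P t.1 C') + e * `|y| <= dot y (P t.1 t.2).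
have [||e e0 he] := @min_eps R _ S.
- move=> [m C]; rewrite /S /=; case: (boolP ((0 < m)%N && valid d m C)); last first.
    by move=> h; exists 1 => // m0 vC; rewrite m0 vC in h.
  move=> /andP[m0 vC]; have [y y0 hy] := lay_vtx lay m0 vC.
  have Y0 : 0 < `|y| by rewrite normr_gt0.
  have [||e /andP[e0 _] he] := @min_eps R _ (fun C' (e : R) => valid d m C' -> C' != C ->
      dot y (P m C') + e * `|y| <= dot y (P m C)).
  + move=> C'; case: (boolP (valid d m C' && (C' != C))); last first.
      by move=> h; exists 1 => // v n; rewrite v n in h.
    move=> /andP[v n]; exists ((dot y (P m C) - dot y (P m C')) / `|y|).
      by rewrite divr_gt0 // subr_gt0 hy.
    by move=> _ _; rewrite mulfVK ?gt_eqF // addrC subrK.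
  + move=> C' e e' h /andP[e'0 ee'] v n; apply: le_trans (h v n).
    by rewrite lerD2l ler_wpM2r.
  by exists e => // _ _; exists y => //.
- move=> [m C] e e' h /andP[e'0 ee'] m0 vC; have [y y0 hy] := h m0 vC; exists y => // C' v n.
  by apply: le_trans (hy _ v n); rewrite lerD2l ler_wpM2r.
exists e => // m C m0 vC; have mk1 : (m < k.+1)%N by rewrite ltnS (valid_le vC).
exact: (he (Ordinal mk1, C)).
Qed.

(* The step from d = 0 to d = 1 is special: at d = 0 the points p_A and -p_B of the
   two alternating sets coincide, so they have to be tilted out of the hyperplane. *)
Variable tilt : bool.
Hypothesis sign0 : forall y c i, y != 0 -> c \in black_opt P y -> lab d 0 c i -> 0 < dot y (w i).
Hypothesis count0 : forall y, y != 0 -> (#|black_opt P y| + #|layer_opt P 1 y| <= d.+1 + tilt)%N.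
Hypothesis vtx0 : forall C, valid d 0 C -> exists2 y, y != 0 & C \in black_opt P y.
Hypothesis ind0 : ~~ tilt -> forall y, y != 0 -> indep (P 0) (abs_opt P y).
Hypothesis sym0 : tilt -> forall C, valid d 0 C ->
  exists2 C', valid d 0 C' & P 0 C' = - P 0 C.
Hypothesis indtilt : tilt -> forall h : ladder k d -> R, (forall C, h C < 0) ->
  indep (fun C => pt (P 0 C) (h C)) [set C | valid d 0 C]%SET.

Lemma step_exists :
  exists (Q : nat -> ladder k d.+1 -> 'rV[R]_d.+2) (v : nat -> 'rV[R]_d.+2),
  [/\ layers Q v, top Q v,
      ~~ tilt -> forall C, Q 0 (ord0, C) = pt (P 0 C) 0
    & forall y C, y != 0 -> C \in black_opt P y -> (ord0, C) \in black_opt Q (pt y 0)].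
Proof.
have [C0 C0_ge1 [P_le w_le]] := upper_const.
have [c0 c0_01 [P_ge P0_ge]] := lower_const.
have [e1 e1_01 pat1] := pattern_margin P w (k.*2 + d).+1.
have [e2 e2_01 vtx2] := vertex_const.
pose e := Num.min e1 e2.
have e_01 : 0 < e <= 1.
  case/andP: e1_01 => h1 h2; case/andP: e2_01 => h3 h4.
  by rewrite /e lt_min h1 h3 ge_min h2.
have e0 : 0 < e by case/andP: e_01.
have ee1 : e <= e1 by rewrite ge_min lexx.
have ee2 : e <= e2 by rewrite ge_min lexx orbT.
have pat y : y != 0 -> exists2 y0, y0 != 0 &
  [/\ forall l c, (0 < l <= k)%N -> near_layer_opt P e l y c -> c \in layer_opt P l y0,
      forall c, near_black_opt P e y c -> c \in black_opt P y0
    & forall i, (i < (k.*2 + d).+1)%N -> dot y (w i) < e * `|y| -> dot y0 (w i) <= 0].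
  have ey : e * `|y| <= e1 * `|y| by rewrite ler_wpM2r.
  move=> /pat1[y0 y00 [h1 h2 h3]]; exists y0 => //; split.
  - move=> l c lk [vc hc]; apply: h1 => //; split => // c' vc'.
    by apply: lt_le_trans (hc _ vc') _; rewrite lerD2l.
  - move=> c [vc hc]; apply: h2; split => // c' vc'.
    by apply: lt_le_trans (hc _ vc') _; rewrite lerD2l.
  - by move=> i iN hi; apply: h3 => //; apply: lt_le_trans hi ey.
have vtx m C : (0 < m)%N -> valid d m C -> exists2 y, y != 0 &
    forall C', valid d m C' -> C' != C -> dot y (P m C') + e * `|y| <= dot y (P m C).
  move=> m0 vC; have [y y0 hy] := vtx2 m C m0 vC; exists y => // C' v n.
  by apply: le_trans (hy _ v n); rewrite lerD2l ler_wpM2r.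
have C00 : 0 < C0 by apply: lt_le_trans C0_ge1.
have c00 : 0 < c0 by case/andP: c0_01.
pose u := c0 * e / (100 * C0).
have C100 : 0 < 100 * C0 by rewrite mulr_gt0.
have u_gt0 : 0 < u by rewrite divr_gt0 ?mulr_gt0.
have u_small : 100 * C0 * u <= c0 * e by rewrite /u mulrC mulfVK ?gt_eqF.
pose q (c : ladder k d.+1) : 'rV[R]_d.+1 := u ^+ c.1 *: P c.1 c.2.
pose X := xi k u; have X0 : 0 < X by apply: exprn_gt0.
pose H (l : nat) (c : ladder k d.+1) : R := sgb R (odd c.1) * offset u l c.1.
pose good (l : nat) (h : ladder k d.+1 -> R) := [/\ forall c, `|h c - H l c| <= X,
    forall c : ladder k d.+1, c.1 = l :> nat -> 0 < sgb R (~~ odd k) * h c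
  & forall (F : {set ladder k d.+1}) y, lastc y != 0 ->
    (forall c, c \in F -> `|dot y (pt (q c) (h c))| = 1) ->
    indep (fun c => pt (q c) (h c)) F].
have [h1 h1P] : {h1 | forall l, good l (h1 l)}.
  suff ex l : exists h, good l h by exists (fun l => projT1 (cid (ex l))) => l; exact: projT2 (cid (ex l)).
  (* At type l the offset is 0 and only the error remains; cutting its interval at 0 gives it the
     sign opposite to that of type k. *)
  pose lo (c : ladder k d.+1) := H l c - (if (c.1 == l :> nat) && ~~ odd k then 0 else X).
  pose hi (c : ladder k d.+1) := H l c + (if (c.1 == l :> nat) && odd k then 0 else X).
  have [|h [_ h2 _ h4]] := @generic_heights R _ _ q finset.set0 (fun=> 0) lo hi (fun=> 0).
    move=> c _; rewrite /lo /hi; case: (c.1 == l :> nat); case: (odd k) => /=; lra.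
  have h2' c : lo c < h c < hi c by apply: h2; rewrite inE.
  exists h; split.
  - move=> c; have := h2' c; rewrite /lo /hi ler_norml.
    by case: (c.1 == l :> nat); case: (odd k) => /= /andP[a1 a2]; apply/andP; split; lra.
  - move=> c cl; have := h2' c; rewrite /lo /hi cl eqxx /= /H cl offsetxx mulr0.
    by case: (odd k); rewrite /sgb /= => /andP[a1 a2]; lra.
  - move=> F y y0 hF; apply: (h4 F y y0 hF) => co _ j; rewrite finset.in_setI inE andbF //.
(* Layer 0 is placed after layer 1, whose heights serve as the function f of [generic_heights]. Flat
   old points form [old] and keep height 0; tilted ones get the upper bound 0. *)
pose O := [set c : ladder k d.+1 | ~~ tilt && (c.1 == ord0)]%SET.
pose lo (c : ladder k d.+1) := H 0 c - X.
pose hi (c : ladder k d.+1) := H 0 c + (if tilt && (c.1 == ord0) then 0 else X).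
have [|h0 [g1 g2 g3 g4]] := @generic_heights R _ _ q O (fun=> 0) lo hi (h1 1%N).
  by move=> c _; rewrite /lo /hi; case: ifP => _; lra.
have H00 (c : ladder k d.+1) : c.1 = ord0 -> H 0 c = 0 by move=> c0'; rewrite /H c0' offsetxx mulr0.
have g0 c : `|h0 c - H 0 c| <= X.
  have [cO|cO] := boolP (c \in O).
    rewrite g1 //; move: cO; rewrite inE => /andP[_ /eqP/H00 ->].
    by rewrite subr0 normr0 ltW.
  have := g2 _ cO; rewrite /lo /hi ler_norml => /andP[a1].
  by case: ifP => _ a2; apply/andP; split; lra.
pose height l := if l is 0%N then h0 else h1 l.
have hhE l c : `|height l c - sgb R (odd c.1) * offset u l c.1| <= X.
  by case: l => [|l]; [apply: g0|have [h _ _] := h1P l.+1; apply: h].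
have hh_old l (c : ladder k d.+1) : (0 < l)%N -> c.1 = l :> nat -> 0 < sgb R (~~ odd k) * height l c.
  by case: l => // l _ cl; have [_ h _] := h1P l.+1; apply: h.
have nO (c : ladder k d.+1) : (0 < c.1)%N -> c \notin O.
  by move=> c1; rewrite inE negb_and; apply/orP; right; rewrite -val_eqE /= -lt0n.
have hh_inj (c c' : ladder k d.+1) : (0 < c.1)%N -> (0 < c'.1)%N -> c != c' ->
  height 0 c - height 1 c != height 0 c' - height 1 c'.
  by move=> c1 c'1; apply: g3; apply: nO.
have hh_flat : ~~ tilt -> forall C, height 0 (ord0, C) = 0.
  by move=> nt C; apply: g1; rewrite inE nt /=.
have hh_tilt : tilt -> forall C, height 0 (ord0, C) < 0.
  move=> tl C; have := g2 (ord0, C); rewrite inE tl /= => /(_ isT).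
  by rewrite /hi tl eqxx H00 //= addr0 => /andP[].
have gen l (F : {set ladder k d.+1}) y : (0 < l < k)%N -> lastc y != 0 ->
  (forall c, c \in F -> `|dot y (pt (q c) (height l c))| = 1) ->
  indep (fun c => pt (q c) (height l c)) F.
  by case: l => // l _; have [_ _ h] := h1P l.+1; apply: h.
have gen0 (F : {set ladder k d.+1}) y : lastc y != 0 ->
  (forall c, c \in F -> `|dot y (pt (q c) (height 0 c))| = 1) ->
  indep (fun c => pt (q c) (height 0 c)) (F :&: O) ->
  indep (fun c => pt (q c) (height 0 c)) F by apply: g4.
have tilt_ind : tilt -> indep (fun C => pt (P 0 C) (height 0 (ord0, C))) [set C | valid d 0 C]%SET.
  by move=> tl; apply: (indtilt tl) => C; apply: hh_tilt.
have lz := lay_zero lay; have ls := lay_sign lay; have li := lay_ind lay.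
exists (next_pts P u height), (next_wts k w u); split.
- exact: (step_layers k_gt0 C0_ge1 c0_01 e_01 u_gt0 u_small lz P_le w_le P_ge P0_ge
    hhE hh_old ls sign0 pat li gen vtx).
- exact: (step_top k_gt0 C0_ge1 c0_01 e_01 u_gt0 u_small lz P_le w_le P_ge P0_ge
    hhE hh_old ls sign0 pat li gen vtx hh_inj hh_flat hh_tilt sym0 tilt_ind ind0 gen0
    count0 vtx0).
- by move=> nt C; rewrite /next_pts k_gt0 hh_flat // expr0 scale1r.
- by move=> y C; apply: (black_opt_ext k_gt0 C0_ge1 c0_01 e_01 u_gt0 u_small P_le P0_ge).
Qed.

End StepExists.

(** * The initial configuration *)

Section Base.
Variables (R : realType) (k : nat).
Hypothesis k_gt0 : (0 < k)%N.

Definition base_pts (l : nat) (b : ladder k 0) : 'rV[R]_1 :=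
  const_mx (if (l < k)%N then sgb R b else 0).

Definition base_wts (i : nat) : 'rV[R]_1 := const_mx (sgb R (~~ odd i)).

Lemma dot_const1 (y : 'rV[R]_1) a : dot y (const_mx a) = y ord0 ord0 * a.
Proof. by rewrite /dot big_ord1 mxE. Qed.

Lemma rV1_neq0 (y : 'rV[R]_1) : y != 0 -> y ord0 ord0 != 0.
Proof.
by apply: contra => /eqP e; apply/eqP/rowP => i; rewrite ord1 e mxE.
Qed.

Lemma base_max l (y : 'rV[R]_1) (b : ladder k 0) : (l < k)%N -> y != 0 ->
  b \in layer_opt base_pts l y -> 0 < y ord0 ord0 * sgb R b.
Proof.
move=> lk /rV1_neq0 y0 /layer_optP[_ /(_ (~~ b))]; rewrite /= lk => /(_ isT).
rewrite !dot_const1 lk => h; rewrite lt_neqAle; apply/andP; split.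
  by rewrite eq_sym mulf_neq0 // /sgb; case: (b : bool); rewrite ?oppr_eq0 oner_eq0.
by move: h; rewrite /sgb; case: (b : bool) => /=; lra.
Qed.

Lemma base_bk (y : 'rV[R]_1) (b : ladder k 0) : y != 0 ->
  b \in black_opt base_pts y -> 0 < y ord0 ord0 * sgb R b.
Proof.
move=> /rV1_neq0 y0 /black_optP[vb /(_ b vb)]; rewrite !dot_const1 k_gt0 => h.
rewrite lt_neqAle; apply/andP; split; last by apply: le_trans h.
by rewrite eq_sym mulf_neq0 // /sgb; case: (b : bool); rewrite ?oppr_eq0 oner_eq0.
Qed.

Lemma sgb_pos_inj (a : R) (b b' : bool) : 0 < a * sgb R b -> 0 < a * sgb R b' -> b = b'.
Proof. by rewrite /sgb; case: b; case: b' => //; lra. Qed.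

Lemma base_layers : layers base_pts base_wts.
Proof.
split.
- by move=> c; rewrite /base_pts ltnn; apply/rowP => i; rewrite !mxE.
- move=> l y /andP[_ lk] /rV1_neq0 y0; exists (0 < y ord0 ord0); first by rewrite /= lk.
  rewrite dot_const1 lk /sgb; have [h|h] := ltP 0 (y ord0 ord0); first by rewrite mulr1.
  by rewrite mulrN1 oppr_gt0 lt_neqAle y0.
- move=> l y c i l0 y0 cm /= /and3P[li il oc]; rewrite dot_const1.
  have lk : (l < k)%N by move: li il; clear; lia.
  have -> : ~~ odd i = c by move: oc; case: (odd i); case: (c : bool).
  exact: base_max cm.
- move=> l y /andP[_ lk] y0 a; set F := layer_opt _ _ _ => h j jF.
  have FE : F = [set j]%SET.
    apply/finset.setP => i; rewrite inE; apply/idP/eqP => [iF|->] //.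
    exact: (sgb_pos_inj (base_max lk y0 iF) (base_max lk y0 jF)).
  move: h; rewrite FE big_set1 => /rowP/(_ ord0); rewrite !mxE lk => /eqP.
  by rewrite mulf_eq0 /sgb; case: (j : bool); rewrite ?oppr_eq0 oner_eq0 orbF => /eqP.
- move=> l c l0 vc; exists (const_mx (sgb R c)).
    apply/eqP => /rowP/(_ ord0); rewrite !mxE /sgb => /eqP.
    by case: (c : bool); rewrite ?oppr_eq0 oner_eq0.
  move=> c' vc' cc'; rewrite !dot_const1 mxE.
  have -> : (l < k)%N.
    by move: vc vc' cc' => /=; case: (c : bool); case: (c' : bool) => //; rewrite !andbF !orbF.
  by move: cc'; rewrite /sgb; case: (c : bool); case: (c' : bool) => //=; lra.
Qed.

Lemma base_step :
  exists (Q : nat -> ladder k 1 -> 'rV[R]_2) (v : nat -> 'rV[R]_2), layers Q v /\ top Q v.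
Proof.
suff [Q [v [? ? _ _]]] : exists (Q : nat -> ladder k 1 -> 'rV[R]_2) (v : nat -> 'rV[R]_2),
  [/\ layers Q v, top Q v,
      ~~ true -> forall C : ladder k 0, Q 0%N (ord0, C) = pt (base_pts 0 C) 0
    & forall y C, y != 0 -> C \in black_opt base_pts y -> (ord0, C) \in black_opt Q (pt y 0)].
  by exists Q, v.
have nz b : sgb R b != 0 by rewrite /sgb; case: b; rewrite ?oppr_eq0 oner_eq0.
apply: (step_exists k_gt0 base_layers) => //.
- move=> y y0; exists true; first by rewrite /= k_gt0.
  by rewrite dot_const1 k_gt0 mulr1 rV1_neq0.
- move=> y c i y0 cb /= /and3P[_ _ oc]; rewrite dot_const1.
  have -> : ~~ odd i = c by move: oc; case: (odd i); case: (c : bool).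
  exact: base_bk cb.
(* One black cell and one cell of layer 1: the sum 2 exceeds d + 1 = 1 by exactly the unit that the
   tilt allows. *)
- move=> y y0; apply: (@leq_add _ _ 1 1); apply/card_le1_eqP => a b.
    by move=> /(base_bk y0) h1 /(base_bk y0) h2; apply: sgb_pos_inj h2 h1.
  have [k1|k1] := ltnP 1 k.
    by move=> /(base_max k1 y0) h1 /(base_max k1 y0) h2; apply: sgb_pos_inj h2 h1.
  move=> /layer_optP[va _] /layer_optP[vb _]; exact: (valid_last_unique k1 vb va).
- move=> C vC; exists (const_mx (sgb R C)).
    by apply/eqP => /rowP/(_ ord0); rewrite !mxE => /eqP; rewrite (negbTE (nz _)).
  apply/black_optP; split => // c' _; rewrite !dot_const1 mxE k_gt0 normrM !normr_sgb.
  by rewrite /sgb; case: (C : bool); rewrite ?mulr1 ?mulrN1 ?opprK.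
- move=> _ C vC; exists (~~ (C : bool)); first by rewrite /= k_gt0.
  apply/rowP => i; rewrite !mxE k_gt0 /sgb; by case: (C : bool); rewrite /= ?opprK.
(* The points 1 and -1 of the line, both lowered by negative heights, are no longer collinear with
   the origin: a relation has equal coefficients, and the heights do not cancel. *)
- move=> _ h h0 a; rewrite sum_pt => e.
  have := congr1 (@lastc R 1) e; have := congr1 (@trunc R 1) e.
  rewrite trunc_pt lastc_pt trunc0 lastc0 => /rowP/(_ ord0); rewrite summxE mxE.
  have FE : [set C : ladder k 0 | valid 0 0 C]%SET = [set true; false]%SET.
    by apply/finset.setP => -[]; rewrite !inE /= k_gt0.
  rewrite FE !big_setU1 ?inE //= !big_set1 !mxE k_gt0 /sgb => e1 e2.
  have := h0 true; have := h0 false => hf ht.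
  have af : a false = a true by move: e1; lra.
  have : a true = 0.
    apply/eqP; move: e2; rewrite af -mulrDr => /eqP; rewrite mulf_eq0 => /orP[//|].
    by rewrite lt_eqF //; move: hf ht; lra.
  by move=> at0 [] _ //; rewrite af.
Qed.

End Base.

(** * Boundary of a simplicial polytope *)

Section Boundary.
Variables (R : realType) (d : nat) (V : finType) (p : V -> 'rV[R]_d.+1).

(** The polar body of the hull: functionals normalised so that supporting hyperplanes have value
    1. *)
Definition polar (y : 'rV[R]_d.+1) : Prop := forall v, dot y (p v) <= 1.

Definition tight (y : 'rV[R]_d.+1) : {set V} := [set v | dot y (p v) == 1]%SET.

Definition bfaces : {set {set V}} :=
  [set F : {set V} | (F != finset.set0) &&
     `[< exists2 y, polar y & F \subset tight y >]]%SET.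

Lemma bfacesP F : reflect
  (F != finset.set0 /\ exists2 y, polar y & F \subset tight y) (F \in bfaces).
Proof.
rewrite inE; apply: (iffP andP) => -[F0 h]; split => //; first by move/asboolP: h.
exact/asboolP.
Qed.

Lemma tightP y v : reflect (dot y (p v) = 1) (v \in tight y).
Proof. by rewrite inE; apply: eqP. Qed.

Hypothesis p_pos : forall y, y != 0 -> exists v, 0 < dot y (p v).
Hypothesis p_ind : forall y, polar y -> indep p (tight y).
Hypothesis p_vtx : forall v, exists2 y, polar y & dot y (p v) = 1.

Lemma bfaces_ind F : F \in bfaces -> indep p F.
Proof. by case/bfacesP => _ [y /p_ind iy sF]; apply: indep_sub sF iy. Qed.

Lemma bface_vertex v : [set v]%SET \in bfaces.
Proof.
have [y py yv] := p_vtx v; apply/bfacesP; split; last first.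
  by exists y => //; rewrite finset.sub1set; apply/tightP.
by apply/finset.set0Pn; exists v; rewrite inE.
Qed.

Lemma bface_neq0 F : F \in bfaces -> F != finset.set0.
Proof. by case/bfacesP. Qed.

Lemma bface_closed (F G : {set V}) : F \in bfaces -> G \subset F -> G != finset.set0 -> G \in bfaces.
Proof.
move=> /bfacesP[_ [y py Fy]] GF G0; apply/bfacesP; split => //.
by exists y => //; apply: fintype.subset_trans GF Fy.
Qed.

Lemma bface_affinely_independent F : F \in bfaces -> affinely_independent p F.
Proof. by move=> /bfaces_ind iF c _; apply: iF. Qed.

(** If the coefficient at v0 vanished, a small step from x along p u - p v0, for another vertex u of
    F, would stay in the affine hull and hence in the hull. Its coefficients are unique, and the one
    at v0 is negative. *)
Lemma relint_positive F x : indep p F -> relative_interior p F x ->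
  exists c : V -> R, [/\ forall v, v \in F -> 0 < c v, \sum_(v in F) c v = 1
    & x = \sum_(v in F) c v *: p v].
Proof.
move=> iF [[c [c0 c1 xE]] /nbhs_ballP[e /= e0 he]].
exists c; split => // v0 v0F; rewrite lt_neqAle c0 // andbT eq_sym; apply/eqP => cv0.
have [u uF cu] : exists2 u, u \in F & c u != 0.
  apply: contrapT => h; suff : \sum_(v in F) c v = 0 by rewrite c1; apply/eqP/oner_neq0.
  apply: big1 => v vF; apply/eqP; apply: contrapT => /negP cv.
  by apply: h; exists v.
have uv0 : u != v0 by apply: contra cu => /eqP ->; rewrite cv0.
pose z := p u - p v0.
pose t := e / 2 / (1 + `|z|).
have z0 : 0 < 1 + `|z| by rewrite ltr_wpDr.
have t0 : 0 < t by rewrite !divr_gt0.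
have tz : t * `|z| < e.
  apply: (@le_lt_trans _ _ (e / 2)); last by lra.
  rewrite /t mulrAC ler_pdivrMr // ler_wpM2l ?divr_ge0 ?(ltW e0) //.
  by rewrite lerDr.
pose c' v := c v + t * (v == u)%:R - t * (v == v0)%:R.
have del (w : V) (a : R) : w \in F -> \sum_(v in F) a * (v == w)%:R = a.
  move=> wF; rewrite (bigD1 w) //= eqxx mulr1 big1 ?addr0 // => v /andP[_ /negbTE ->].
  by rewrite mulr0.
have delp (w : V) (a : R) : w \in F -> \sum_(v in F) (a * (v == w)%:R) *: p v = a *: p w.
  move=> wF; rewrite (bigD1 w) //= eqxx mulr1 big1 ?addr0 // => v /andP[_ /negbTE ->].
  by rewrite mulr0 scale0r.
have sumc' : \sum_(v in F) c' v *: p v = x + t *: z.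
  rewrite xE /z scalerBr -(delp u t uF) -(delp v0 t v0F) addrA -big_split /= -sumrB.
  by apply: eq_bigr => v _; rewrite /c' !scalerDl scaleNr.
have [||a [a0 a1 aE]] := he (x + t *: z).
- by rewrite -ball_normE /= opprD addrA subrr add0r normrN normrZ gtr0_norm.
- exists c'; split; last by rewrite sumc'.
  by rewrite sumrB big_split /= c1 !del // addrK.
have /(_ v0 v0F) : forall v, v \in F -> a v - c' v = 0.
  apply: iF; under eq_bigr => v _ do rewrite scalerBl.
  by rewrite sumrB sumc' -aE subrr.
move/eqP; rewrite subr_eq0 /c' cv0 eqxx [v0 == u]eq_sym (negbTE uv0) mulr0 mulr1 add0r sub0r => /eqP av.
by have := a0 _ v0F; rewrite av oppr_ge0 leNgt t0.
Qed.

Lemma tight_of_combination y (G : {set V}) (c : V -> R) : polar y ->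
  (forall v, v \in G -> 0 <= c v) -> \sum_(v in G) c v = 1 ->
  dot y (\sum_(v in G) c v *: p v) = 1 ->
  forall v, v \in G -> 0 < c v -> v \in tight y.
Proof.
move=> py c0 c1 h v vG cv; apply/tightP/eqP; apply/negPn/negP => ne.
have : \sum_(u in G) c u * (1 - dot y (p u)) = 0.
  under eq_bigr => u _ do rewrite mulrBr mulr1 -dotZr.
  by rewrite sumrB c1 -dot_sumr h subrr.
move/eqP; rewrite psumr_eq0 => [/allP/(_ v (mem_index_enum _))|u uG]; last first.
  by rewrite mulr_ge0 ?c0 // subr_ge0.
by rewrite vG /= mulf_eq0 gt_eqF //= subr_eq0 eq_sym (negbTE ne).
Qed.

Lemma dot_tight_combination y (F : {set V}) (c : V -> R) : F \subset tight y ->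
  dot y (\sum_(v in F) c v *: p v) = \sum_(v in F) c v.
Proof.
move=> /fintype.subsetP Fy; rewrite dot_sumr; apply: eq_bigr => v vF.
by rewrite dotZr; have /tightP -> := Fy _ vF; rewrite mulr1.
Qed.

Lemma sum_set_in (W : nmodType) (F T : {set V}) (f : V -> W) : F \subset T ->
  \sum_(v in F) f v = \sum_(v in T) (if v \in F then f v else 0).
Proof.
move=> /fintype.subsetP FT; rewrite -big_mkcondr /=; apply: eq_bigl => v.
by case vF: (v \in F); rewrite ?andbF // FT.
Qed.

(** A functional supporting F has value 1 at a common point x, which forces all of G into its tight
    set. There coefficients are unique, and their positivity recovers both F and G from x. *)
Lemma bface_disjoint F G : F \in bfaces -> G \in bfaces -> F != G ->
  relative_interior p F `&` relative_interior p G = set0.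
Proof.
move=> fF fG FG; apply/seteqP; split => // x [].
move=> /(relint_positive (bfaces_ind fF))[a [a0 a1 xa]].
move=> /(relint_positive (bfaces_ind fG))[b [b0 b1 xb]].
have [_ [y py Fy]] := bfacesP _ fF.
have Gy : G \subset tight y.
  apply/fintype.subsetP => v vG; apply: (@tight_of_combination y G b) => //.
  - by move=> u uG; rewrite ltW ?b0.
  - by rewrite -xb xa dot_tight_combination.
  - exact: b0.
pose h v := (if v \in F then a v else 0) - (if v \in G then b v else 0).
have h0 v : v \in tight y -> h v = 0.
  apply: (p_ind py); rewrite /h.
  under eq_bigr => u _ do rewrite scalerBl.
  rewrite sumrB; apply/eqP; rewrite subr_eq0; apply/eqP.
  transitivity x.
    rewrite xa (sum_set_in _ Fy); apply: eq_bigr => u _.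
    by case: ifP => //; rewrite scale0r.
  rewrite xb (sum_set_in _ Gy); apply: eq_bigr => u _.
  by case: ifP => //; rewrite scale0r.
move/negP: FG; apply; apply/eqP/finset.setP => v; apply/idP/idP => vX.
  have := h0 v (fintype.subsetP Fy _ vX); rewrite /h vX; case: ifP => // _.
  by move/eqP; rewrite subr0 gt_eqF ?a0.
have := h0 v (fintype.subsetP Gy _ vX); rewrite /h vX; case: ifP => // _.
by move/eqP; rewrite sub0r oppr_eq0 gt_eqF ?b0.
Qed.

Definition boundary : geometric_complex R d.+1 :=
  @GeometricComplex R d.+1 V bfaces p bface_vertex bface_neq0 bface_closed
    bface_affinely_independent bface_disjoint.

(** * The gauge function and radial projection *)

Lemma polar_bounded : exists2 B : R, 0 < B & forall y, polar y -> `|y| <= B.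
Proof.
have [|e e0 he] := @uniform_margin R d V predT (fun v => - p v).
  by move=> y /p_pos[v hv]; exists v => //; rewrite dotNr oppr_lt0.
exists e^-1 => [|y py]; first by rewrite invr_gt0.
have [->|y0] := eqVneq y 0; first by rewrite normr0 invr_ge0 ltW.
have [v _] := he y y0; rewrite dotNr lerN2 => h.
by rewrite -[X in _ <= X]mul1r ler_pdivlMr // mulrC; apply: le_trans h (py v).
Qed.

Lemma polar_compact : compact [set y | polar y].
Proof.
apply: bounded_closed_compact.
  have [B B0 hB] := polar_bounded; exists B; split; first by rewrite num_real.
  by move=> x xB y /hB h; apply: le_trans h (ltW xB).
have -> : [set y | polar y] = \bigcap_(v in [set: V]) ((fun y => dot y (p v)) @^-1` [set x | x <= 1]).
  by apply/seteqP; split => [y py v _|y h v]; [apply: py|apply: h].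
apply: closed_bigI => v _; apply: preimage_closed; last exact: closed_le.
by move=> y _; apply: continuous_dotl.
Qed.

Lemma gauge_attained x : exists y, polar y /\ forall y', polar y' -> dot y' x <= dot y x.
Proof.
have [|||y /set_mem py hy] := @EVT_max_rV R d.+1 (fun y => dot y x) [set y | polar y].
- by exists 0 => v; rewrite dot0l ler01.
- exact: polar_compact.
- by apply: continuous_subspaceT => y; apply: continuous_dotl.
by exists y; split => // y' py'; apply: hy; apply: mem_set.
Qed.

(** The support function of the polar body, which by duality is the gauge of the hull. Taken as an
    attained maximum it comes with a supporting functional at x. *)
Definition gauge (x : 'rV[R]_d.+1) : R := dot (projT1 (cid (gauge_attained x))) x.

Lemma gaugeP x : exists2 y, polar y & gauge x = dot y x /\ forall y', polar y' -> dot y' x <= gauge x.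
Proof. by rewrite /gauge; case: (cid _) => y [py hy] /=; exists y. Qed.

Lemma gauge_eq x y : polar y -> (forall y', polar y' -> dot y' x <= dot y x) -> gauge x = dot y x.
Proof.
move=> py hy; have [y' py' [e h]] := gaugeP x.
by apply/eqP; rewrite eq_le h // andbT e hy.
Qed.

Lemma polar_shift y u : polar y -> (forall v, v \in tight y -> dot u (p v) <= 0) ->
  exists2 t : R, 0 < t & polar (y + t *: u).
Proof.
move=> py hu.
pose B := 1 + \sum_v `|dot u (p v)|.
have B0 : 0 < B by rewrite ltr_pwDl // sumr_ge0.
have uB v : dot u (p v) <= B.
  rewrite /B (bigD1 v) //= addrCA; apply: le_trans (ler_norm _) _.
  by rewrite lerDl addr_ge0 // sumr_ge0.
pose m := \big[Num.min/1]_(v | v \notin tight y) (1 - dot y (p v)).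
have m0 : 0 < m.
  rewrite /m; elim/big_ind: _ => [//|a b a0 b0|v]; first by rewrite lt_min a0.
  by move=> /tightP/eqP nv; rewrite subr_gt0 lt_neqAle nv py.
exists (m / B); first exact: divr_gt0.
move=> v; rewrite dotDl dotZl; have [vt|vt] := boolP (v \in tight y).
  have /tightP -> := vt; rewrite gerDl pmulr_rle0 ?divr_gt0 //; exact: hu.
have mv : m <= 1 - dot y (p v) by rewrite /m (bigD1 v) //= ge_min lexx.
have : m / B * dot u (p v) <= m.
  by rewrite mulrAC ler_pdivrMr // ler_wpM2l // ltW.
by move: mv; lra.
Qed.

(** By [polar_shift] and maximality of y, any u that is nonpositive on the tight set is nonpositive
    at x. As the tight points are independent, Farkas' lemma becomes linear algebra: [span_split]
    puts x in their span, and dual functionals show that its coefficients are nonnegative. *)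
Lemma gauge_cone x : exists2 y, polar y & exists c : V -> R,
  [/\ forall v, 0 <= c v, x = \sum_(v in tight y) c v *: p v & gauge x = \sum_(v in tight y) c v].
Proof.
have [y py [gx hx]] := gaugeP x; exists y => //.
have key u : (forall v, v \in tight y -> dot u (p v) <= 0) -> dot u x <= 0.
  move=> hu; have [t t0 /hx] := polar_shift py hu.
  by rewrite dotDl dotZl gx gerDl pmulr_rle0.
have [[c xE]|[u [u0 ux]]] := span_split p (tight y) x; last first.
  by move: ux; rewrite ltNge key // => v /u0 ->.
have c0 v0 : v0 \in tight y -> 0 <= c v0.
  move=> v0t; have [u hu] := indep_dual (fun v => - (v == v0)%:R) (p_ind py).
  have : dot u x <= 0.
    by apply: key => v vt; rewrite hu // oppr_le0; case: (v == v0).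
  rewrite xE dot_sumr (bigD1 v0) //= dotZr hu // eqxx big1 ?addr0 => [|v /andP[vt /negbTE nv]].
    by rewrite mulrN1 oppr_le0.
  by rewrite dotZr hu // nv oppr0 mulr0.
exists (fun v => if v \in tight y then c v else 0); split.
- by move=> v; case: ifP => // /c0.
- by rewrite xE; apply: eq_bigr => v ->.
rewrite gx xE dot_tight_combination //; first by apply: eq_bigr => v ->.
Qed.

Lemma gauge_gt0 x : x != 0 -> 0 < gauge x.
Proof.
move=> x0; have [y py [c [c0 xE ->]]] := gauge_cone x.
rewrite lt_neqAle sumr_ge0 // andbT eq_sym; apply: contra x0.
rewrite psumr_eq0 // => /allP h; rewrite xE big1 // => v vt.
by have := h v (mem_index_enum _); rewrite vt => /eqP ->; rewrite scale0r.
Qed.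

Lemma gaugeZ a x : 0 < a -> gauge (a *: x) = a * gauge x.
Proof.
move=> a0; have [y py [gx h]] := gaugeP x.
rewrite (gauge_eq py) ?dotZr ?gx // => y' py'; rewrite !dotZr ler_pM2l // -gx; exact: h.
Qed.

Lemma gauge_lipschitz : exists2 B : R, 0 < B & forall x x', `|gauge x - gauge x'| <= B * `|x - x'|.
Proof.
have [B B0 hB] := polar_bounded.
exists (d.+1%:R * B); first by rewrite mulr_gt0 // ltr0n.
have half x x' : gauge x - gauge x' <= d.+1%:R * B * `|x - x'|.
  have [y py [-> _]] := gaugeP x; have [_ _ [_ /(_ y py)]] := gaugeP x'.
  have := normr_dot_le (x - x') y; rewrite dotC dotBr => h1 h2.
  apply: (@le_trans _ _ (dot y x - dot y x')); first by rewrite lerD2l lerN2.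
  apply: le_trans (ler_norm _) (le_trans h1 _); rewrite ler_wpM2r //.
  apply: (@le_trans _ _ (\sum_(i < d.+1) B)); last by rewrite sumr_const card_ord mulr_natl.
  by apply: ler_sum => i _; apply: le_trans (normr_coord _ _) (hB _ py).
by move=> x x'; rewrite ler_norml half andbT lerNl opprB distrC half.
Qed.

Lemma gauge_continuous : continuous gauge.
Proof.
have [B B0 hB] := gauge_lipschitz.
move=> x; apply/(@cvgrPdist_lt _ _ _ (nbhs x) (nbhs_filter x)) => e e0; apply/nbhs_ballP.
exists (e / B) => [|z]; first by rewrite /= divr_gt0.
rewrite -ball_normE /= ltr_pdivlMr // mulrC => h.
exact: le_lt_trans (hB _ _) h.
Qed.

Lemma polyhedron_gauge x : polyhedron boundary x <-> gauge x = 1.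
Proof.
split=> [[F /bfacesP[F0 [y py Fy]] [c [c0 c1 xE]]]|gx].
  have yx : dot y x = 1 by rewrite xE dot_tight_combination.
  rewrite -yx; apply: gauge_eq => // y' py'; rewrite yx xE dot_sumr -c1.
  by apply: ler_sum => v vF; rewrite dotZr ler_piMr ?c0.
have [y py [c [c0 xE gE]]] := gauge_cone x.
exists (tight y); last by exists c; split => //; rewrite -gE.
apply/bfacesP; split; last by exists y.
apply/eqP => t0; move: gE; rewrite t0 big_set0 gx => /eqP.
by rewrite oner_eq0.
Qed.

Lemma boundary_triangulates : triangulates boundary (@unit_sphere R d).
Proof.
pose nrm (x : 'rV[R]_d.+1) := Num.sqrt (dot x x).
have nrm_gt0 x : x != 0 -> 0 < nrm x by move=> x0; rewrite sqrtr_gt0 dot_self_gt0.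
have nrmZ a x : 0 < a -> nrm (a *: x) = a * nrm x.
  move=> a0; rewrite /nrm dotZr dotZl mulrA -expr2 sqrtrM ?sqr_ge0 //.
  by rewrite sqrtr_sqr gtr0_norm.
have nrm_cont : continuous nrm.
  move=> x; apply: (@continuous_comp _ _ _ (fun x => dot x x) Num.sqrt).
    apply: continuous_bigsum => i _; apply: (@continuousM _ _ (fun z : 'rV[R]_d.+1 => z ord0 i) (fun z : 'rV[R]_d.+1 => z ord0 i)); exact: coord_continuous.
  exact: sqrt_continuous.
have sphereE x : unit_sphere x <-> nrm x = 1.
  rewrite /unit_sphere /nrm /=; have -> : \sum_(i < d.+1) x ord0 i ^+ 2 = dot x x by [].
  split=> [->|h]; first exact: sqrtr1.
  rewrite -[LHS]sqr_sqrtr ?h ?expr1n //.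
  by apply: sumr_ge0 => i _; rewrite -expr2 sqr_ge0.
have normal_cont (f : 'rV[R]_d.+1 -> R) x : continuous f -> f x != 0 ->
    {for x, continuous (fun z => (f z)^-1 *: z)}.
  move=> cf fx; have FF := nbhs_filter x.
  apply: (@cvgZ _ _ _ (nbhs x) FF (fun z => (f z)^-1) id); last exact: cvg_id.
  exact: (@continuousV _ _ f x fx (cf x)).
have nz0 (f : 'rV[R]_d.+1 -> R) x : f 0 = 0 -> f x = 1 -> x != 0.
  by move=> f0 fx; apply/eqP => x0; move: fx; rewrite x0 f0 => /eqP; rewrite eq_sym oner_eq0.
have g0 : gauge 0 = 0 by have [y _ [-> _]] := gaugeP 0; rewrite dot0r.
have n0 : nrm 0 = 0 by rewrite /nrm dot0r sqrtr0.
exists (fun x => (nrm x)^-1 *: x), (fun x => (gauge x)^-1 *: x); split.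
- split; apply: continuous_in_subspaceT => x /set_mem.
    move=> /polyhedron_gauge/(nz0 _ _ g0) x0; apply: normal_cont => //.
    by rewrite gt_eqF ?nrm_gt0.
  move=> /sphereE/(nz0 _ _ n0) x0; apply: normal_cont; first exact: gauge_continuous.
  by rewrite gt_eqF ?gauge_gt0.
- move=> x /polyhedron_gauge/(nz0 _ _ g0) /nrm_gt0 h; apply/sphereE.
  by rewrite nrmZ ?invr_gt0 // mulVf ?gt_eqF.
- move=> x /sphereE/(nz0 _ _ n0)/gauge_gt0 h; apply/polyhedron_gauge.
  by rewrite gaugeZ ?invr_gt0 // mulVf ?gt_eqF.
- move=> x /polyhedron_gauge gx; have h := nrm_gt0 _ (nz0 _ _ g0 gx).
  by rewrite gaugeZ ?invr_gt0 // gx mulr1 invrK scalerA divff ?scale1r ?gt_eqF.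
- move=> x /sphereE nx; have h := gauge_gt0 (nz0 _ _ n0 nx).
  by rewrite nrmZ ?invr_gt0 // nx mulr1 invrK scalerA divff ?scale1r ?gt_eqF.
Qed.

Lemma orthogonal_ex (F : {set V}) : (#|F| < d.+1)%N ->
  exists2 u, u != 0 & forall v, v \in F -> dot u (p v) = 0.
Proof.
move=> cF; pose M := \matrix_(i < #|F|) p (enum_val i).
have : kermx M^T != 0.
  rewrite kermx_eq0 /row_free mxrank_tr; apply: contraTN cF => /eqP e.
  by rewrite -leqNgt -e rank_leq_row.
move=> /rowV0Pn[u /sub_kermxP uM u0]; exists u => // v vF.
have /rowP/(_ (enum_rank_in vF v)) := uM; rewrite !mxE => e.
rewrite -[RHS]e; apply: eq_bigr => i _; by rewrite !mxE enum_rankK_in.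
Qed.

(** If F had at most d points, some u would vanish on it. Moving y along u up to the first further
    tight point, which exists by [p_pos], yields a strictly larger face. *)
Lemma maximal_bface F : maxset [pred G : {set V} | G \in bfaces] F ->
  exists2 y, polar y & F = tight y /\ (d < #|F|)%N.
Proof.
case/maxsetP => /= /bfacesP[F0 [y py Fy]] maxF.
have FE : F = tight y.
  apply/esym/maxF => //; apply/bfacesP; split; last by exists y.
  by apply: contra F0 => /eqP t0; rewrite -finset.subset0 -t0.
exists y => //; split => //; rewrite ltnNge; apply/negP => cF.
have [u u0 uF] := orthogonal_ex cF; have [v0 hv0] := p_pos u0.
case: (@arg_minP _ _ _ v0 (fun v => 0 < dot u (p v))
  (fun v => (1 - dot y (p v)) / dot u (p v)) hv0) => v hv minv.
set t := (1 - _) / dot u (p v) in minv.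
have t0 : 0 <= t by rewrite divr_ge0 ?subr_ge0 ?(ltW hv).
pose z := y + t *: u.
have pz : polar z.
  move=> w; rewrite /z dotDl dotZl; have [hw|hw] := ltP 0 (dot u (p w)).
    by have := minv _ hw; rewrite ler_pdivlMr // => h; rewrite addrC -lerBrDr.
  have : t * dot u (p w) <= 0 by rewrite mulr_ge0_le0.
  by have := py w; lra.
have zv : v \in tight z.
  by apply/tightP; rewrite /z dotDl dotZl /t mulfVK ?gt_eqF // addrC subrK.
have Fz : F \subset tight z.
  apply/fintype.subsetP => w wF; apply/tightP; rewrite /z dotDl dotZl uF // mulr0 addr0.
  by apply/tightP; rewrite -FE.
have tz : tight z = F.
  apply: maxF => //; apply/bfacesP; split; last by exists z.
  by apply/finset.set0Pn; exists v.
by move: hv; rewrite uF ?ltxx // -tz.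
Qed.

End Boundary.

(** * The complexes Q_n *)

Section Labels.
Variables (k d : nat).
Hypothesis k_gt0 : (0 < k)%N.
Notation n := (k.*2 + d)%N.

(** Ordinals start at 0 and the cycle at 1, hence the shift. The ambient m is kept apart from 2k + d
    so that labels can be typed by n. *)
Definition lset (m : nat) (c : ladder k d) : {set 'I_m} :=
  [set i : 'I_m | lab d 0 c i.+1]%SET.

Lemma cycle_adjE (i j : 'I_n) : cycle_adj i j ->
  [\/ j = i.+1 :> nat, i = j.+1 :> nat, (i.+1 = n /\ j = 0 :> nat)%N
    | (j.+1 = n /\ i = 0 :> nat)%N].
Proof.
have step (a b : 'I_n) : b = ordS a -> (b = a.+1 :> nat \/ (a.+1 = n /\ b = 0 :> nat))%N.
  move=> ->; rewrite /= ; have := ltn_ord a; rewrite leq_eqVlt => /orP[/eqP e|h].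
    by right; rewrite e modnn.
  by left; rewrite modn_small.
case/orP => /eqP /step[h|h]; [exact: Or41|exact: Or43|exact: Or42|exact: Or44].
Qed.

Lemma lset_in c : valid d 0 c -> lset n c \in schrijver_vertices n k.
Proof.
move=> /lab_stable[supp siz cons wrap].
have lab0 : lab d 0 c 0 = false by apply/negP => /supp[].
rewrite inE; apply/andP; split.
  apply/eqP; rewrite -[RHS]siz addn0 big_ord_recl /= lab0 add0n.
  rewrite -sum1_card big_mkcond; apply: eq_bigr => i _; rewrite inE /bump /= add1n.
  by case: (lab _ _ _ _).
apply/'forall_implyP => i; rewrite inE => li; apply/'forall_implyP => j; rewrite inE => lj.
have wr : lab d 0 c 1 -> lab d 0 c n -> False.
  by move=> h1 h2; apply: wrap h1 _; rewrite ?subn0 //; move: k_gt0; clear; lia.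
apply/negP => /cycle_adjE[e|e|[e1 e2]|[e1 e2]].
- by apply: (cons i.+1) => //; rewrite -e.
- by apply: (cons j.+1) => //; rewrite -e.
- by apply: wr; [rewrite e2 in lj|rewrite e1 in li].
- by apply: wr; [rewrite e2 in li|rewrite e1 in lj].
Qed.

Lemma lset_surjective A : A \in schrijver_vertices n k ->
  exists2 c, valid d 0 c & lset n c = A.
Proof.
rewrite inE => /andP[/eqP cA iA].
pose B (i : nat) := [exists x : 'I_n, (x \in A) && (x.+1 == i)%N].
have BS (x : 'I_n) : B x.+1 = (x \in A).
  apply/existsP/idP; last by move=> xA; exists x; rewrite xA eqxx.
  by case=> x' /andP[xA /eqP oo]; have <- : x' = x by apply: val_inj; case: oo.
have indA (a b : 'I_n) : a \in A -> b \in A -> b = ordS a -> False.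
  move=> aA bA e; have /'forall_implyP/(_ a aA)/'forall_implyP/(_ b bA) := iA.
  by rewrite /cycle_adj e eqxx.
have [|c vc cB] := @lab_surjective k d 0 B (leq0n k).
  split.
  - by move=> i /existsP[x /andP[xA /eqP xi]]; rewrite addn0 -xi.
  - rewrite addn0 big_ord_recl /=.
    have -> : B 0%N = false by apply/existsP => -[x /andP[]].
    rewrite add0n -[RHS]cA -sum1_card [RHS]big_mkcond /=; apply: eq_bigr => i _.
    by rewrite /bump /= add1n BS; case: (i \in A).
  - move=> i /existsP[x /andP[xA /eqP xi]] /existsP[x' /andP[x'A /eqP x'i]].
    apply: (indA x x' xA x'A); apply: val_inj => /=.
    have e : x' = x.+1 :> nat by move: xi x'i; clear; lia.
    by rewrite modn_small -e.
  - rewrite subn0 => n1 /existsP[x /andP[xA /eqP xi]] /existsP[x' /andP[x'A /eqP x'i]].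
    apply: (indA x' x x'A xA); apply: val_inj => /=; rewrite x'i modnn.
    by move: xi; clear; lia.
by exists c => //; apply/finset.setP => i; rewrite inE cB BS.
Qed.

Lemma lset_injective c c' : valid d 0 c -> valid d 0 c' -> lset n c = lset n c' -> c = c'.
Proof.
move=> vc vc' e; apply: (lab_injective vc vc') => i.
have supp (a : ladder k d) : valid d 0 a -> lab d 0 a i -> (0 < i <= n)%N.
  by move=> /lab_stable[h _ _ _] /h[i0]; rewrite addn0 i0.
have [|out] := boolP (0 < i <= n)%N.
  case: i {supp} => // i /= i_n; move/finset.setP/(_ (Ordinal i_n)): e.
  by rewrite !inE.
by apply/idP/idP => h; move: out; rewrite (supp _ _ h).
Qed.

Lemma widen_lset (c : ladder k d) : valid d 0 c ->
  widen_set n.+1 (lset n c) = [set i : 'I_n.+1 | lab d 0 c i.+1]%SET.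
Proof.
move=> /lab_stable[supp _ _ _]; apply/finset.setP => j; rewrite !inE.
apply/existsP/idP => [[i /andP[]]|lj].
  by rewrite inE => li /eqP <-.
have [_] := supp _ lj; rewrite addn0 => jn.
by exists (Ordinal jn); rewrite inE lj /=.
Qed.

End Labels.

(** * The coloured complex of one configuration *)

Section StageComplex.
Variables (R : realType) (k d : nat).
Variables (P : nat -> ladder k d -> 'rV[R]_d.+1) (w : nat -> 'rV[R]_d.+1).
Hypothesis k_gt0 : (0 < k)%N.
Hypothesis tp : top P w.

Definition cell : finType := {c : ladder k d | valid d 0 c}.

Definition signed (v : cell * bool) : 'rV[R]_d.+1 := sgb R v.2 *: P 0 (val v.1).

Lemma dot_signed y v : dot y (signed v) = sgb R v.2 * dot y (P 0 (val v.1)).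
Proof. exact: dotZr. Qed.

Lemma polar_signed y :
  polar signed y <-> forall c, valid d 0 c -> `|dot y (P 0 c)| <= 1.
Proof.
split=> [py c vc|h [[c vc] b]].
  have := py (Sub c vc, true); have := py (Sub c vc, false).
  by rewrite !dot_signed /sgb /= ler_norml; lra.
rewrite dot_signed; apply: le_trans (ler_norm _) _.
by rewrite normrM normr_sgb mul1r h.
Qed.

Lemma tight_black_opt y v : polar signed y -> v \in tight signed y ->
  val v.1 \in black_opt P (sgb R v.2 *: y).
Proof.
move=> /polar_signed py /tightP; rewrite dot_signed -dotZl => e.
apply/black_optP; split; first exact: (valP v.1).
by move=> c' vc'; rewrite e dotZl normrM normr_sgb mul1r py.
Qed.

Lemma tight_neq0 y v : v \in tight signed y -> y != 0.
Proof.
by move=> /tightP; apply: contra_eq_neq => ->; rewrite dot0l eq_sym oner_neq0.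
Qed.

Lemma sgb_neq0 b : sgb R b != 0.
Proof. by rewrite /sgb; case: b; rewrite ?oppr_eq0 oner_eq0. Qed.

Lemma signed_pos y : y != 0 -> exists v, 0 < dot y (signed v).
Proof.
move=> /(top_pos tp)[c vc hc]; exists (Sub c vc, 0 < dot y (P 0 c)).
rewrite dot_signed /= /sgb; have [h|h] := ltP 0 (dot y (P 0 c)); first by rewrite mul1r.
by rewrite mulN1r oppr_gt0 lt_neqAle hc.
Qed.

Lemma tight_inj y u v : u \in tight signed y -> v \in tight signed y ->
  val u.1 = val v.1 -> u = v.
Proof.
case: u v => [a b] [a' b'] /tightP + /tightP + /= e.
have -> : a' = a by apply: val_inj.
by rewrite !dot_signed /sgb; case: b; case: b' => //= h1 h2; exfalso; move: h1 h2; lra.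
Qed.

Lemma tight_abs_opt y v : polar signed y -> v \in tight signed y -> val v.1 \in abs_opt P y.
Proof.
move=> /polar_signed py /tightP; rewrite dot_signed => e.
apply/abs_optP; split=> [|c' vc']; first exact: (valP v.1).
suff -> : `|dot y (P 0 (val v.1))| = 1 by apply: py.
by rewrite -[RHS](normr1 R) -e normrM normr_sgb mul1r.
Qed.

(** A tight set holds at most one of p_c and -p_c, so a relation among signed points is one among
    the p_c with c in [abs_opt], with coefficients changed only by signs. *)
Lemma signed_ind y : polar signed y -> indep signed (tight signed y).
Proof.
move=> py a a0 v0 v0t; have y0 := tight_neq0 v0t.
pose T := tight signed y.
pose a' c := \sum_(v in T | val v.1 == c) a v * sgb R v.2.
have /(_ (val v0.1)) : forall c, c \in abs_opt P y -> a' c = 0.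
  apply: (top_ind tp y0); rewrite -[RHS]a0.
  rewrite (partition_big (fun v : cell * bool => val v.1) (mem (abs_opt P y))) /=; last first.
    by move=> v; apply: tight_abs_opt.
  apply: eq_bigr => c _; rewrite /a' scaler_suml; apply: eq_bigr => v /andP[_ /eqP <-].
  by rewrite /signed scalerA.
move=> /(_ (tight_abs_opt py v0t)); rewrite /a' (bigD1 v0) /=; last by rewrite v0t eqxx.
rewrite big1 ?addr0 => [/eqP|v /andP[/andP[vt /eqP e] nv]]; last first.
  by move: nv; rewrite (tight_inj vt v0t e) eqxx.
by rewrite mulf_eq0 (negbTE (sgb_neq0 _)) orbF => /eqP.
Qed.

Lemma black_opt_gt0 y c : y != 0 -> c \in black_opt P y -> 0 < dot y (P 0 c).
Proof.
move=> /(top_pos tp)[c' vc' h] /black_optP[_ /(_ c' vc')]; apply: lt_le_trans.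
by rewrite normr_gt0.
Qed.

Lemma signed_vtx v : exists2 y, polar signed y & dot y (signed v) = 1.
Proof.
case: v => -[c vc] b; have [y y0 cb] := top_vtx tp vc.
have M0 := black_opt_gt0 y0 cb; set M := dot y (P 0 c) in M0.
exists ((sgb R b / M) *: y).
  apply/polar_signed => c' vc'; rewrite dotZl normrM normrM normr_sgb mul1r normfV (gtr0_norm M0).
  by rewrite mulrC ler_pdivrMr // mul1r; have /black_optP[_] := cb; apply.
rewrite dot_signed dotZl /= -/M mulfVK ?gt_eqF // /sgb; by case: b; lra.
Qed.

Definition stage_complex : coloured_complex R d.+1 :=
  @ColouredComplex R d.+1 (boundary signed_ind signed_vtx) (fun v : cell * bool => v.2).

Lemma stage_antisymmetric : antisymmetric_complex stage_complex.
Proof.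
move=> [c b]; exists (c, ~~ b); split; last by case: b.
by rewrite /= /signed /sgb /=; case: b; rewrite ?scaleN1r ?scale1r ?opprK.
Qed.

Lemma stage_no_antipodal : no_antipodal_face stage_complex.
Proof.
move=> F /bfacesP[_ [y py /fintype.subsetP Fy]] u v /Fy/tightP hu /Fy/tightP hv /= e.
by move: hv; rewrite e dotNr hu; lra.
Qed.

Lemma stage_triangulates : triangulates stage_complex (@unit_sphere R d).
Proof. exact: (boundary_triangulates signed_pos signed_ind signed_vtx). Qed.

Lemma layer1_opt_gt0 y : (0 < #|layer_opt P 1 y|)%N.
Proof.
have [c vc] : exists c : ladder k d, valid d 1 c.
  case: d => [|d']; first by exists true; rewrite /= andbT orbC -leq_eqVlt.
  have [c vc] := valid_last_ex k d'; exists (ord_max, c) => /=.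
  by rewrite k_gt0.
rewrite card_gt0; apply/finset.set0Pn.
case: (@arg_maxP _ _ _ c (valid d 1) (fun c => dot y (P 1 c)) vc) => c1 v1 h.
by exists c1; apply/layer_optP.
Qed.

Lemma stage_not_monochromatic (F : {set vertex stage_complex}) :
  maximal_face F -> ~~ monochromatic F.
Proof.
move=> /(maximal_bface signed_pos)[y py [FE cF]]; apply/negP => mono.
have [v0 v0F] : exists v0, v0 \in F by apply/finset.set0Pn; rewrite -card_gt0; apply: leq_trans cF.
have v0t : v0 \in tight signed y by rewrite -FE.
have y0 := tight_neq0 v0t.
have col v : v \in F -> v.2 = v0.2.
  move=> vF; have /'forall_implyP/(_ v vF)/'forall_implyP/(_ v0 v0F) := mono.
  by move/eqP.
(* Changing the sign of y turns a white facet into a black one. *)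
pose y' := sgb R v0.2 *: y.
have y'0 : y' != 0 by rewrite scaler_eq0 negb_or sgb_neq0.
have FB : (#|F| <= #|black_opt P y'|)%N.
  rewrite -(@card_in_imset _ _ (fun v : cell * bool => val v.1)); last first.
    by rewrite FE => u v ut vt; apply: tight_inj ut vt.
  apply: subset_leq_card; apply/fintype.subsetP => _ /imsetP[v vF ->].
  by rewrite /y' -(col v vF); apply: tight_black_opt => //; rewrite -FE.
have := top_count tp y'0; have := layer1_opt_gt0 y'.
by move: (leq_trans cF FB); clear; lia.
Qed.

Definition stage_label (n : nat) (v : cell * bool) : {set 'I_n} := lset n (val v.1).

Lemma stage_labelled b :
  @bijectively_labelled _ _ stage_complex _ (@stage_label (k.*2 + d)) (schrijver_vertices (k.*2 + d) k) b.
Proof.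
split.
  move=> [a b1] [a' b2]; rewrite !inE => /eqP /= -> /eqP /= ->.
  by move=> /(lset_injective (valP a) (valP a')) e; congr (_, _); apply: val_inj.
apply/finset.setP => A; apply/imsetP/idP => [[v _ ->]|].
  by apply: lset_in => //; apply: valP.
move=> /lset_surjective[c vc <-]; exists (Sub c vc, b) => //.
by rewrite inE /= eqxx.
Qed.

Lemma stage_adj u v : black (c := stage_complex) u -> ~~ black (c := stage_complex) v ->
  @associated_graph _ _ stage_complex u v ->
  schrijver_adj k (@stage_label (k.*2 + d) u) (@stage_label (k.*2 + d) v).
Proof.
move=> bu bv /andP[_ /bfacesP[_ [y py /fintype.subsetP Fy]]].
have ut : u \in tight signed y by apply: Fy; rewrite !inE eqxx.
have vt : v \in tight signed y by apply: Fy; rewrite !inE eqxx orbT.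
have y0 := tight_neq0 ut.
apply/and3P; split; try by apply: lset_in => //; apply: valP.
rewrite finset.disjoints_subset; apply/fintype.subsetP => i; rewrite !inE => lu; apply/negP => lv.
have ub := tight_black_opt py ut; have vb := tight_black_opt py vt.
move: bu bv ub vb; rewrite /= => -> /negbTE -> ub vb.
have := top_sign tp _ ub lu; have := top_sign tp _ vb lv.
by rewrite !scaler_eq0 !negb_or !sgb_neq0 y0 !dotZl /sgb => /(_ isT) + /(_ isT); lra.
Qed.

End StageComplex.

(** * Inclusion of a complex in the next one *)

Section Extension.
Variables (R : realType) (k d : nat).
Variables (P : nat -> ladder k d -> 'rV[R]_d.+1) (w : nat -> 'rV[R]_d.+1).
Variables (Q : nat -> ladder k d.+1 -> 'rV[R]_d.+2) (v : nat -> 'rV[R]_d.+2).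
Hypothesis tP : top P w.
Hypothesis tQ : top Q v.
Hypothesis flat : forall C, Q 0 (ord0, C) = pt (P 0 C) 0.
Hypothesis ext : forall y C, y != 0 -> C \in black_opt P y -> (ord0, C) \in black_opt Q (pt y 0).

(** Head 0 at layer 0 gives an empty rim, so the labelled set is unchanged. *)
Definition lift_cell (c : cell k d) : cell k d.+1 :=
  Sub ((ord0, val c) : ladder k d.+1) (valP c).

Lemma ptZ n a (x : 'rV[R]_n) : a *: pt x 0 = pt (a *: x) 0.
Proof. by apply/rowP => i; rewrite !mxE; case: insubP => *; rewrite ?mxE ?mulr0. Qed.

Lemma stage_subcomplex :
  @labelled_subcomplex R _ _ _ _
    (stage_complex tP) (@stage_label k d (k.*2 + d))
    (stage_complex tQ) (@stage_label k d.+1 (k.*2 + d.+1)).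
Proof.
exists (fun u : cell k d * bool => (lift_cell u.1, u.2)); split.
- move=> [[a va] b] [[a' va'] b'] [e1 e2]; rewrite e2; congr (_, _).
  by apply: val_inj.
- by move=> u; rewrite /= /signed /= flat ptZ.
- by [].
- move=> [c b]; rewrite /stage_label /= addnS widen_lset; last exact: (valP c).
  apply/finset.setP => i; rewrite !inE /= /rim /=; case: (lab _ _ _ _); rewrite ?orbT ?orbF //.
  by rewrite andbF.
- move=> F /bfacesP[F0 [y py /fintype.subsetP Fy]]; apply/bfacesP.
  have [u0 u0F] := finset.set0Pn _ F0; split.
    by apply/finset.set0Pn; eexists; apply/imsetP; exists u0.
  have dotf u : dot (pt y 0) (signed Q (lift_cell u.1, u.2)) = dot y (signed P u).
    by rewrite !dot_signed /= flat dot_pt trunc_pt lastc_pt mul0r addr0.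
  exists (pt y 0); last first.
    apply/fintype.subsetP => _ /imsetP[u uF ->]; apply/tightP; rewrite dotf.
    by apply/tightP; apply: Fy.
  have u0t := Fy _ u0F; apply/polar_signed => c' vc'.
  have y0 : sgb R u0.2 *: y != 0 by rewrite scaler_eq0 negb_or sgb_neq0 (tight_neq0 u0t).
  have /black_optP[_ /(_ c' vc')] := ext y0 (tight_black_opt py u0t).
  rewrite -ptZ dotZl normrM normr_sgb mul1r => h; apply: le_trans h _.
  suff -> : dot (sgb R u0.2 *: pt y 0) (Q 0 (ord0, val u0.1)) = 1 by [].
  rewrite dotZl; transitivity (dot (pt y 0) (signed Q (lift_cell u0.1, u0.2))).
    by rewrite dot_signed.
  by rewrite dotf; apply/tightP.
Qed.

End Extension.

(** * The sequence of complexes *)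

Section Construction.
Variables (R : realType) (k : nat).
Hypothesis k_gt0 : (0 < k)%N.

Record stage (d : nat) := Stage {
  pts : nat -> ladder k d -> 'rV[R]_d.+1;
  wts : nat -> 'rV[R]_d.+1;
  stage_layers : layers pts wts;
  stage_top : top pts wts }.

Definition extends d (S : stage d) (T : stage d.+1) : Prop :=
  (forall C, pts T 0 (ord0, C) = pt (pts S 0 C) 0) /\
  (forall y C, y != 0 -> C \in black_opt (pts S) y -> (ord0, C) \in black_opt (pts T) (pt y 0)).

Lemma first_stage : exists S : stage 1, True.
Proof. by have [Q [v [lQ tQ]]] := base_step R k_gt0; exists (Stage lQ tQ). Qed.

Lemma next_stage d (S : stage d) : exists T : stage d.+1, extends S T.
Proof.
have [Q [v [lQ tQ fQ eQ]]] : exists (Q : nat -> ladder k d.+1 -> 'rV[R]_d.+2) (v : nat -> 'rV[R]_d.+2),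
  [/\ layers Q v, top Q v,
      ~~ false -> forall C, Q 0 (ord0, C) = pt (pts S 0 C) 0
    & forall y C, y != 0 -> C \in black_opt (pts S) y -> (ord0, C) \in black_opt Q (pt y 0)].
  have tS := stage_top S.
  apply: (step_exists k_gt0 (stage_layers S)) => //.
  - exact: top_pos tS.
  - exact: top_sign tS.
  - by move=> y y0; rewrite addn0; apply: top_count tS _ y0.
  - exact: top_vtx tS.
  - by move=> _; apply: top_ind tS.
by exists (Stage lQ tQ); split => //; apply: fQ.
Qed.

(** The index starts at dimension parameter 1: at 0 the two points of layer 0 are opposite on a
    line, so [top_ind] fails there. *)
Fixpoint stages (d : nat) : stage d.+1 :=
  if d is d'.+1 then projT1 (cid (next_stage (stages d'))) else projT1 (cid first_stage).

Lemma stages_extend d : extends (stages d) (stages d.+1).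
Proof. exact: projT2 (cid (next_stage (stages d))). Qed.

Definition empty_complex : coloured_complex R 1.
Proof.
refine (@ColouredComplex R 1 (@GeometricComplex R 1 void finset.set0 (of_void _) _ _ _ _ _) xpredT).
- by case.
- by move=> F; rewrite inE.
- by move=> F G; rewrite inE.
- by move=> F; rewrite inE.
- by move=> F G; rewrite inE.
Defined.

(* The argument m is n - 2k; m = 0 is a junk value. *)
Definition cplx (m : nat) : coloured_complex R m.+1 :=
  if m is d.+1 then stage_complex (stage_top (stages d)) else empty_complex.

Definition cplx_label (n m : nat) : vertex (cplx m) -> {set 'I_n} :=
  match m return vertex (cplx m) -> {set 'I_n} with
  | d.+1 => @stage_label k d.+1 n
  | 0 => fun _ => finset.set0
  end.

End Construction.

Theorem theorem4p1 (R : realType) (k : nat) (hk : (1 <= k)%N) :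
  exists (Q : forall n : nat, coloured_complex R (n - 2 * k).+1)
         (lab : forall n : nat, vertex (Q n) -> {set 'I_n}),
  forall n : nat, (2 * k + 1 <= n)%N ->
    (* the labelling of the black and of the white vertices *)
    (bijectively_labelled (lab n) (schrijver_vertices n k) true /\
     bijectively_labelled (lab n) (schrijver_vertices n k) false) /\
    (* (i) *)
    [/\ antisymmetric_complex (Q n),
        triangulates (Q n) (@unit_sphere R (n - 2 * k))
      & no_antipodal_face (Q n)] /\
    (* (ii) *)
    (forall F : {set vertex (Q n)}, maximal_face F -> ~~ monochromatic F) /\
    (* (iii) *)
    ((forall A : {set 'I_n}, A \in schrijver_vertices n k ->
        exists v : vertex (Q n), lab n v = A) /\
     (forall u v : vertex (Q n), black u -> ~~ black v ->
        associated_graph u v -> schrijver_adj k (lab n u) (lab n v))) /\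
    (* (iv) *)
    ((2 * k + 1 < n)%N ->
       antisymmetric_complex (Q n.-1) /\
       labelled_subcomplex (lab n.-1) (lab n)).
Proof.
exists (fun n => cplx R hk (n - 2 * k)), (fun n => @cplx_label R k hk n (n - 2 * k)) => n hn.
have [d nE] : exists d, (n = k.*2 + d.+1)%N.
  by exists (n - (2 * k + 1))%N; move: hn; clear; lia.
have dE : (n - 2 * k = d.+1)%N by move: nE; clear; lia.
have -> : (2 * k + 1 < n)%N = (0 < d)%N by move: nE; clear; lia.
have eE : (n.-1 - 2 * k = d)%N by move: nE; clear; lia.
have n1 : (n.-1 = k.*2 + d)%N by move: nE; clear; lia.
rewrite eE dE {dE eE hn}.
(* With n - 2k a successor and [n.-1] generalised, the types of the two complexes compute and the
   substitution goes through. *)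
move: n1; move: (n.-1) => n' n'E; subst n n'.
set tS := stage_top (stages R hk d).
have lbl b := stage_labelled hk tS b.
split; first by split; apply: lbl.
split; first by split; [exact: stage_antisymmetric|exact: stage_triangulates|
  exact: stage_no_antipodal].
split; first exact: stage_not_monochromatic.
split.
  split; last exact: stage_adj.
  move=> A hA; have [_ im] := lbl true; move: hA; rewrite -im => /imsetP[v _ ->].
  by exists v.
case: d {tS lbl} => // d _; split; first exact: stage_antisymmetric.
have [fl ex] := stages_extend R hk d; exact: stage_subcomplex.
Qed.
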